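(* Let $(\xi,f)$ be a pair with $\xi\in L^2_T$ $\mathcal F_T$-measurable and $f$ satisfying (B) (with $\mathbb H=\mathbb F$). Let $f^0$ satisfy (B) (with $\mathbb H=\mathbb F$), let $f^1$ satisfy (B1) (with $\mathbb H=\mathbb G$), and suppose that for a positive constant $C$, for all $t\in[0,T]$, all $(x_i,y_i,z_i)\in\mathbb R\times\mathbb R\times \widehat L^2(\ell)$, $i=1,2$, and all $\zeta\in\mathbb R$, $$|f(t,x_1,y_1,z_1)-f^0(t,x_2,y_2,z_2)|\le C\big(|x_1-x_2|+|y_1-y_2|+\|z_1-z_2\|\big),$$ $$|f(t,x_1,y_1,z_1)-f^1(t,x_2,y_2,z_2,\zeta)|\le C\big(|x_1-x_2|+|y_1-y_2|+\|z_1-z_2\|+|\zeta|\big).$$ For $\varepsilon>0$ let $\xi^0_\varepsilon\in L^2_T$ be $\mathcal F_T$-measurable and $\xi^1_\varepsilon\in L^2_T$ be $\mathcal G_T$-measurable, with $\xi^\rho_\varepsilon\to\xi$ in $L^2$ as $\varepsilon\to0$, $\rho=0,1$. Let $(X,Y,Z)$ be the solution of the original BSDEJ with data $(\xi,f)$, and let $(X^\rho_\varepsilon,Y^\rho_\varepsilon,Z^\rho_\varepsilon,\zeta^\rho_\varepsilon)$ be the solution of the approximating BSDEJ with data $(\xi^\rho_\varepsilon,f^\rho)$, for $\rho=0$ and $\rho=1$ (with $\zeta^0_\varepsilon\equiv0$). Then there is a positive constant $K$, not depending on $\varepsilon$, such that for all $t\in[0,T]$ and for $\rho=0$ and $\rho=1$,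 $$\mathbb E\Big[\int_t^T|X(s)-X^\rho_\varepsilon(s)|^2ds\Big]+\mathbb E\Big[\int_t^T|Y(s)-Y^\rho_\varepsilon(s)|^2ds\Big]+\mathbb E\Big[\int_t^T\int_{\mathbb R_0}|Z(s,z)-Z^\rho_\varepsilon(s,z)|^2\ell(dz)ds\Big]+\mathbb E\Big[\int_t^T|\zeta^\rho_\varepsilon(s)|^2ds\Big]\le K\,\mathbb E[|\xi-\xi^\rho_\varepsilon|^2].$$
   Context: $(\Omega,\mathcal F,\mathbb P)$ is a complete probability space, $T>0$, $\mathbb R_0=\mathbb R\setminus\{0\}$. $W,B$ are independent standard Brownian motions on $[0,T]$ and $N(dt,dz)$ is a Poisson random measure on $[0,T]\times\mathbb R_0$, independent of $W,B$, with $\mathbb E[N(dt,dz)]=\ell(dz)dt$, where $\int_{\mathbb R_0}z^2\ell(dz)<\infty$; $\widetilde N(dt,dz)=N(dt,dz)-\ell(dz)dt$. $\mathbb F=(\mathcal F_t)$ is the $\mathbb P$-augmented filtration generated by $W$ and $\widetilde N$; $\mathbb G=(\mathcal G_t)$ is the $\mathbb P$-augmented filtration generated by $W$, $B$ and $\widetilde N$. $\mathbb H$ denotes $\mathbb F$ or $\mathbb G$. Spaces: $L^2_T$ is the space of square integrable $\mathcal H_T$-measurable random variables; $H^2_T$ the $\mathbb H$-predictable processes $\phi$ with $\mathbb E\int_0^T|\phi(t)|^2dt<\infty$; $\widehat H^2_T$ the $\mathbb H$-predictable $\theta:\Omega\times[0,T]\times\mathbb R_0\to\mathbb R$ with $\mathbb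 E\int_0^T\int_{\mathbb R_0}|\theta(t,z)|^2\ell(dz)dt<\infty$; $S^2_T$ the $\mathbb H$-adapted càdlàg processes $\gamma$ with $\mathbb E[\sup_{0\le t\le T}|\gamma(t)|^2]<\infty$. $\nu=S^2_T\times H^2_T\times\widehat H^2_T$, $\widetilde\nu=S^2_T\times H^2_T\times\widehat H^2_T\times H^2_T$. $\widehat L^2(\ell)$ is the space of Borel $\psi:\mathbb R_0\to\mathbb R$ with $\|\psi\|^2=\int_{\mathbb R_0}|\psi(z)|^2\ell(dz)<\infty$. (B) for $f:\Omega\times[0,T]\times\mathbb R\times\mathbb R\times\widehat L^2(\ell)\to\mathbb R$: $f(\cdot,x,y,z)$ is $\mathbb H$-progressively measurable for all $x,y,z$; $f(\cdot,0,0,0)\in H^2_T$; there is a constant $C$ with $|f(t,x_1,y_1,z_1)-f(t,x_2,y_2,z_2)|\le C(|x_1-x_2|+|y_1-y_2|+\|z_1-z_2\|)$ for all $t$ and all arguments. (B1) for $f^1:\Omega\times[0,T]\times\mathbb R\times\mathbb R\times\widehat L^2(\ell)\times\mathbb R\to\mathbb R$: the same three requirements with the additional real argument $\zeta$ ($\mathbb H$-progressive measurability for fixed $(x,y,z,\zeta)$, $f^1(\cdot,0,0,0,0)\in H_T^2$, uniform Lipschitz continuity in $(x,y,z,\zeta)$). Original BSDEJ with data $(\xi,f)$ ($\mathbb H=\mathbb F$, solution $(X,Y,Z)\in\nu$): $-dX(t)=f(t,X(t),Y(t),Z(t,\cdot))dt-Y(t)dW(t)-\int_{\mathbb R_0}Z(t,z)\widetilde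 N(dt,dz)$, $X(T)=\xi$. Approximating BSDEJ, $\rho=0$ ($\mathbb H=\mathbb F$, solution in $\nu$): $-dX^0_\varepsilon(t)=f^0(t,X^0_\varepsilon(t),Y^0_\varepsilon(t),Z^0_\varepsilon(t,\cdot))dt-Y^0_\varepsilon(t)dW(t)-\int_{\mathbb R_0}Z^0_\varepsilon(t,z)\widetilde N(dt,dz)$, $X^0_\varepsilon(T)=\xi^0_\varepsilon$, and $\zeta^0_\varepsilon:=0$. Approximating BSDEJ, $\rho=1$ ($\mathbb H=\mathbb G$, solution in $\widetilde\nu$): $-dX^1_\varepsilon(t)=f^1(t,X^1_\varepsilon(t),Y^1_\varepsilon(t),Z^1_\varepsilon(t,\cdot),\zeta^1_\varepsilon(t))dt-Y^1_\varepsilon(t)dW(t)-\int_{\mathbb R_0}Z^1_\varepsilon(t,z)\widetilde N(dt,dz)-\zeta^1_\varepsilon(t)dB(t)$, $X^1_\varepsilon(T)=\xi^1_\varepsilon$. *)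

(* Defs.v *)
From HB Require Import structures.
From mathcomp Require Import all_boot all_order all_algebra.
From mathcomp Require Import all_classical all_reals all_analysis.
From mathcomp Require Import measurable_realfun.
Set Implicit Arguments.
Unset Strict Implicit.
Unset Printing Implicit Defensive.
Import Order.TTheory GRing.Theory Num.Theory.
Import numFieldNormedType.Exports.
Local Open Scope classical_set_scope.
Local Open Scope ring_scope.

(* Conventions.
   - A process on [0, T] is a map phi : R -> Omega -> R (time first); only its
     values at times in [0, T] are ever used.
   - A measure on R \ {0} is a measure on R; only its trace on Rstar is ever
     used, so that its mass at 0 is irrelevant.  Likewise, functions on R \ {0}
     are functions on R of which only the restriction to Rstar matters.
   - Path properties and the inequalities between random functions hold
     P-almost surely. *)

Section sigma_algebras.
Context {R : realType} {d : measure_display} {Omega : measurableType d}.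
Variable P : probability Omega R.
Implicit Types (T t : R) (H : R -> set (set Omega)).

Definition Rstar : set R := [set z | z != 0].

(* The traces on D of the events { f \in A }, A measurable. *)
Definition events_on {U : Type} {d' : measure_display} {V : measurableType d'}
    (D : set U) (f : U -> V) : set (set U) :=
  preimage_set_system D f measurable.

Definition indep2 (G1 G2 : set (set Omega)) :=
  forall A1 A2, G1 A1 -> G2 A2 -> P (A1 `&` A2) = (P A1 * P A2)%E.

(* When each Gi is a sigma-algebra, taking some Ai = Omega yields the product
   rule for the subfamilies of two, so that this is mutual independence. *)
Definition indep3 (G1 G2 G3 : set (set Omega)) :=
  forall A1 A2 A3, G1 A1 -> G2 A2 -> G3 A3 ->
    P (A1 `&` A2 `&` A3) = (P A1 * P A2 * P A3)%E.

Definition augmented (E : R -> set (set Omega)) (t : R) : set (set Omega) :=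
  <<s E t `|` P.-negligible>>.

Definition adapted T H (phi : R -> Omega -> R) :=
  forall t : R, 0 <= t <= T -> events_on setT (phi t) `<=` H t.

Definition progressive T H (phi : R -> Omega -> R) :=
  forall t : R, 0 <= t <= T ->
    events_on (setT `*` `[0, t]) (fun p : Omega * R => phi p.2 p.1) `<=`
    <<s setT `*` `[0, t],
        [set A `*` S | A in H t & S in [set S : set R | measurable S /\ S `<=` `[0, t]]] >>.

Definition predictable_sets T H : set (set (Omega * R)) :=
  <<s setT `*` `[0, T],
      [set A `*` [set 0] | A in H 0] `|`
      [set C | exists (s t : R) A, [/\ 0 <= s, s < t, t <= T, H s A &
                                 C = A `*` `]s, t] ]] >>.

Definition predictable T H (phi : R -> Omega -> R) :=
  events_on (setT `*` `[0, T]) (fun p : Omega * R => phi p.2 p.1) `<=`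
  predictable_sets T H.

Definition predictable_field T H (theta : R -> Omega -> R -> R) :=
  events_on ((setT `*` `[0, T]) `*` Rstar)
            (fun p : (Omega * R) * R => theta p.1.2 p.1.1 p.2) `<=`
  <<s (setT `*` `[0, T]) `*` Rstar,
      [set C `*` S | C in predictable_sets T H &
                     S in [set S : set R | measurable S /\ S `<=` Rstar]] >>.

End sigma_algebras.

Section noises.
Context {R : realType} {d : measure_display} {Omega : measurableType d}.
Variables (P : probability Omega R) (T : R).
Notation leb := (@lebesgue_measure R).

Definition brownian_events (W : R -> Omega -> R) (t : R) : set (set Omega) :=
  \bigcup_(s in `[0, t]) events_on setT (W s).

Definition standard_brownian (W : R -> Omega -> R) :=
  [/\ (forall t : R, 0 <= t <= T -> measurable_fun setT (W t)),
      {ae P, forall w, W 0 w = 0},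
      {ae P, forall w, {within `[0, T], continuous (W ^~ w)}},
      (forall s t : R, 0 <= s -> s < t -> t <= T ->
         indep2 P <<s brownian_events W s>>
                  (events_on setT (fun w => W t w - W s w))) &
      (forall s t : R, 0 <= s -> s < t -> t <= T ->
         forall A : set R, measurable A ->
           P [set w | A (W t w - W s w)] = normal_prob 0 (Num.sqrt (t - s)) A)].

Variable l : {measure set R -> \bar R}.

(* The measure dt l(dz) of a subset C of [0, T] x Rstar. *)
Definition intensity (C : set (R * R)) : \bar R :=
  (\int[leb]_(t in `[0%R, T]) l (xsection C t `&` Rstar))%E.

(* The law of N(C) is written out rather than taken from poisson_pmf because
   the latter is not a probability mass function at rate 0. *)
Definition poisson_random_measure
    (N : Omega -> {measure set (R * R)%type -> \bar R}) :=
  [/\ (forall C, measurable C -> C `<=` `[0, T] `*` Rstar ->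
         measurable_fun setT (fun w => N w C)),
      (forall C, measurable C -> C `<=` `[0, T] `*` Rstar ->
         (intensity C < +oo)%E -> forall k : nat,
         P [set w | N w C = k%:R%:E] =
         (expR (- fine (intensity C)) * fine (intensity C) ^+ k / k`!%:R)%:E) &
      (forall (n : nat) (C : 'I_n -> set (R * R)) (A : 'I_n -> set (\bar R)),
         (forall i, measurable (C i) /\ C i `<=` `[0, T] `*` Rstar) ->
         trivIset setT C -> (forall i, measurable (A i)) ->
         P (\bigcap_(i in setT) [set w | A i (N w (C i))]) =
         (\prod_(i < n) P [set w | A i (N w (C i))])%E)].

Definition poisson_events
    (N : Omega -> {measure set (R * R)%type -> \bar R}) : set (set Omega) :=
  \bigcup_(C in [set C | measurable C /\ C `<=` `[0, T] `*` Rstar])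
    events_on setT (fun w => N w C).

(* Meaningful for intensity C < +oo, in which case N(C) is a.s. finite. *)
Definition compensated (N : Omega -> {measure set (R * R)%type -> \bar R})
    (C : set (R * R)) (w : Omega) : R :=
  fine (N w C) - fine (intensity C).

Definition compensated_events
    (N : Omega -> {measure set (R * R)%type -> \bar R}) (t : R) : set (set Omega) :=
  \bigcup_(C in [set C | [/\ measurable C, C `<=` `[0, t] `*` Rstar &
                             (intensity C < +oo)%E]])
    events_on setT (compensated N C).

Definition filtF (W : R -> Omega -> R)
    (N : Omega -> {measure set (R * R)%type -> \bar R}) : R -> set (set Omega) :=
  augmented P (fun t => brownian_events W t `|` compensated_events N t).

Definition filtG (W B : R -> Omega -> R)
    (N : Omega -> {measure set (R * R)%type -> \bar R}) : R -> set (set Omega) :=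
  augmented P (fun t => brownian_events W t `|` brownian_events B t
                        `|` compensated_events N t).

End noises.

Section spaces.
Context {R : realType} {d : measure_display} {Omega : measurableType d}.
Variables (P : probability Omega R) (T : R) (l : {measure set R -> \bar R}).
Variable H : R -> set (set Omega).
Notation leb := (@lebesgue_measure R).

Definition L2T (xi : Omega -> R) :=
  events_on setT xi `<=` H T /\ ('E_P[fun w => (xi w ^+ 2)%R] < +oo)%E.

Definition sqnormH (t u : R) (phi : R -> Omega -> R) : \bar R :=
  (\int[P]_w \int[leb]_(s in `[t, u]) ((phi s w) ^+ 2)%:E)%E.

Definition sqnormHhat (t u : R) (theta : R -> Omega -> R -> R) : \bar R :=
  (\int[P]_w \int[leb]_(s in `[t, u])
     \int[l]_(z in Rstar) ((theta s w z) ^+ 2)%:E)%E.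

Definition H2T (phi : R -> Omega -> R) :=
  predictable T H phi /\ (sqnormH 0 T phi < +oo)%E.

Definition Hhat2T (theta : R -> Omega -> R -> R) :=
  predictable_field T H theta /\ (sqnormHhat 0 T theta < +oo)%E.

Definition cadlag (x : R -> R) :=
  (forall t : R, 0 <= t < T -> x s @[s --> t^'+] --> x t) /\
  (forall t : R, 0 < t <= T -> cvg (x s @[s --> t^'-])).

Definition S2T (gamma : R -> Omega -> R) :=
  [/\ adapted T H gamma,
      {ae P, forall w, cadlag (gamma ^~ w)} &
      (\int[P]_w ereal_sup [set ((gamma t w) ^+ 2)%:E | t in `[0%R, T]] < +oo)%E].

Definition L2l (psi : R -> R) :=
  measurable_fun Rstar psi /\ (\int[l]_(z in Rstar) ((psi z) ^+ 2)%:E < +oo)%E.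

Definition norml (psi : R -> R) : R :=
  Num.sqrt (fine (\int[l]_(z in Rstar) ((psi z) ^+ 2)%:E)%E).

Definition driverB (f : R -> Omega -> R -> R -> (R -> R) -> R) :=
  [/\ (forall x y z, L2l z -> progressive T H (fun t w => f t w x y z)),
      H2T (fun t w => f t w 0 0 (cst 0)) &
      exists C : R, {ae P, forall w, forall t : R, 0 <= t <= T ->
        forall x1 x2 y1 y2 z1 z2, L2l z1 -> L2l z2 ->
        `|f t w x1 y1 z1 - f t w x2 y2 z2|
          <= C * (`|x1 - x2| + `|y1 - y2| + norml (z1 \- z2))}].

Definition driverB1 (f : R -> Omega -> R -> R -> (R -> R) -> R -> R) :=
  [/\ (forall x y z zeta, L2l z -> progressive T H (fun t w => f t w x y z zeta)),
      H2T (fun t w => f t w 0 0 (cst 0) 0) &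
      exists C : R, {ae P, forall w, forall t : R, 0 <= t <= T ->
        forall x1 x2 y1 y2 z1 z2 zeta1 zeta2, L2l z1 -> L2l z2 ->
        `|f t w x1 y1 z1 zeta1 - f t w x2 y2 z2 zeta2|
          <= C * (`|x1 - x2| + `|y1 - y2| + norml (z1 \- z2)
                  + `|zeta1 - zeta2|)}].

End spaces.

Section stochastic_integrals.
Context {R : realType} {d : measure_display} {Omega : measurableType d}.
Variables (P : probability Omega R) (T : R) (l : {measure set R -> \bar R}).
Variable H : R -> set (set Omega).

Definition simple_coef (a b : R) (c : Omega -> R) :=
  [/\ 0 <= a, a <= b, b <= T, events_on setT c `<=` H a &
      exists M : R, forall w, `|c w| <= M].

(* \sum_i coef_i 1_]left_i, right_i](t) *)
Record simple_process := SimpleProcess {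
  sp_size : nat;
  sp_left : 'I_sp_size -> R;
  sp_right : 'I_sp_size -> R;
  sp_coef : 'I_sp_size -> Omega -> R;
  sp_ok : forall i, simple_coef (sp_left i) (sp_right i) (sp_coef i) }.

Definition sp_val (phi : simple_process) (t : R) (w : Omega) : R :=
  \sum_(i < sp_size phi) sp_coef i w * \1_(`]sp_left i, sp_right i]) t.

Definition sp_integral (W : R -> Omega -> R) (phi : simple_process)
    (t : R) (w : Omega) : R :=
  \sum_(i < sp_size phi)
    sp_coef i w * (W (Num.min (sp_right i) t) w - W (Num.min (sp_left i) t) w).

(* M is, up to modification, the process t |-> \int_0^t phi dW: the L^2 limit of
   the integrals of simple processes that converge to phi in H^2_T. *)
Definition ito_integral (W : R -> Omega -> R) (phi M : R -> Omega -> R) :=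
  exists phin : nat -> simple_process,
    sqnormH P 0 T (fun t w => sp_val (phin n) t w - phi t w)
      @[n --> \oo] --> 0%E /\
    (forall t : R, 0 <= t <= T -> measurable_fun setT (M t) /\
      'E_P[fun w => ((sp_integral W (phin n) t w - M t w) ^+ 2)%R]%E
        @[n --> \oo] --> 0%E).

(* \sum_i coef_i 1_]left_i, right_i](t) 1_mark_i(z) *)
Record simple_field := SimpleField {
  sf_size : nat;
  sf_left : 'I_sf_size -> R;
  sf_right : 'I_sf_size -> R;
  sf_coef : 'I_sf_size -> Omega -> R;
  sf_mark : 'I_sf_size -> set R;
  sf_ok : forall i, simple_coef (sf_left i) (sf_right i) (sf_coef i);
  sf_mark_ok : forall i, [/\ measurable (sf_mark i), sf_mark i `<=` Rstar &
                             (l (sf_mark i) < +oo)%E] }.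

Definition sf_val (theta : simple_field) (t : R) (w : Omega) (z : R) : R :=
  \sum_(i < sf_size theta)
    sf_coef i w * \1_(`]sf_left i, sf_right i]) t * \1_(sf_mark i) z.

Definition sf_integral (N : Omega -> {measure set (R * R)%type -> \bar R})
    (theta : simple_field) (t : R) (w : Omega) : R :=
  \sum_(i < sf_size theta)
    sf_coef i w *
    compensated T l N
      (`]Num.min (sf_left i) t, Num.min (sf_right i) t] `*` sf_mark i) w.

(* M is, up to modification, the process
   t |-> \int_0^t \int_Rstar theta(s, z) Ntilde(ds, dz). *)
Definition jump_integral (N : Omega -> {measure set (R * R)%type -> \bar R})
    (theta : R -> Omega -> R -> R) (M : R -> Omega -> R) :=
  exists thetan : nat -> simple_field,
    sqnormHhat P l 0 T (fun t w z => sf_val (thetan n) t w z - theta t w z)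
      @[n --> \oo] --> 0%E /\
    (forall t : R, 0 <= t <= T -> measurable_fun setT (M t) /\
      'E_P[fun w => ((sf_integral N (thetan n) t w - M t w) ^+ 2)%R]%E
        @[n --> \oo] --> 0%E).

End stochastic_integrals.

Section bsdes.
Context {R : realType} {d : measure_display} {Omega : measurableType d}.
Variables (P : probability Omega R) (T : R) (l : {measure set R -> \bar R}).
Variables (W B : R -> Omega -> R).
Variable N : Omega -> {measure set (R * R)%type -> \bar R}.
Notation leb := (@lebesgue_measure R).

(* Both equations are written in integrated form between t and T.  The almost
   sure integrability of the driver along the solution gives meaning to the
   ds-integral, since Rintegral is total.  The driver is only defined on L2l,
   to which Z(s, .) belongs for almost every (s, w) when Z is in Hhat2T: the
   exceptional times, a null set, are left out of the ds-integral. *)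

Definition proper_times (Z : R -> Omega -> R -> R) (t : R) (w : Omega) : set R :=
  `[t, T] `&` [set s | L2l l (Z s w)].

Definition bsdej (xi : Omega -> R) (f : R -> Omega -> R -> R -> (R -> R) -> R)
    (X Y : R -> Omega -> R) (Z : R -> Omega -> R -> R) :=
  let H := filtF P T l W N in
  let drift w s := f s w (X s w) (Y s w) (Z s w) in
  [/\ S2T P T H X, H2T P T H Y, Hhat2T P T l H Z,
      {ae P, forall w, leb.-integrable (proper_times Z 0 w) (EFin \o drift w)} &
      exists MY MZ : R -> Omega -> R,
        [/\ ito_integral P T H W Y MY, jump_integral P T l H N Z MZ &
            forall t : R, 0 <= t <= T -> {ae P, forall w,
              X t w = xi w + \int[leb]_(s in proper_times Z t w) drift w s
                      - (MY T w - MY t w) - (MZ T w - MZ t w)}]].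

Definition bsdej1 (xi : Omega -> R)
    (f : R -> Omega -> R -> R -> (R -> R) -> R -> R)
    (X Y : R -> Omega -> R) (Z : R -> Omega -> R -> R) (zeta : R -> Omega -> R) :=
  let H := filtG P T l W B N in
  let drift w s := f s w (X s w) (Y s w) (Z s w) (zeta s w) in
  [/\ [/\ S2T P T H X, H2T P T H Y, Hhat2T P T l H Z & H2T P T H zeta],
      {ae P, forall w, leb.-integrable (proper_times Z 0 w) (EFin \o drift w)} &
      exists MY MZ Mzeta : R -> Omega -> R,
        [/\ ito_integral P T H W Y MY, jump_integral P T l H N Z MZ,
            ito_integral P T H B zeta Mzeta &
            forall t : R, 0 <= t <= T -> {ae P, forall w,
              X t w = xi w + \int[leb]_(s in proper_times Z t w) drift w s
                      - (MY T w - MY t w) - (MZ T w - MZ t w)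
                      - (Mzeta T w - Mzeta t w)}]].

Definition bsde_error (t : R) (X Y : R -> Omega -> R) (Z : R -> Omega -> R -> R)
    (X' Y' : R -> Omega -> R) (Z' : R -> Omega -> R -> R)
    (zeta' : R -> Omega -> R) : \bar R :=
  (sqnormH P t T (fun s w => X s w - X' s w)%R
   + sqnormH P t T (fun s w => Y s w - Y' s w)%R
   + sqnormHhat P l t T (fun s w z => Z s w z - Z' s w z)%R
   + sqnormH P t T zeta')%E.

End bsdes.

(* Main.v *)
(* For the differences x, y, z, zeta of the components of two solutions, put a(t) = E x(t)^2 and
   let A(t, u), Q(t, u) be the expected integrals over [t, u] of x^2 and of
   y^2 + ||z||^2 + zeta^2.  The equations say that x(t) plus the increment over [t, u] of the
   stochastic integrals equals x(u) plus the increment of the drift.  By the Ito isometry the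
   left-hand side has second moment a(t) + Q(t, u) (passing from simple to general integrands
   with (a + b)^2 <= 2 a^2 + 2 b^2 costs a harmless factor 4), while by Cauchy-Schwarz and the
   Lipschitz bound the increment of the drift has second moment at most
   4 C^2 (u - t) (A(t, u) + Q(t, u)).  On a short interval this term is absorbed, so that a(t),
   A(t, u) and Q(t, u) are bounded by multiples of a(u); finitely many such steps, whose number
   depends only on C and T, lead to the terminal condition.  No Ito formula is needed.
   Everything takes place in the larger filtration, where a solution for the smaller one is a
   solution with zeta = 0. *)

(* Two questions of measurability shape the proof. The components [X] are adapted with cadlag paths,
   not predictable, so Tonelli is applied to a jointly measurable version of the difference,
   obtained by discretising time from the right. The drift along a solution is integrable path by
   path, but the equations give no joint measurability in [(s, w)]; hence Cauchy-Schwarz is stated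
   for a single path, and its right-hand side is a jointly measurable majorant supplied by the
   Lipschitz bound. The isometry is derived from the laws and the independence of the noises. [W],
   [B] and the compensated measures of all mark sets form one family with covariance rates
   [noise_cov], so that products of integrals against different noises are treated together;
   products of independent factors take the place of conditional expectations. Of general stochastic
   integrals only a lower bound is used, with one simple integrand for each tolerance. Constants:
   separating [x(u)] from the drift turns the factor 4 into 8, the drift then carries
   [8 * 4 * C ^+ 2], and the step length makes its coefficient at most one half. *)
Require Import Defs.
From HB Require Import structures.
From mathcomp Require Import all_boot all_order all_algebra.
From mathcomp Require Import all_classical all_reals all_analysis.
From mathcomp Require Import measurable_realfun ring lra.
Import Order.TTheory GRing.Theory Num.Theory.
Import numFieldNormedType.Exports.
Local Open Scope classical_set_scope.
Local Open Scope ring_scope.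

(** * Square-integrable random variables *)

Section square_integrable.
Context {R : realType} {d : measure_display} {Omega : measurableType d}.
Variable P : probability Omega R.
Implicit Types X Y c : Omega -> R.

Definition rint X := P.-integrable setT (EFin \o X).

(** Measurability is asked separately: that of [X ^+ 2] does not control the sign of [X]. *)
Definition sqint X := measurable_fun setT X /\ rint (fun w => X w ^+ 2).

Definition bounded_rv X := measurable_fun setT X /\ exists M : R, forall w, `|X w| <= M.

End square_integrable.

Section square_integrable_theory.
Context {R : realType} {d : measure_display} {Omega : measurableType d}.
Context {P : probability Omega R}.
Implicit Types X Y c : Omega -> R.
Local Notation rint := (rint P).
Local Notation sqint := (sqint P).

Lemma rint_measurable {X} : rint X -> measurable_fun setT X.
Proof. by move=> /measurable_int /measurable_EFinP. Qed.

Lemma rintD {X Y} : rint X -> rint Y -> rint (fun w => X w + Y w).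
Proof. by move=> iX iY; exact: (integrableD measurableT iX iY). Qed.

Lemma rintB {X Y} : rint X -> rint Y -> rint (fun w => X w - Y w).
Proof. by move=> iX iY; exact: (integrableB measurableT iX iY). Qed.

Lemma rintZ k {X} : rint X -> rint (fun w => k * X w).
Proof. by move=> iX; exact: (@integrableZl _ _ _ P setT measurableT k (EFin \o X)). Qed.

Lemma rint_cst k : rint (fun=> k).
Proof. exact: finite_measure_integrable_cst. Qed.

Lemma rint_sum I (s : seq I) (X : I -> Omega -> R) :
  (forall i, rint (X i)) -> rint (fun w => \sum_(i <- s) X i w).
Proof.
move=> iX; elim: s => [|i s ih].
  by under [X in rint X]eq_fun do rewrite big_nil; exact: rint_cst.
under [X in rint X]eq_fun do rewrite big_cons.
exact: rintD.
Qed.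

Lemma rint_le {X Y} : measurable_fun setT X -> rint Y ->
  (forall w, `|X w| <= Y w) -> rint X.
Proof.
move=> mX iY XY; apply: le_integrable iY => //; first exact/measurable_EFinP.
by move=> w _ /=; rewrite lee_fin (le_trans (XY w)) ?ler_norm.
Qed.

Lemma sqint_mul {X Y} : sqint X -> sqint Y -> rint (fun w => X w * Y w).
Proof.
move=> [mX iX] [mY iY]; apply: (@rint_le _ (fun w => X w ^+ 2 + Y w ^+ 2)).
- exact: measurable_funM.
- exact: rintD.
move=> w; rewrite normrM -[X w ^+ 2]real_normK ?num_real//.
rewrite -[Y w ^+ 2]real_normK ?num_real//.
by have := sqr_ge0 (`|X w| - `|Y w|); have := normr_ge0 (X w);
  have := normr_ge0 (Y w); nra.
Qed.

Lemma sqint_cst k : sqint (fun=> k).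
Proof. by split => //; exact: rint_cst. Qed.

Lemma sqint_rint {X} : sqint X -> rint X.
Proof.
move=> sX; have := sqint_mul (sqint_cst 1) sX.
by under [X in rint X]eq_fun do rewrite mul1r.
Qed.

Lemma sqintD {X Y} : sqint X -> sqint Y -> sqint (fun w => X w + Y w).
Proof.
move=> sX sY; split; first by apply: measurable_funD; [case: sX|case: sY].
have -> : (fun w => (X w + Y w) ^+ 2) =
  (fun w => X w ^+ 2 + 2 * (X w * Y w) + Y w ^+ 2).
  by apply/funext => w; ring.
apply: rintD; last by case: sY.
apply: rintD; first by case: sX.
exact/rintZ/sqint_mul.
Qed.

Lemma sqint_bmul {c X} : bounded_rv c -> sqint X -> sqint (fun w => c w * X w).
Proof.
move=> [mc [M cM]] [mX iX]; split; first exact: measurable_funM.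
apply: (@rint_le _ (fun w => M ^+ 2 * X w ^+ 2)).
- by apply: measurable_funX; exact: measurable_funM.
- exact: rintZ.
move=> w; rewrite exprMn ger0_norm; last by apply: mulr_ge0; exact: sqr_ge0.
rewrite ler_wpM2r ?sqr_ge0// -[c w ^+ 2]real_normK ?num_real//.
by rewrite lerXn2r ?nnegrE ?normr_ge0// (le_trans _ (cM w)) ?normr_ge0.
Qed.

Lemma bounded_cst (k : R) : bounded_rv (fun _ : Omega => k).
Proof. by split => //; exists `|k|. Qed.

Lemma boundedM {c X} : bounded_rv c -> bounded_rv X -> bounded_rv (fun w => c w * X w).
Proof.
move=> [mc [M cM]] [mX [K XK]]; split; first exact: measurable_funM.
by exists (M * K) => w; rewrite normrM ler_pM ?normr_ge0.
Qed.

Lemma bounded_sqint {c} : bounded_rv c -> sqint c.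
Proof.
move=> bc; have := sqint_bmul bc (sqint_cst 1).
by under [X in sqint X]eq_fun do rewrite mulr1.
Qed.

Lemma sqintZ k {X} : sqint X -> sqint (fun w => k * X w).
Proof. by move=> sX; exact: (sqint_bmul (bounded_cst k)). Qed.

Lemma sqintB {X Y} : sqint X -> sqint Y -> sqint (fun w => X w - Y w).
Proof.
move=> sX sY; have := sqintD sX (sqintZ (-1) sY).
by under [X in sqint X]eq_fun do rewrite mulN1r.
Qed.

Lemma sqint_sum I (s : seq I) (X : I -> Omega -> R) :
  (forall i, sqint (X i)) -> sqint (fun w => \sum_(i <- s) X i w).
Proof.
move=> sX; elim: s => [|i s ih].
  by under [X in sqint X]eq_fun do rewrite big_nil; exact: sqint_cst.
under [X in sqint X]eq_fun do rewrite big_cons.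
exact: sqintD.
Qed.

Local Notation Ex X := (Rintegral P setT X).

Lemma ExD {X Y} : rint X -> rint Y -> Ex (fun w => X w + Y w) = Ex X + Ex Y.
Proof. by move=> iX iY; rewrite RintegralD. Qed.

Lemma ExB {X Y} : rint X -> rint Y -> Ex (fun w => X w - Y w) = Ex X - Ex Y.
Proof. by move=> iX iY; rewrite RintegralB. Qed.

Lemma ExZ k {X} : rint X -> Ex (fun w => k * X w) = k * Ex X.
Proof. by move=> iX; rewrite RintegralZl. Qed.

Lemma Ex_cst k : Ex (fun=> k) = k.
Proof. rewrite /Rintegral integral_cst//; transitivity (fine (k%:E * 1)%E); last by rewrite mule1.
by congr (fine (_ * _)%E); exact: probability_setT. Qed.

Lemma Ex_sum I (s : seq I) (X : I -> Omega -> R) :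
  (forall i, rint (X i)) -> Ex (fun w => \sum_(i <- s) X i w) = \sum_(i <- s) Ex (X i).
Proof.
move=> iX; elim: s => [|i s ih].
  by under eq_fun do rewrite big_nil; rewrite big_nil Ex_cst.
under eq_fun do rewrite big_cons.
by rewrite ExD ?big_cons ?ih//; exact: rint_sum.
Qed.

Lemma Ex_ae {X Y} : measurable_fun setT X -> measurable_fun setT Y ->
  {ae P, forall w, X w = Y w} -> Ex X = Ex Y.
Proof.
move=> mX mY XY; rewrite /Rintegral; congr fine; apply: ae_eq_integral => //.
- exact/measurable_EFinP.
- exact/measurable_EFinP.
by apply: filterS XY => w -> _.
Qed.

Lemma rint_ae {X Y} : measurable_fun setT Y -> rint X ->
  {ae P, forall w, X w = Y w} -> rint Y.
Proof.
move=> mY iX XY; have mX := rint_measurable iX.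
apply/integrableP; split; first exact/measurable_EFinP.
move/integrableP : iX => [_]; apply: le_lt_trans.
rewrite le_eqVlt; apply/orP; left; apply/eqP/ae_eq_integral => //.
- by apply/measurable_EFinP/measurableT_comp.
- by apply/measurable_EFinP/measurableT_comp.
by apply: filterS XY => w /= -> _.
Qed.

Lemma expectationE X : rint X -> ('E_P[X])%E = (Ex X)%:E.
Proof. by move=> iX; rewrite unlock /Rintegral fineK// integrable_fin_num. Qed.

(** Packages the law of a plain function with its change of variables, so that later proofs can
    handle [p] as an abstract probability. *)
Lemma law_exists {dV} {V : measurableType dV} {X : Omega -> V} :
  measurable_fun setT X ->
  exists p : probability V R, [/\ forall A, p A = P (setT `&` X @^-1` A),
    forall f, measurable_fun setT f -> (forall v, 0 <= f v)%E ->
      (\int[p]_v f v = \int[P]_w f (X w))%E &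
    forall f, measurable_fun setT f -> P.-integrable setT (f \o X) ->
      p.-integrable setT f /\ (\int[p]_v f v = \int[P]_w f (X w))%E].
Proof.
move=> mX.
pose hX : {mfun Omega >-> V} := HB.pack X (isMeasurableFun.Build _ _ _ _ _ mX).
exists (distribution P hX); split.
- by move=> A; rewrite setTI.
- by move=> f mf f0; rewrite ge0_integral_distribution.
move=> f mf iX; split; last by rewrite integral_distribution.
exact: (integrable_pushforward mX).
Qed.

(* Independence makes the joint law of X and Y a product measure. *)
Lemma Ex_indepM {X Y} : rint X -> rint Y ->
  indep2 P (events_on setT X) (events_on setT Y) ->
  rint (fun w => X w * Y w) /\ Ex (fun w => X w * Y w) = Ex X * Ex Y.
Proof.
move=> iX iY indXY.
have mX := rint_measurable iX; have mY := rint_measurable iY.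
have mXY : measurable_fun setT (fun w => (X w, Y w)) by exact: measurable_fun_pair.
have [pX [pXE pX0 pXI]] := law_exists mX.
have [pY [pYE pY0 pYI]] := law_exists mY.
have [pXY [pXYE pXY0 pXYI]] := law_exists mXY.
have prodE A : measurable A -> (pX \x pY)%E A = pXY A.
  apply: product_measure_unique => A1 A2 mA1 mA2.
  apply: (etrans (pXYE _)); apply: (etrans _ (esym (f_equal2 mule (pXE _) (pYE _)))).
  transitivity (P ((setT `&` X @^-1` A1) `&` (setT `&` Y @^-1` A2))).
    by congr (P _); rewrite !setTI.
  by apply: indXY; [exists A1|exists A2].
have mmul : measurable_fun setT (fun z : R * R => z.1 * z.2).
  by apply: measurable_funM; [exact: measurable_fst|exact: measurable_snd].
have mabs : measurable_fun setT (fun z : R => `|z|%:E).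
  by apply/measurable_EFinP; exact: normr_measurable.
have iXY : rint (fun w => X w * Y w).
  apply/integrableP; split; first by apply/measurable_EFinP; exact: measurable_funM.
  rewrite [X in (X < _)%E](_ : _ = \int[pXY]_z `|(z.1 * z.2)%R|%:E)%E; last first.
    by rewrite pXY0//; by apply/measurable_EFinP; exact: measurableT_comp.
  rewrite (eq_measure_integral (pX \x pY)%E); last by move=> A mA _; exact/esym/prodE.
  rewrite fubini_tonelli1//; last by apply/measurable_EFinP; exact: measurableT_comp.
  rewrite /fubini_F/=.
  have E1 x : (\int[pY]_y `|(x * y)%R|%:E = `|x|%:E * \int[pY]_y `|y|%:E)%E.
    under eq_integral do rewrite normrM EFinM.
    by rewrite ge0_integralZl_EFin.
  under eq_integral do rewrite E1.
  have fY : (\int[pY]_y `|y|%:E < +oo)%E.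
    by rewrite pY0//; move/integrableP : iY => [].
  have fX : (\int[pX]_y `|y|%:E < +oo)%E.
    by rewrite pX0//; move/integrableP : iX => [].
  rewrite ge0_integralZr//; last exact: integral_ge0.
  by apply: lte_mul_pinfty; rewrite ?integral_ge0// ge0_fin_numE ?integral_ge0.
split => //.
have [ipXY EpXY] := pXYI (fun z => (z.1 * z.2)%:E) ltac:(exact/measurable_EFinP) iXY.
have [ipX EpX] := pXI EFin ltac:(exact/measurable_EFinP) iX.
have [ipY EpY] := pYI EFin ltac:(exact/measurable_EFinP) iY.
have ipr : (pX \x pY)%E.-integrable setT (fun z => (z.1 * z.2)%:E).
  move/integrableP : ipXY => [? ipXY]; apply/integrableP; split => //.
  by rewrite (eq_measure_integral pXY)//; move=> A mA _; exact: prodE.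
rewrite /Rintegral -fineM ?(integrable_fin_num _ iX) ?(integrable_fin_num _ iY)//.
congr fine; rewrite -EpXY (eq_measure_integral (pX \x pY)%E); last first.
  by move=> A mA _; exact/esym/prodE.
rewrite -integral12_prod_meas1//= /fubini_F/=.
have [k Yk] : exists k, (\int[P]_y (Y y)%:E)%E = k%:E.
  by exists (fine (\int[P]_y (Y y)%:E)%E); rewrite fineK// (integrable_fin_num _ iY).
have E2 x : (\int[pY]_y (x * y)%:E = k%:E * x%:E)%E.
  under eq_integral do rewrite EFinM.
  by rewrite (integralZl _ ipY)// EpY Yk muleC.
under eq_integral do rewrite E2.
by rewrite Yk (integralZl _ ipX)// EpX muleC.
Qed.

End square_integrable_theory.

(** * Moments of Gaussian and Poisson variables *)

Section density.
Context {R : realType} {d : measure_display} {V : measurableType d}.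
Variables (nu mu : {measure set V -> \bar R}) (g : V -> R).
Hypotheses (mg : measurable_fun setT g) (g0 : forall x, 0 <= g x).
Hypothesis nuE : forall A, measurable A -> (nu A = \int[mu]_(x in A) (g x)%:E)%E.
Import HBNNSimple.

Let simple_density (h : {nnsfun V >-> R}) :
  (\int[nu]_x (h x)%:E = \int[mu]_x ((h x)%:E * (g x)%:E))%E.
Proof.
pose level r := h @^-1` [set r].
have mlevel r : measurable (level r) by rewrite -[level r]setTI; exact: measurable_funP.
have cover : \big[setU/set0]_(r <- finmap.enum_fset (fset_set (range h))) level r = setT.
  rewrite bigsetU_fset_set//; apply/seteqP; split => // x _.
  by exists (h x) => //=; exists x.
rewrite integralT_nnsfun sintegralE fsbig_finite//= -[in RHS]cover ge0_integral_bigsetU//.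
- apply: eq_bigr => r _; rewrite nuE//.
  (* A negative [r] has an empty level set, as [h] is nonnegative; the other values can be taken out
     of the integral. *)
  have [r0|r0] := leP 0 r; last first.
    have h0 : level r = set0.
      by apply/seteqP; split => // x /= hx; have : 0 <= h x by []; rewrite hx leNgt r0.
    by rewrite -/(level r) h0 !integral_set0 mule0.
  rewrite -ge0_integralZl_EFin//; first by apply: eq_integral => x /set_mem /= ->.
  + by move=> x _; rewrite lee_fin.
  + by apply: measurable_funTS; apply/measurable_EFinP.
- by move=> r s _ _ [x [/= <- <-]].
- rewrite cover; apply: emeasurable_funM; apply/measurable_EFinP => //.
- by move=> x _; rewrite mule_ge0// lee_fin.
Qed.

(** Monotone convergence along [nnsfun_approx], starting from simple functions. It serves for the
    normal law, and again for the restriction of [l] to [Rstar], whose density is an indicator. *)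
Lemma ge0_integral_density (f : V -> \bar R) : measurable_fun setT f ->
  (forall x, 0 <= f x)%E -> (\int[nu]_x f x = \int[mu]_x (f x * (g x)%:E))%E.
Proof.
move=> mf f0; pose h := nnsfun_approx measurableT mf.
have hf x : (h n x)%:E @[n --> \oo] --> f x by exact: cvg_nnsfun_approx.
have h_nd x : {homo h ^~ x : m n / (m <= n)%N >-> m <= n}.
  by move=> m n mn; exact/lefP/nd_nnsfun_approx.
have lim1 : (\int[nu]_x (h n x)%:E)%E @[n --> \oo] --> (\int[nu]_x f x)%E.
  rewrite (eq_integral (fun x => limn (fun n => (h n x)%:E))).
    apply: cvg_monotone_convergence => //.
    - by move=> n; exact/measurable_EFinP.
    - by move=> n x _; rewrite lee_fin.
    - by move=> x _ m n mn; rewrite lee_fin h_nd.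
  by move=> x _; apply/esym/cvg_lim => //; exact: hf.
have lim2 : (\int[mu]_x ((h n x)%:E * (g x)%:E))%E @[n --> \oo] -->
    (\int[mu]_x (f x * (g x)%:E))%E.
  rewrite (eq_integral (fun x => limn (fun n => (h n x)%:E * (g x)%:E)%E)).
    apply: cvg_monotone_convergence => //.
    - by move=> n; apply: emeasurable_funM; exact/measurable_EFinP.
    - by move=> n x _; rewrite mule_ge0// lee_fin.
    - by move=> x _ m n mn; rewrite lee_wpmul2r ?lee_fin ?h_nd.
  by move=> x _; apply/esym/cvg_lim => //; apply: cvgeZr => //; exact: hf.
apply: cvg_unique lim1 _ => //.
by rewrite (funext (fun n => simple_density (h n))).
Qed.

End density.

(** * Mean and second moment of a normal variable *)

Section normal_moments.
Context {R : realType} {s : R} (s0 : 0 < s).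
Notation leb := (@lebesgue_measure R).
Let phi : R -> R := normal_pdf 0 s.

Let phiE x : phi x = normal_peak s * expR (- (x ^+ 2) / (s ^+ 2 *+ 2)).
Proof. by rewrite /phi /normal_pdf gt_eqF//= /normal_fun subr0. Qed.

Let phi_ge0 x : 0 <= phi x. Proof. exact: normal_pdf_ge0. Qed.

Let phi_even x : phi (- x) = phi x. Proof. by rewrite !phiE sqrrN. Qed.

Let cphi : continuous phi. Proof. by apply: continuous_normal_pdf; rewrite gt_eqF. Qed.

(** The antiderivative is the boundary term of an integration by parts: the derivative of [phi] at
    [x] is [- x * phi x / s ^+ 2], so that [x ^+ 2 * phi x] differs from [s ^+ 2 * phi x] by an
    exact derivative. *)
Let phi_derive (x : R) : is_derive x 1 (fun x : R => - s ^+ 2 * (x * phi x))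
  (x ^+ 2 * phi x - s ^+ 2 * phi x).
Proof.
have -> : (fun x => - s ^+ 2 * (x * phi x)) =
  (fun x : R => - s ^+ 2 * (x * (normal_peak s * expR (- (x ^+ 2) / (s ^+ 2 *+ 2))))).
  by apply/funext => y; rewrite phiE.
rewrite phiE.
apply: is_derive_eq.
rewrite /GRing.scale/=; field.
by rewrite gt_eqF// expr2 mulr_gt0.
Qed.

Let mphi : measurable_fun setT phi. Proof. exact: measurable_normal_pdf. Qed.

Let x2phi_partial (n : nat) : (\int[leb]_(x in `[0%R, n.+1%:R]) (x ^+ 2 * phi x)%:E =
  (s ^+ 2)%:E * \int[leb]_(x in `[0%R, n.+1%:R]) (phi x)%:E
  + (- s ^+ 2 * (n.+1%:R * phi n.+1%:R))%:E)%E.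
Proof.
have cx2 : continuous (fun x : R => x ^+ 2 * phi x).
  by move=> x; apply: cvgM; [exact: exprn_continuous|exact: cphi].
have itvi (g : R -> R) : continuous g ->
    leb.-integrable `[0, n.+1%:R] (EFin \o g).
  move=> cg; apply: continuous_compact_integrable => //.
    exact: segment_compact.
  exact: continuous_subspaceT.
have csp : continuous (fun x : R => s ^+ 2 * phi x).
  by move=> x; apply: cvgM; [exact: cvg_cst|exact: cphi].
have := @continuous_FTC2 R (fun x => x ^+ 2 * phi x - s ^+ 2 * phi x)
  (fun x : R => - s ^+ 2 * (x * phi x)) 0 n.+1%:R (ltr0Sn _ _).
have cd : {within `[0, n.+1%:R], continuous (fun x : R => x ^+ 2 * phi x - s ^+ 2 * phi x)}.
  by apply: continuous_subspaceT => x; apply: cvgB; [exact: cx2|exact: csp].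
move=> /(_ cd).
have dF (x : R) : derivable (fun x : R => - s ^+ 2 * (x * phi x)) x 1.
  by apply: ex_derive; exact: phi_derive.
have cF (x : R) : {for x, continuous (fun x : R => - s ^+ 2 * (x * phi x))}.
  by apply: differentiable_continuous; exact/derivable1_diffP.
have dL : derivable_oo_LRcontinuous (fun x : R => - s ^+ 2 * (x * phi x)) 0 n.+1%:R.
  split => //; first exact/cvg_at_right_filter/cF.
  exact/cvg_at_left_filter/cF.
move=> /(_ dL).
have dE : {in `]0, n.+1%:R[, (fun x : R => - s ^+ 2 * (x * phi x))^`()%classic =1
    (fun x => x ^+ 2 * phi x - s ^+ 2 * phi x)}.
  by move=> x _; rewrite derive1E; apply: derive_val; exact: phi_derive.
move=> /(_ dE).
under eq_integral do rewrite EFinB.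
rewrite integralB_EFin//; [|exact: itvi|exact: itvi].
under [X in (_ - X)%E]eq_integral do rewrite EFinM.
rewrite integralZl//; last exact: itvi.
rewrite mul0r mulr0 sube0 => <-.
rewrite addeC subeK// fin_numM//.
by apply: integrable_fin_num => //; exact: itvi.
Qed.

(** The inequality [1 + v <= expR v] at [v = x ^+ 2 / (2 * s ^+ 2)] bounds [x * phi x] by a constant
    multiple of [1 / x]; that constant is [K]. *)
Let decay : (n.+1%:R * phi n.+1%:R) @[n --> \oo] --> 0.
Proof.
pose K := normal_peak s * (s ^+ 2 *+ 2).
apply: (@squeeze_cvgr _ _ _ _ (cst 0) (fun n => K * (n.+1%:R)^-1)).
- near=> n; rewrite mulr_ge0//= phiE /K.
  have n0 : 0 < n.+1%:R :> R by [].
  have s2 : 0 < s ^+ 2 *+ 2 by rewrite pmulrn_lgt0// exprn_gt0.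
  rewrite mulNr expRN mulrCA -!mulrA ler_wpM2l ?normal_peak_ge0//.
  rewrite ler_pdivrMr ?expR_gt0//.
  apply: (@le_trans _ _ (s ^+ 2 *+ 2 / n.+1%:R * (n.+1%:R * (n.+1%:R / (s ^+ 2 *+ 2))))).
    by rewrite le_eqVlt; apply/orP; left; apply/eqP; field; rewrite !gt_eqF// exprn_gt0.
  rewrite ler_wpM2l//; first by rewrite divr_ge0// ltW.
  by rewrite (le_trans _ (expR_ge1Dx _))// lerDr.
- exact: cvg_cst.
- rewrite -(mulr0 K); apply: cvgM; [exact: cvg_cst|exact: cvg_harmonic].
Unshelve. all: end_near. Qed.

Let half_line (g : R -> R) : measurable_fun setT g -> (forall x, 0 <= g x) ->
  (\int[leb]_(x in `[0%R, n.+1%:R]) (g x)%:E @[n --> \oo] -->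
   \int[leb]_(x in `[0%R, +oo[) (g x)%:E)%E.
Proof.
move=> mg g0.
have -> : `[0, +oo[%classic = \bigcup_n `[0:R, n.+1%:R]%classic.
  apply/seteqP; split => x /=; rewrite in_itv/= ?andbT.
    move=> x0; exists (Num.truncn x) => //=; rewrite in_itv/= x0/=.
    by apply/ltW/truncnS_gt.
  by move=> [n _ /=]; rewrite in_itv/= => /andP[].
apply: ge0_nondecreasing_set_cvg_integral => //.
- apply/nondecreasing_seqP => n; rewrite subsetEset => x /=; rewrite !in_itv/= => /andP[->/=].
  by move=> /le_trans; apply; rewrite ler_nat.
- by move=> i; apply/measurable_funTS/measurable_EFinP.
- by move=> i x _; rewrite lee_fin.
Qed.

(** By parity, this integral and the total mass of [phi] are both twice their parts on the half
    line, where [x2phi_partial] passes to the limit and loses its boundary term. *)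
Lemma normal_second_moment : (\int[leb]_x (x ^+ 2 * phi x)%:E = (s ^+ 2)%:E)%E.
Proof.
have cx2 : continuous (fun x : R => x ^+ 2 * phi x).
  by move=> x; apply: cvgM; [exact: exprn_continuous|exact: cphi].
rewrite (ge0_symfun_integralT _ cx2); last 2 first.
- by move=> x; rewrite mulr_ge0 ?sqr_ge0.
- by move=> x /=; rewrite sqrrN phi_even.
have := integral_normal_pdf 0 s.
rewrite -/phi (ge0_symfun_integralT phi_ge0 cphi); last first.
  by move=> x /=; rewrite phi_even.
rewrite -!set_itvcy => E1.
have -> : (\int[leb]_(x in `[0%R, +oo[) (x ^+ 2 * phi x)%:E =
    (s ^+ 2)%:E * \int[leb]_(x in `[0%R, +oo[) (phi x)%:E)%E.
  have h1 : (\int[leb]_(x in `[0%R, n.+1%:R]) (x ^+ 2 * phi x)%:E @[n --> \oo] -->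
      \int[leb]_(x in `[0%R, +oo[) (x ^+ 2 * phi x)%:E)%E.
    apply: half_line; first by apply: measurable_funM => //; exact: measurable_funX.
    by move=> x; rewrite mulr_ge0 ?sqr_ge0.
  have h2 : ((s ^+ 2)%:E * \int[leb]_(x in `[0%R, n.+1%:R]) (phi x)%:E
      + (- s ^+ 2 * (n.+1%:R * phi n.+1%:R))%:E @[n --> \oo] -->
      (s ^+ 2)%:E * \int[leb]_(x in `[0%R, +oo[) (phi x)%:E)%E.
    rewrite -[X in _ --> X]adde0; apply: cvgeD.
    - by rewrite fin_num_adde_defl.
    - by apply: cvgeZl => //; exact: half_line.
    - apply: cvg_EFin; first by near=> n.
      rewrite -(mulr0 (- s ^+ 2)); apply: cvgM; [exact: cvg_cst|exact: decay].
  by rewrite -(cvg_lim _ h1)//; under eq_fun do rewrite x2phi_partial; exact/cvg_lim.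
by rewrite muleCA E1 mule1.
Unshelve. all: end_near. Qed.

Context {d : measure_display} {Omega : measurableType d} (P : probability Omega R).

Lemma lebesgue_integral_opp (h : R -> \bar R) : measurable_fun setT h ->
  (forall x, 0 <= h x)%E -> (\int[leb]_x h (- x)%R = \int[leb]_x h x)%E.
Proof.
move=> mh h0.
have mopp : measurable_fun setT (-%R : R -> R) by exact: oppr_measurable.
have mopp' : measurable_fun setT (-%R : measurableTypeR R -> measurableTypeR R) by [].
have := @ge0_integral_pushforward _ _ (measurableTypeR R) (measurableTypeR R) R _ mopp'
  leb setT h measurableT mh.
rewrite preimage_setT => <- //.
by apply: eq_measure_integral => //= A mA AS; exact: lebesgue_measureN.
Qed.

Lemma gaussian_moments (X : Omega -> R) : measurable_fun setT X ->
  (forall A, measurable A -> P [set w | A (X w)] = normal_prob 0 s A) ->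
  [/\ sqint P X, Rintegral P setT X = 0 &
     Rintegral P setT (fun w => X w ^+ 2) = s ^+ 2].
Proof.
move=> mX lawX; have [p [pE p0 pI]] := law_exists (P := P) (V := measurableTypeR R) mX.
have pphi A : measurable A -> p A = (\int[leb]_(x in A) (phi x)%:E)%E.
  by move=> mA; apply: (etrans (pE A)); rewrite setTI; exact: lawX.
have EX f : measurable_fun setT f -> (forall x, 0 <= f x)%E ->
    (\int[P]_w f (X w) = \int[leb]_x (f x * (phi x)%:E))%E.
  move=> mf f0; rewrite -p0//.
  exact: (@ge0_integral_density _ _ _ p leb phi).
have EX2 : (\int[P]_w ((X w) ^+ 2)%:E = (s ^+ 2)%:E)%E.
  rewrite (EX (fun x => (x ^+ 2)%:E))//; last 2 first.
  - by apply/measurable_EFinP; exact: exprn_measurable.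
  - by move=> x; rewrite lee_fin sqr_ge0.
  rewrite -normal_second_moment; apply: eq_integral => x _; by rewrite EFinM.
have sX : sqint P X.
  split => //; apply/integrableP; split.
    by apply/measurable_EFinP; exact: measurable_funX.
  under eq_integral do rewrite /= ger0_norm ?sqr_ge0//.
  by rewrite EX2 ltry.
split => //; last by rewrite /Rintegral EX2.
have iX := sqint_rint sX.
have mpos : measurable_fun setT (fun x : R => (Num.max x 0)%:E).
  by apply/measurable_EFinP; exact: measurable_maxr.
have mneg : measurable_fun setT (fun x : R => (Num.max (- x) 0)%:E).
  by apply/measurable_EFinP; apply: measurable_maxr => //; exact: oppr_measurable.
have maxE w : X w = Num.max (X w) 0 - Num.max (- X w) 0.
  by rewrite /Num.max; case: ltP => ?; case: ltP => ?; lra.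
have imax (Y : Omega -> R) : rint P Y -> rint P (fun w => Num.max (Y w) 0).
  move=> iY; have mY := rint_measurable iY.
  apply: (rint_le _ (integrable_norm iY)); first exact: measurable_maxr.
  by move=> w /=; rewrite /Num.max; case: ltP => ?; rewrite ?normr0//; lra.
have iXN : rint P (fun w => - X w).
  by have := rintZ (-1) iX; under eq_fun do rewrite mulN1r.
(* The mean is the difference of the integrals of the positive and the negative part, which a
   reflection exchanges because the density is even. *)
rewrite (_ : X = fun w => Num.max (X w) 0 - Num.max (- X w) 0); last exact/funext.
rewrite ExB; [|exact: imax|exact: (imax (fun w => - X w))].
apply/eqP; rewrite subr_eq0; apply/eqP; congr fine.
rewrite (EX (fun x => (Num.max x 0)%:E))//; last first.
  by move=> x; rewrite lee_fin le_max lexx orbT.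
rewrite (EX (fun x => (Num.max (- x) 0)%:E))//; last first.
  by move=> x; rewrite lee_fin le_max lexx orbT.
rewrite -lebesgue_integral_opp.
- by apply: eq_integral => x _; rewrite phi_even.
- by apply: emeasurable_funM => //; exact/measurable_EFinP.
- by move=> x; rewrite mule_ge0// lee_fin// le_max lexx orbT.
Qed.

End normal_moments.

(** * Mean and variance of a Poisson variable *)

Section poisson_moments.
Context {R : realType} {lam : R} (lam0 : 0 <= lam).

Let p k := expR (- lam) * lam ^+ k / k`!%:R.

Let p0 k : 0 <= p k.
Proof. by rewrite /p !mulr_ge0 ?expR_ge0 ?exprn_ge0 ?invr_ge0. Qed.

(** After a shift of the index, this reduces the series of [k%:R * p k] to that of [p k], and the
    series of [k%:R ^+ 2 * p k] to the two lower ones. *)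
Let pS k : k.+1%:R * p k.+1 = lam * p k.
Proof.
rewrite /p factS natrM exprS; field.
by rewrite pnatr_eq0 -lt0n fact_gt0/= -(natrD R 1) pnatr_eq0.
Qed.

Let sum_p : (\sum_(k <oo) (p k)%:E = 1)%E.
Proof.
transitivity ((expR (- lam))%:E * (expR lam)%:E)%E; last first.
  by rewrite -EFinM expRN mulVf ?gt_eqF ?expR_gt0.
under eq_eseriesr do rewrite /p -mulrA EFinM.
rewrite nneseriesZl/=; last by move=> n _; rewrite lee_fin divr_ge0// exprn_ge0.
congr *%E; rewrite expRE -EFin_lim; last first.
  rewrite /pseries/=; under eq_fun do rewrite mulrC.
  exact: is_cvg_series_exp_coeff.
apply/congr_lim/funext => n/=; rewrite /pseries/= /series/= -sumEFin//.
by under eq_bigr do rewrite mulrC.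
Qed.

Let sum_kp : (\sum_(k <oo) (k%:R * p k)%:E = lam%:E)%E.
Proof.
rewrite (nneseries_recl (P := xpredT))//; last by move=> k _; rewrite lee_fin mulr_ge0.
rewrite -nneseries_addn; last by move=> k; rewrite lee_fin mulr_ge0.
under eq_eseriesr do rewrite addn1.
rewrite mul0r add0e; under eq_eseriesr do rewrite pS EFinM.
by rewrite nneseriesZl ?sum_p ?mule1// => n _; rewrite lee_fin.
Qed.

Let sum_k2p : (\sum_(k <oo) (k%:R ^+ 2 * p k)%:E = (lam * (lam + 1))%:E)%E.
Proof.
rewrite (nneseries_recl (P := xpredT))//; last by move=> k _; rewrite lee_fin mulr_ge0 ?sqr_ge0.
rewrite -nneseries_addn; last by move=> k; rewrite lee_fin mulr_ge0 ?sqr_ge0.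
under eq_eseriesr do rewrite addn1.
rewrite expr0n/= mul0r add0e.
have E k : ((k.+1%:R ^+ 2 * p k.+1)%:E = lam%:E * ((k%:R * p k)%:E + (p k)%:E))%E.
  by rewrite expr2 -mulrA pS -natr1 -EFinD -EFinM; congr EFin; ring.
under eq_eseriesr do rewrite E.
rewrite nneseriesZl; last by move=> n _; rewrite -EFinD lee_fin; apply: addr_ge0; first exact: mulr_ge0.
rewrite nneseriesD//; first last.
- by move=> n _ _; rewrite lee_fin.
- by move=> n _ _; rewrite lee_fin; exact: mulr_ge0.
by rewrite sum_kp sum_p.
Qed.

Context {d : measure_display} {Omega : measurableType d} (P : probability Omega R).
Context {N : Omega -> \bar R} (mN : measurable_fun setT N).
Hypothesis lawN : forall k : nat, P [set w | N w = k%:R%:E] = (p k)%:E.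

Let A k := [set w | N w = k%:R%:E].

Let mA k : measurable (A k).
Proof.
have := mN measurableT [set k%:R%:E] (emeasurable_set1 _).
by rewrite setTI.
Qed.

Let tA : trivIset setT A.
Proof.
apply/trivIsetP => i j _ _; apply: contraNeq => /set0P[w []]; rewrite /A/= => -> [] /eqP.
by rewrite eqr_nat => /eqP ->.
Qed.

Let mAU : measurable (\bigcup_k A k).
Proof. by apply: bigcup_measurable => k _; exact: mA. Qed.

(** The weights [p k] sum to 1, so no mass is left for [+oo] or for non-integers. This matters
    because [fine] sends [+oo] to 0 and would hide such values. *)
Let PA : P (~` \bigcup_k A k) = 0%E.
Proof.
have PU : P (\bigcup_k A k) = 1%E.
  apply: (etrans (measure_semi_bigcup P mA tA mAU)).
  by rewrite -[RHS]sum_p; apply: eq_eseriesr => k _; exact: lawN.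
apply: (etrans (probability_setC P mAU)).
by apply: (etrans (congr1 (fun x => 1 - x)%E PU)); rewrite subee.
Qed.

Let integral_N (h : Omega -> \bar R) (c : nat -> R) : measurable_fun setT h ->
  (forall w, 0 <= h w)%E -> (forall k w, N w = k%:R%:E -> h w = (c k)%:E) ->
  (\int[P]_w h w = \sum_(k <oo) (c k * p k)%:E)%E.
Proof.
move=> mh h0 hc.
rewrite (@ge0_negligible_integral _ _ _ P setT (~` \bigcup_k A k))//; last exact: measurableC.
rewrite setDE setCK setTI ge0_integral_bigcup//; last exact: measurable_funTS.
apply: eq_eseriesr => k _.
under eq_integral => w /set_mem Akw do rewrite (hc k w Akw).
by rewrite integral_cst// EFinM; congr *%E; exact: lawN.
Qed.

Lemma poisson_ae_nat : {ae P, forall w, exists k : nat, N w = k%:R%:E}.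
Proof.
exists (~` \bigcup_k A k); split => //; first exact: measurableC.
by move=> w /=; apply: contra_not => -[k _ /= Nk]; exists k.
Qed.

Lemma poisson_moments : let X w := fine (N w) - lam in
  [/\ sqint P X, Rintegral P setT X = 0 & Rintegral P setT (fun w => X w ^+ 2) = lam].
Proof.
pose Y w := fine (N w).
have mY : measurable_fun setT Y.
  by apply: (measurableT_comp _ mN); exact: fine_measurable.
have EabsY : (\int[P]_w `|Y w|%:E = lam%:E)%E.
  rewrite (integral_N _ (fun k => k%:R))//.
  - by apply/measurable_EFinP; exact: measurableT_comp.
  - by move=> k w; rewrite /Y => ->; rewrite /= ger0_norm.
have EY2 : (\int[P]_w (Y w ^+ 2)%:E = (lam * (lam + 1))%:E)%E.
  rewrite (integral_N _ (fun k => k%:R ^+ 2))//.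
  - by apply/measurable_EFinP; exact: measurable_funX.
  - by move=> w; rewrite lee_fin sqr_ge0.
  - by move=> k w; rewrite /Y => ->.
have sY : sqint P Y.
  split => //; apply/integrableP; split.
    by apply/measurable_EFinP; exact: measurable_funX.
  under eq_integral do rewrite /= ger0_norm ?sqr_ge0//.
  by rewrite EY2 ltry.
have iY := sqint_rint sY.
have EY : Rintegral P setT Y = lam.
  have <- : Rintegral P setT (fun w => `|Y w|) = lam by rewrite /Rintegral EabsY.
  apply: Ex_ae => //; first exact: measurableT_comp.
  by apply: filterS poisson_ae_nat => w [k Nk]; rewrite /Y Nk/= ger0_norm.
have EY2' : Rintegral P setT (fun w => Y w ^+ 2) = lam * (lam + 1).
  by rewrite /Rintegral EY2.
have sl := sqint_cst (P := P) lam.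
split; first exact: sqintB.
  by rewrite ExB// ?Ex_cst ?EY ?subrr//; exact: rint_cst.
rewrite (_ : (fun w => _) = fun w => Y w ^+ 2 - 2 * lam * Y w + lam ^+ 2); last first.
  by apply/funext => w; rewrite /Y; ring.
have i1 : rint P (fun w => 2 * lam * Y w) by exact: rintZ.
have i2 := rintB sY.2 i1.
rewrite ExD//; last exact: rint_cst.
rewrite ExB//; last by case: sY.
by rewrite ExZ// Ex_cst EY EY2'; ring.
Qed.

End poisson_moments.

(** * Independence of past and increments *)

Section sigma_algebra_measurability.
Context {R : realType} {d : measure_display} {Omega : measurableType d}.
Context {S : set (set Omega)} (sS : sigma_algebra setT S).
Implicit Types X Y : Omega -> R.

Let E : g_sigma_algebraType S = Omega :> Type := erefl.

(** Turns adaptedness into measurability for the structure generated by [S], so that sums, products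
    and compositions are covered by the usual closure rules. *)
Lemma events_onP {d'} {V : measurableType d'} (X : Omega -> V) :
  events_on setT X `<=` S <->
  measurable_fun setT (X : g_sigma_algebraType S -> V).
Proof.
split.
  move=> XS _ A mA; apply: sub_gen_smallest; apply: XS; by exists A.
by move=> mX _ [A mA <-]; have := mX measurableT A mA; rewrite /measurable/= sigma_algebra_id.
Qed.

Lemma events_onB {X Y} : events_on setT X `<=` S -> events_on setT Y `<=` S ->
  events_on setT (fun w => X w - Y w) `<=` S.
Proof. by move=> /events_onP mX /events_onP mY; apply/events_onP; exact: measurable_funB. Qed.

Lemma events_onM {X Y} : events_on setT X `<=` S -> events_on setT Y `<=` S ->
  events_on setT (fun w => X w * Y w) `<=` S.
Proof. by move=> /events_onP mX /events_onP mY; apply/events_onP; exact: measurable_funM. Qed.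

Lemma events_on_comp {d' d''} {U : measurableType d'} {V : measurableType d''}
    {X : Omega -> U} {h : U -> V} : measurable_fun setT h ->
  events_on setT X `<=` S -> events_on setT (fun w => h (X w)) `<=` S.
Proof. by move=> mh /events_onP mX; apply/events_onP; exact: measurableT_comp. Qed.

End sigma_algebra_measurability.

(** * Product rules on pi-systems and on generated sigma-algebras *)

Section independence.
Context {R : realType} {d : measure_display} {Omega : measurableType d}.
Context {P : probability Omega R}.
Implicit Types (S G : set (set Omega)).

(** Dynkin's argument: for a fixed [D] in [G], the events that satisfy the product rule with [D]
    form a lambda-system. Only the first family is enlarged, so [G] may be any class of events. *)
Lemma indep2_sigma Pi G : setI_closed Pi -> Pi `<=` measurable -> G `<=` measurable ->
  indep2 P Pi G -> indep2 P <<s Pi>> G.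
Proof.
move=> PiI mPi mG ind A D sA GD; have mD := mG _ GD.
suff : <<s Pi >> `<=` [set A | measurable A /\ P (A `&` D) = (P A * P D)%E].
  by move=> /(_ _ sA)[].
apply: lambda_system_subset => //.
- apply/dynkin_lambda_system; split => //=.
  + by rewrite setTI probability_setT mul1e.
  + move=> B [mB PB]; split; first exact: measurableC.
    rewrite probability_setC// setIC -setDE measureD//; last by rewrite ltey_eq fin_num_measure.
    have e : P (D `&` B) = (P B * P D)%E by rewrite setIC.
    apply: (etrans (congr1 (fun x => P D - x)%E e)).
    by rewrite muleBl ?mul1e ?fin_num_measure// fin_num_adde_defr// fin_num_measure.
  + move=> F tF HF; split; first by apply: bigcup_measurable => k _; case: (HF k).
    rewrite setI_bigcupl measure_semi_bigcup//; last 3 first.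
    * by move=> i; apply: measurableI => //; case: (HF i).
    * by apply: trivIset_setIr; exact: tF.
    * by apply: bigcup_measurable => k _; apply: measurableI => //; case: (HF k).
    rewrite measure_semi_bigcup//; last 2 first.
    * by move=> i; case: (HF i).
    * by apply: bigcup_measurable => k _; case: (HF k).
    have PD : P D = (fine (P D))%:E by rewrite fineK// fin_num_measure.
    rewrite muleC PD -nneseriesZl//; apply: eq_eseriesr => i _.
    by rewrite -PD muleC; case: (HF i).
- by move=> B PiB; split; [exact: mPi|exact: ind].
Qed.

(** Adding null sets keeps a pi-system, because intersecting with a null set gives a null set;
    completeness makes these sets measurable, and both sides of the product rule vanish on them. *)
Lemma indep2_augmented Pi G : measure_is_complete P ->
  setI_closed Pi -> Pi `<=` measurable -> G `<=` measurable ->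
  indep2 P Pi G -> indep2 P <<s Pi `|` P.-negligible>> G.
Proof.
move=> hP PiI mPi mG ind; apply: indep2_sigma => //.
- move=> A B [PiA|nA] [PiB|nB]; [left; exact: PiI|right..].
  + by apply: negligibleS nB; exact: subIsetr.
  + by apply: negligibleS nA; exact: subIsetl.
  + by apply: negligibleS nA; exact: subIsetl.
- by move=> A [/mPi//|]; exact: hP.
- move=> A D [PiA|nA] GD; first exact: ind.
  have mA := hP _ nA.
  have PA : P A = 0%E by exact: measure_negligible.
  rewrite PA mul0e; apply: (subset_measure0 _ _ (@subIsetl _ A D)) => //.
  by apply: measurableI => //; exact: mG.
Qed.

(** For sigma-algebras, a pi-system generating their join. *)
Definition rectangles S1 S2 S3 := [set A | exists A1 A2 A3, [/\ S1 A1, S2 A2, S3 A3 &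
   A = A1 `&` A2 `&` A3]].

Lemma sigma_algebraI {S A B} : sigma_algebra setT S -> S A -> S B -> S (A `&` B).
Proof.
move=> [S0 SC' SU] SA SB; rewrite -(setCK (A `&` B)) setCI -setTD; apply: (SC' _).
rewrite -bigcup2E; apply: SU => -[|[|n]]//=; rewrite /bigcup2/= -setTD; exact: SC'.
Qed.

Lemma sigma_algebraT {S} : sigma_algebra setT S -> S setT.
Proof. by move=> [S0 SC SU]; rewrite -(setD0 setT); exact: SC. Qed.

(** In the applications [S1'] is the past of one noise, [G] holds the events of a later increment of
    the same noise, and [S2], [S3] are the other noises over the whole of [[0, T]]. On a rectangle,
    the event [D] is moved into the first factor, the independence of [S1], [S2], [S3] splits the
    probability, and the independence of [S1'] and [G] splits that factor. *)
Lemma indep2_join S1 S2 S3 S1' G : measure_is_complete P ->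
  sigma_algebra setT S1 -> sigma_algebra setT S2 -> sigma_algebra setT S3 ->
  sigma_algebra setT S1' ->
  S1 `<=` measurable -> S2 `<=` measurable -> S3 `<=` measurable ->
  indep3 P S1 S2 S3 -> S1' `<=` S1 -> G `<=` S1 -> indep2 P S1' G ->
  indep2 P <<s (S1' `|` S2 `|` S3) `|` P.-negligible>> G.
Proof.
move=> hP s1 s2 s3 s1' m1 m2 m3 ind3 S11 GS1 ind2.
have mrect : rectangles S1' S2 S3 `<=` measurable.
  move=> A [A1 [A2 [A3 [? ? ? ->]]]]; apply: measurableI; last exact: m3.
  by apply: measurableI; [exact/m1/S11|exact: m2].
suff : indep2 P <<s rectangles S1' S2 S3 `|` P.-negligible>> G.
  move=> + A D sA GD; apply => //; move: A sA.
  apply: smallest_sub; first exact: smallest_sigma_algebra.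
  move=> A [[[SA|SA]|SA]|nA]; apply: sub_gen_smallest; [left..|by right].
  - exists A, setT, setT; rewrite !setIT; split => //; exact: sigma_algebraT.
  - exists setT, A, setT; rewrite setTI setIT; split => //; exact: sigma_algebraT.
  - exists setT, setT, A; rewrite !setTI; split => //; exact: sigma_algebraT.
apply: indep2_augmented => //.
- move=> A B [A1 [A2 [A3 [? ? ? ->]]]] [B1 [B2 [B3 [? ? ? ->]]]].
  exists (A1 `&` B1), (A2 `&` B2), (A3 `&` B3); split; try exact: sigma_algebraI.
  by rewrite !setIA; apply/seteqP; split => x /=; tauto.
- by move=> D /GS1 /m1.
- move=> A D [A1 [A2 [A3 [a1 a2 a3 ->]]]] GD.
  have -> : A1 `&` A2 `&` A3 `&` D = (A1 `&` D) `&` A2 `&` A3.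
    by apply/seteqP; split => x /=; tauto.
  rewrite !ind3//; last 2 first.
  - exact: S11.
  - by apply: sigma_algebraI => //; [exact: S11|exact: GS1].
  by rewrite ind2// -!muleA; congr (_ * _)%E; rewrite muleC -muleA.
Qed.

End independence.

Lemma indep3C12 {R : realType} {d} {Omega : measurableType d} {P : probability Omega R}
    {S1 S2 S3} : indep3 P S1 S2 S3 -> indep3 P S2 S1 S3.
Proof. by move=> ind A1 A2 A3 ? ? ?; rewrite (setIC A1) ind// (muleC (P A2)). Qed.

Lemma indep3C13 {R : realType} {d} {Omega : measurableType d} {P : probability Omega R}
    {S1 S2 S3} : indep3 P S1 S2 S3 -> indep3 P S3 S2 S1.
Proof.
move=> ind A1 A2 A3 ? ? ?.
rewrite (_ : A1 `&` A2 `&` A3 = A3 `&` A2 `&` A1); last by rewrite setIC (setIC A1) setIA.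
by rewrite ind// muleC (muleC (P A3)) muleA.
Qed.

Lemma measurable_Rstar {R : realType} : measurable (@Rstar R).
Proof.
rewrite (_ : Rstar = ~` [set 0]); first by apply: measurableC; exact: measurable_set1.
by apply/seteqP; split => x /= /eqP.
Qed.

(** * Independence of the past and the future of the Poisson random measure *)

Section poisson_past.
Context {R : realType} {d : measure_display} {Omega : measurableType d}.
Context {P : probability Omega R} {T : R} {l : {measure set R -> \bar R}}.
Context {N : Omega -> {measure set (R * R)%type -> \bar R}}.
Hypothesis hN : poisson_random_measure P T l N.
Notation strip s := (`[0, s] `*` Rstar : set (R * R)).

Let mN (C : set (R * R)) : measurable C -> C `<=` strip T ->
  measurable_fun setT (fun w => N w C).
Proof. by case: hN => + _ _; exact. Qed.

(** Lets the blocks be indexed by sums and products of finite types, as the constructions on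
    partitions below require. *)
Lemma poisson_indep_finType (I : finType) (D : I -> set (R * R)) (A : I -> set (\bar R)) :
  (forall i, measurable (D i) /\ D i `<=` strip T) -> trivIset setT D ->
  (forall i, measurable (A i)) ->
  P (\bigcap_(i in setT) [set w | A i (N w (D i))]) =
  (\prod_(i : I) P [set w | A i (N w (D i))])%E.
Proof.
move=> mD tD mA; case: hN => _ _ /(_ #|I| (D \o enum_val) (A \o enum_val)) h.
rewrite (reindex (enum_val : 'I_#|I| -> I))/=; last first.
  by exists enum_rank => i _; rewrite ?enum_valK ?enum_rankK.
rewrite -h.
- congr (P _); apply/seteqP; split => w /= Aw i _; first exact: Aw.
  by rewrite -(enum_rankK i); exact: Aw.
- by move=> i; exact: mD.
- apply/trivIsetP => i j _ _ ij; move/trivIsetP : tD; apply => //.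
  by apply: contra_neq ij; exact: enum_val_inj.
- by move=> i; exact: mA.
Qed.

Section past.
Context {s : R} (sT : s <= T).

Let stripsT : strip s `<=` strip T.
Proof. by move=> [t z] /= []; rewrite !in_itv/= => /andP[-> ts] ?; rewrite (le_trans ts). Qed.

(** The independence in [poisson_random_measure] concerns disjoint sets, whereas the sets that
    generate the past may overlap. Finite partitions of the strip reconcile the two: each set is a
    block of one, and two of them have a common refinement. *)
Record partition_of := PartitionOf {
  part_index : finType;
  part_set : part_index -> set (R * R);
  part_measurable : forall i, measurable (part_set i);
  part_trivIset : trivIset setT part_set;
  part_cover : \bigcup_i part_set i = strip s }.

Let part_sub (D : partition_of) i : part_set D i `<=` strip s.
Proof. by rewrite -(part_cover D); exact: bigcup_sup. Qed.

(* A pi-system generating the events of the values of N on the blocks of D. *)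
Let gen D : set (set Omega) :=
  [set E | exists A : part_index D -> set (\bar R), (forall i, measurable (A i)) /\
     E = \bigcap_(i in setT) [set w | A i (N w (part_set D i))]].

Let genI D : setI_closed (gen D).
Proof.
move=> _ _ [A [mA ->]] [B [mB ->]]; exists (fun i => A i `&` B i).
split; first by move=> i; exact: measurableI.
by rewrite -bigcapI; apply: eq_bigcapr.
Qed.

Let gen_measurable D : gen D `<=` measurable.
Proof.
move=> _ [A [mA ->]]; apply: fin_bigcap_measurable.
  exact: finite_finset.
move=> i _; have := @mN (part_set D i) (part_measurable _ _)
  (subset_trans (part_sub D i) stripsT) measurableT (A i) (mA i).
by rewrite setTI.
Qed.

(** [F] is disjoint from the strip, so it joins the blocks of [D] as one more set of a disjoint
    family, to which the defining independence applies. *)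
Let gen_indep D F : measurable F -> F `<=` strip T -> F `&` strip s = set0 ->
  indep2 P (gen D) (events_on setT (fun w => N w F)).
Proof.
move=> mF FT Fs _ _ [A [mA ->]] [B mB <-].
pose D' (i : 'I_1 + part_index D) := if i is inr j then part_set D j else F.
pose A' (i : 'I_1 + part_index D) := if i is inr j then A j else B.
have mD' i : measurable (D' i) /\ D' i `<=` strip T.
  case: i => [//|j] /=; split; first exact: part_measurable.
  exact: subset_trans (part_sub D j) stripsT.
have tD' : trivIset setT D'.
  have disj j : F `&` part_set D j = set0.
    by rewrite -subset0 -Fs; apply: setIS; exact: part_sub.
  apply/trivIsetP => -[i|i] [j|j] _ _ //= ij.
  - by exfalso; move/eqP : ij; apply; rewrite !ord1.
  - by rewrite setIC.
  - by move/trivIsetP : (part_trivIset D); apply.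
have mA' i : measurable (A' i) by case: i.
have := poisson_indep_finType _ _ _ mD' tD' mA'.
rewrite big_sumType/= big_ord1 -poisson_indep_finType//; last 2 first.
- by move=> i; exact: (mD' (inr i)).
- exact: part_trivIset.
rewrite muleC setTI => <-; congr (P _); apply/seteqP; split => w /=.
  by move=> [wA wB] [i|i] _; [exact: wB|exact: wA].
by move=> h; split; [move=> i _; exact: (h (inr i))|exact: (h (inl ord0))].
Qed.

Let gen_events D (J : set (part_index D)) :
  events_on setT (fun w => N w (\bigcup_(i in J) part_set D i)) `<=` <<s gen D>>.
Proof.
have sg : sigma_algebra setT <<s gen D>> by exact: smallest_sigma_algebra.
apply/(events_onP sg).
have -> : (fun w => N w (\bigcup_(i in J) part_set D i)) =
    fun w => (\sum_(i \in J) N w (part_set D i))%E.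
  apply/funext => w; apply: measure_fin_bigcup => //.
  - exact: finite_finset.
  - exact: sub_trivIset (part_trivIset D).
  - by move=> i _; exact: part_measurable.
apply: emeasurable_fsum; first exact: finite_finset.
move=> i; apply/(events_onP sg) => _ [B mB <-]; apply: sub_gen_smallest.
exists (fun j => if j == i then B else setT); split; first by move=> j; case: ifP.
rewrite setTI; apply/seteqP; split => w /=.
  by move=> wB j _; case: eqP => // ->.
by move=> /(_ i I); rewrite eqxx.
Qed.

Program Definition part_refine (D1 D2 : partition_of) : partition_of := {|
  part_index := (part_index D1 * part_index D2)%type;
  part_set := fun ij => part_set D1 ij.1 `&` part_set D2 ij.2 |}.
Next Obligation. by move=> D1 D2 i; apply: measurableI; exact: part_measurable. Qed.
Next Obligation.
move=> D1 D2; apply/trivIsetP => -[i j] [i' j'] _ _ /=.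
rewrite xpair_eqE negb_and => /orP[ii'|jj']; rewrite setIACA.
- by move/trivIsetP : (part_trivIset D1) => ->//; rewrite set0I.
- by move/trivIsetP : (part_trivIset D2) => ->//; rewrite setI0.
Qed.
Next Obligation.
move=> D1 D2; apply/seteqP; split => [x [ij _ [/= x1 _]]|x sx].
  exact: part_sub x1.
have : strip s x by []. rewrite -{1}(part_cover D1) => -[i _ xi].
have : strip s x by []. rewrite -{1}(part_cover D2) => -[j _ xj].
by exists (i, j).
Qed.

(** A block of [D1] is the union of the blocks of the refinement contained in it, so [gen_events]
    expresses its measure as a finite sum. *)
Let gen_refine1 D1 D2 : <<s gen D1>> `<=` <<s gen (part_refine D1 D2)>>.
Proof.
apply: smallest_sub; first exact: smallest_sigma_algebra.
move=> _ [A [mA ->]]; apply: (@fin_bigcap_measurable _ (g_sigma_algebraType (gen (part_refine D1 D2)))).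
  exact: finite_finset.
move=> i _; have -> : part_set D1 i =
    \bigcup_(k in [set k : part_index (part_refine D1 D2) | k.1 = i]) part_set (part_refine D1 D2) k.
  apply/seteqP; split => [x xi|x [[i' j'] /= ->] []//].
  have := part_sub _ _ _ xi; rewrite -{1}(part_cover D2) => -[j _ xj].
  by exists (i, j).
by apply: gen_events; exists (A i) => //; rewrite setTI.
Qed.

Let gen_refine2 D1 D2 : <<s gen D2>> `<=` <<s gen (part_refine D1 D2)>>.
Proof.
apply: smallest_sub; first exact: smallest_sigma_algebra.
move=> _ [A [mA ->]]; apply: (@fin_bigcap_measurable _ (g_sigma_algebraType (gen (part_refine D1 D2)))).
  exact: finite_finset.
move=> i _; have -> : part_set D2 i =
    \bigcup_(k in [set k : part_index (part_refine D1 D2) | k.2 = i]) part_set (part_refine D1 D2) k.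
  apply/seteqP; split => [x xi|x [[i' j'] /= ->] []//].
  have := part_sub _ _ _ xi; rewrite -{1}(part_cover D1) => -[j _ xj].
  by exists (j, i).
by apply: gen_events; exists (A i) => //; rewrite setTI.
Qed.

Program Definition part_bool (C : set (R * R)) (mC : measurable C) (Cs : C `<=` strip s) :
    partition_of := {|
  part_index := bool;
  part_set := fun b => if b then C else strip s `\` C |}.
Next Obligation.
move=> C mC Cs [//|]; apply: measurableD => //; apply: measurableX => //.
exact: measurable_Rstar.
Qed.
Next Obligation.
move=> C mC Cs; apply/trivIsetP => -[] [] _ _ //= _; apply/seteqP; split => // x /=; tauto.
Qed.
Next Obligation.
move=> C mC Cs; apply/seteqP; split => [x [[] _]|x sx]; first exact: Cs.
  by case.
have [xC|xC] := pselect (C x); [by exists true|by exists false].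
Qed.

(** The events decided by some finite partition form a pi-system thanks to common refinements, and
    [part_bool] shows that they generate the past. *)
Lemma poisson_past_indep F : measurable F -> F `<=` strip T -> F `&` strip s = set0 ->
  indep2 P <<s compensated_events T l N s>> (events_on setT (fun w => N w F)).
Proof.
move=> mF FT Fs.
pose past := [set E | exists D, <<s gen D>> E].
have mev : events_on setT (fun w => N w F) `<=` measurable.
  by move=> _ [B mB <-]; exact: mN.
suff : indep2 P <<s past>> (events_on setT (fun w => N w F)).
  move=> + E G sE GG; apply => //; move: E sE.
  apply: smallest_sub; first exact: smallest_sigma_algebra.
  move=> E [C [mC Cs _]] EC; apply: sub_gen_smallest.
  exists (part_bool C mC Cs).
  have sg : sigma_algebra setT <<s gen (part_bool C mC Cs)>> by exact: smallest_sigma_algebra.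
  move: E EC; apply: (events_on_comp sg (h := fun x => fine x - fine (intensity T l C))).
    by apply: measurable_funB => //; exact: fine_measurable.
  have := @gen_events (part_bool C mC Cs) [set true].
  by rewrite bigcup_set1.
have mgen D : <<s gen D>> `<=` measurable.
  apply: smallest_sub; last exact: gen_measurable.
  split; [exact: measurable0|by move=> A mA; exact: measurableD|].
  by move=> A mA; exact: bigcup_measurable.
apply: indep2_sigma => //.
- move=> A B [D1 D1A] [D2 D2B]; exists (part_refine D1 D2).
  apply: (sigma_algebraI (smallest_sigma_algebra setT _)).
    exact: gen_refine1.
  exact: gen_refine2.
- by move=> A [D /mgen].
- move=> A B [D DA] HB; apply: (@indep2_sigma _ _ _ _ (gen D) (events_on setT (fun w => N w F))) => //.
  + exact: gen_indep.
Qed.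

End past.
End poisson_past.

Section centered_independent.
Context {R : realType} {d : measure_display} {Omega : measurableType d}.
Context {P : probability Omega R} {K : set (set Omega)} {D : Omega -> R} {v : R}.
Hypotheses (ind : indep2 P K (events_on setT D)) (sD : sqint P D)
  (ED : Rintegral P setT D = 0) (ED2 : Rintegral P setT (fun w => D w ^+ 2) = v).

(** This rule and the next one play the part of the conditional moments [E[D | K] = 0] and
    [E[D ^+ 2 | K] = v], tested against factors measurable for [K]. *)
Lemma Ex_mul_centered X : sqint P X -> events_on setT X `<=` K ->
  Rintegral P setT (fun w => X w * D w) = 0.
Proof.
move=> sX XK.
have h : indep2 P (events_on setT X) (events_on setT D).
  by move=> A B /XK KA; exact: ind.
by have [_ ->] := Ex_indepM (sqint_rint sX) (sqint_rint sD) h; rewrite ED mulr0.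
Qed.

Lemma Ex_mul_square c : bounded_rv c -> events_on setT c `<=` K ->
  Rintegral P setT (fun w => c w * D w ^+ 2) = v * Rintegral P setT c.
Proof.
move=> bc cK.
have h : indep2 P (events_on setT c) (events_on setT (fun w => D w ^+ 2)).
  move=> A B /cK KA [B' mB' <-]; apply: ind => //.
  exists ((fun x : R => x ^+ 2) @^-1` B') => //.
  by rewrite -[X in measurable X]setTI; exact: exprn_measurable.
have [_ ->] := Ex_indepM (sqint_rint (P := P) (bounded_sqint bc)) sD.2 h.
by rewrite ED2 mulrC.
Qed.

End centered_independent.

(** * The compensated measure of rectangles *)

Section poisson_compensated.
Context {R : realType} {d : measure_display} {Omega : measurableType d}.
Context {P : probability Omega R} {T : R} {l : {measure set R -> \bar R}}.
Context {N : Omega -> {measure set (R * R)%type -> \bar R}}.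
Hypothesis hN : poisson_random_measure P T l N.
Notation leb := (@lebesgue_measure R).
Notation strip s := (`[0, s] `*` Rstar : set (R * R)).
Notation comp := (compensated T l N).

Definition mark (S : set R) := [/\ measurable S, S `<=` Rstar & (l S < +oo)%E].

Lemma markS {S S'} : mark S -> measurable S' -> S' `<=` S -> mark S'.
Proof.
move=> [mS S0 lS] mS' SS; split => //; first exact: subset_trans S0.
by apply: le_lt_trans lS; apply: le_measure; rewrite ?inE.
Qed.

Lemma mark_fin {S} : mark S -> l S = (fine (l S))%:E.
Proof. by move=> [_ _ lS]; rewrite fineK// ge0_fin_numE. Qed.

Lemma mark_fin_num {S} : mark S -> l S \is a fin_num.
Proof. by move=> /mark_fin ->. Qed.

Lemma intensity_rect {s u : R} {S} : 0 <= s -> s <= u -> u <= T -> mark S ->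
  intensity T l (`]s, u] `*` S) = ((u - s) * fine (l S))%:E.
Proof.
move=> s0 su uT mS; have [_ S0 _] := mS.
rewrite /intensity.
transitivity (\int[leb]_(t in `[0%R, T]) ((cst (l S) \_ `]s, u]) t))%E.
  apply: eq_integral => t _; rewrite patchE; case: ifPn => tsu.
    by rewrite in_xsectionX// setIidl.
  by rewrite notin_xsectionX// set0I measure0.
rewrite -integral_mkcondr setIidr; last first.
  move=> t /=; rewrite !in_itv/= => /andP[st tu].
  by rewrite (le_trans s0 (ltW st)) (le_trans tu uT).
rewrite integral_cst//= lebesgue_measure_itv/= lte_fin.
rewrite (mark_fin mS) mulrC EFinM; congr *%E.
move: su; rewrite le_eqVlt => /predU1P[->|->//].
by rewrite ltxx subrr.
Qed.

Lemma rect_strip {s u : R} {S} : 0 <= s -> u <= T -> mark S -> `]s, u] `*` S `<=` strip T.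
Proof.
move=> s0 uT [_ S0 _] [t z] /= []; rewrite !in_itv/= => /andP[st tu] /S0.
by rewrite (le_trans s0 (ltW st)) (le_trans tu uT).
Qed.

Lemma measurable_rect {s u : R} {S} : mark S -> measurable (`]s, u] `*` S : set (R * R)).
Proof. by move=> [mS _ _]; exact: measurableX. Qed.

Lemma comp_moments {C} : measurable C -> C `<=` strip T -> (intensity T l C < +oo)%E ->
  [/\ sqint P (comp C), Rintegral P setT (comp C) = 0,
      Rintegral P setT (fun w => comp C w ^+ 2) = fine (intensity T l C) &
      {ae P, forall w, N w C \is a fin_num}].
Proof.
move=> mC CT iC; have [mN lawN _] := hN.
have i0 : 0 <= fine (intensity T l C).
  by rewrite fine_ge0// integral_ge0.
have [sX EX EX2] := poisson_moments i0 P (mN _ mC CT) (lawN _ mC CT iC).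
split => //.
have := poisson_ae_nat i0 P (mN _ mC CT) (lawN _ mC CT iC).
by apply: filterS => w [k ->].
Qed.

(** The identity is only almost sure: [fine] is not additive at infinite values, so the finiteness
    of [N w C1] and [N w C2] from [comp_moments] is essential. *)
Lemma comp_add {C1 C2} : measurable C1 -> measurable C2 ->
  C1 `<=` strip T -> C2 `<=` strip T -> C1 `&` C2 = set0 ->
  (intensity T l C1 < +oo)%E -> (intensity T l C2 < +oo)%E ->
  intensity T l (C1 `|` C2) = (intensity T l C1 + intensity T l C2)%E ->
  {ae P, forall w, comp (C1 `|` C2) w = comp C1 w + comp C2 w}.
Proof.
move=> m1 m2 s1 s2 C12 i1 i2 i12.
have [_ _ _ n1] := comp_moments m1 s1 i1.
have [_ _ _ n2] := comp_moments m2 s2 i2.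
have f1 : intensity T l C1 \is a fin_num by rewrite ge0_fin_numE// integral_ge0.
have f2 : intensity T l C2 \is a fin_num by rewrite ge0_fin_numE// integral_ge0.
apply: filterS2 n1 n2 => w fn1 fn2.
rewrite /compensated i12 (fineD f1 f2) (measureU (N w))//.
by rewrite (fineD fn1 fn2); ring.
Qed.

Lemma rect_fin {s u : R} {S} : 0 <= s -> s <= u -> u <= T -> mark S ->
  (intensity T l (`]s, u] `*` S) < +oo)%E.
Proof. by move=> s0 su uT mS; rewrite intensity_rect// ltry. Qed.

Lemma comp_time_add {s u : R} {S} : 0 <= s -> s <= u -> u <= T -> mark S ->
  {ae P, forall w, comp (`]0, u] `*` S) w - comp (`]0, s] `*` S) w =
                   comp (`]s, u] `*` S) w}.
Proof.
move=> s0 su uT mS; have sT := le_trans su uT; have u0 := le_trans s0 su.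
have E : `]0, u] `*` S = (`]0, s] `*` S) `|` (`]s, u] `*` S).
  apply/seteqP; split => -[t z] /=; rewrite !in_itv/=.
    by move=> [/andP[-> ->] Sz]; case: (leP t s) => _; [left|right].
  move=> [[/andP[-> ts] Sz]|[/andP[st ->] Sz]]; first by rewrite (le_trans ts su).
  by rewrite (le_lt_trans s0 st).
have disj : (`]0, s] `*` S) `&` (`]s, u] `*` S) = set0.
  rewrite -subset0 => -[t z] /= []; rewrite !in_itv/= => -[/andP[_ ts] _] [/andP[st _] _].
  by move: (lt_le_trans st ts); rewrite ltxx.
have iE : intensity T l (`]0, s] `*` S `|` `]s, u] `*` S) =
    (intensity T l (`]0%R, s] `*` S) + intensity T l (`]s, u] `*` S))%E.
  by rewrite -E !intensity_rect// -EFinD; congr EFin; ring.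
rewrite E; have := comp_add (measurable_rect mS) (measurable_rect mS) (rect_strip (lexx 0) sT mS)
  (rect_strip s0 uT mS) disj (rect_fin (lexx 0) s0 sT mS) (rect_fin s0 su uT mS) iE.
by apply: filterS => w ->; ring.
Qed.

Lemma comp_mark_add {s u : R} {S S'} : 0 <= s -> s <= u -> u <= T -> mark S -> mark S' ->
  S `&` S' = set0 ->
  {ae P, forall w, comp (`]s, u] `*` (S `|` S')) w =
     comp (`]s, u] `*` S) w + comp (`]s, u] `*` S') w}.
Proof.
move=> s0 su uT mS mS' SS'.
have mU : mark (S `|` S').
  have [? ? ?] := mS; have [? ? ?] := mS'; split; first exact: measurableU.
    by rewrite subUset.
  by rewrite measureU// lte_add_pinfty.
have E : `]s, u] `*` (S `|` S') = (`]s, u] `*` S) `|` (`]s, u] `*` S').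
  by apply/seteqP; split => -[t z] /=; tauto.
have disj : (`]s, u] `*` S) `&` (`]s, u] `*` S') = set0.
  rewrite -subset0 => -[t z] /= [[_ Sz] [_ Sz']].
  by have : (S `&` S') z by []; rewrite SS'.
have iE : intensity T l (`]s, u] `*` S `|` `]s, u] `*` S') =
    (intensity T l (`]s, u] `*` S) + intensity T l (`]s, u] `*` S'))%E.
  rewrite -E !intensity_rect// -EFinD; congr EFin.
  rewrite measureU//; [|by case: mS|by case: mS'].
  by rewrite (fineD (mark_fin_num mS) (mark_fin_num mS')) mulrDr.
rewrite E; exact: comp_add (measurable_rect mS) (measurable_rect mS') (rect_strip s0 uT mS)
  (rect_strip s0 uT mS') disj (rect_fin s0 su uT mS) (rect_fin s0 su uT mS') iE.
Qed.

End poisson_compensated.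

Arguments mark {R} l S.

(** * The noises and their filtration *)

(** One index type for all the driving martingales: a mark set [M] stands for the compensated number
    of jumps with mark in [M]. The isometry is then proved once, for combinations of all of them. *)
Inductive noise (R : Type) := NoiseW | NoiseB | NoiseN of set R.
Arguments NoiseW {R}. Arguments NoiseB {R}. Arguments NoiseN {R} _.

Section noises.
Context {R : realType} {d : measure_display} {Omega : measurableType d}.
Context {P : probability Omega R} {T : R} {l : {measure set R -> \bar R}}.
Context {W B : R -> Omega -> R} {N : Omega -> {measure set (R * R)%type -> \bar R}}.
Hypotheses (hP : measure_is_complete P) (hW : standard_brownian P T W)
  (hB : standard_brownian P T B) (hN : poisson_random_measure P T l N)
  (hWBN : indep3 P <<s brownian_events W T>> <<s brownian_events B T>>
                   <<s poisson_events T N>>).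
Notation comp := (compensated T l N).
Notation G := (filtG P T l W B N).

Lemma brownian_events_sub {V : R -> Omega -> R} {s u : R} : s <= u ->
  brownian_events V s `<=` brownian_events V u.
Proof.
move=> su E [r /=]; rewrite in_itv/= => /andP[r0 rs] rE.
by exists r => //=; rewrite in_itv/= r0 (le_trans rs).
Qed.

Lemma compensated_events_sub {s u : R} : s <= u ->
  compensated_events T l N s `<=` compensated_events T l N u.
Proof.
move=> su E [C [mC Cs iC] CE]; exists C => //; split => //.
move=> [t z] /Cs[/=]; rewrite in_itv/= => /andP[t0 ts] ?.
by split => //=; rewrite in_itv/= t0 (le_trans ts).
Qed.

Lemma compensated_poisson_events {s : R} : s <= T ->
  compensated_events T l N s `<=` <<s poisson_events T N>>.
Proof.
move=> sT E [C [mC Cs iC] CE].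
have sg : sigma_algebra setT <<s poisson_events T N>> by exact: smallest_sigma_algebra.
move: E CE; apply: (events_on_comp sg (h := fun x => fine x - fine (intensity T l C))).
  by apply: measurable_funB => //; exact: fine_measurable.
move=> E NE; apply: sub_gen_smallest; exists C => //; split => //.
move=> [t z] /Cs[/=]; rewrite in_itv/= => /andP[t0 ts] ?.
by split => //=; rewrite in_itv/= t0 (le_trans ts).
Qed.

Lemma sigma_measurable : sigma_algebra setT (@measurable _ Omega).
Proof.
split; [exact: measurable0|by move=> A mA; exact: measurableD|].
by move=> A mA; exact: bigcup_measurable.
Qed.

Lemma brownian_events_measurable {V} : standard_brownian P T V ->
  <<s brownian_events V T>> `<=` measurable.
Proof.
move=> [mV _ _ _ _]; apply: smallest_sub; first exact: sigma_measurable.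
move=> E [r /=]; rewrite in_itv/= => rT [A mA <-]; exact: mV.
Qed.

Lemma poisson_events_measurable : <<s poisson_events T N>> `<=` measurable.
Proof.
apply: smallest_sub; first exact: sigma_measurable.
by move=> E [C [mC CT] [A mA <-]]; case: hN => + _ _; exact.
Qed.

Lemma filtG_sigma t : sigma_algebra setT (G t).
Proof. exact: smallest_sigma_algebra. Qed.

Lemma filtG_sub s u : s <= u -> G s `<=` G u.
Proof.
move=> su; apply: smallest_sub; first exact: smallest_sigma_algebra.
move=> E [[[]|]|] h; apply: sub_gen_smallest; move: h.
- by move=> /(brownian_events_sub su) ?; left; left; left.
- by move=> /(brownian_events_sub su) ?; left; left; right.
- by move=> /(compensated_events_sub su) ?; left; right.
- by right.
Qed.

Lemma filtF_subG t : filtF P T l W N t `<=` G t.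
Proof.
apply: smallest_sub; first exact: smallest_sigma_algebra.
by move=> E [[]|] ?; apply: sub_gen_smallest; [left; left; left|left; right|right].
Qed.

Lemma filtG_measurable t : t <= T -> G t `<=` measurable.
Proof.
move=> tT; apply: smallest_sub; first exact: sigma_measurable.
move=> E [[[]|]|].
- move=> /(brownian_events_sub tT) ?; apply: (brownian_events_measurable hW).
  exact: sub_gen_smallest.
- move=> /(brownian_events_sub tT) ?; apply: (brownian_events_measurable hB).
  exact: sub_gen_smallest.
- by move=> /(compensated_poisson_events tT); exact: poisson_events_measurable.
- exact: hP.
Qed.

Definition noise_val (k : noise R) (t : R) (w : Omega) : R :=
  match k with
  | NoiseW => W t w | NoiseB => B t w | NoiseN M => comp (`]0, t] `*` M) w
  end.

Definition noise_ok (k : noise R) := if k is NoiseN M then mark l M else True.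

(** The rate of the predictable bracket of the two noises, a constant since the increments are
    stationary and independent of the past. *)
Definition noise_cov (k j : noise R) : R :=
  match k, j with
  | NoiseW, NoiseW => 1 | NoiseB, NoiseB => 1
  | NoiseN M, NoiseN M' => fine (l (M `&` M')) | _, _ => 0
  end.

(* What is independent of the increments of each noise after time s. *)
Let past (k : noise R) (s : R) : set (set Omega) :=
  match k with
  | NoiseW => <<s (<<s brownian_events W s>> `|` <<s brownian_events B T>>
                   `|` <<s poisson_events T N>>) `|` P.-negligible>>
  | NoiseB => <<s (<<s brownian_events B s>> `|` <<s brownian_events W T>>
                   `|` <<s poisson_events T N>>) `|` P.-negligible>>
  | NoiseN _ => <<s (<<s compensated_events T l N s>> `|` <<s brownian_events B T>>
                   `|` <<s brownian_events W T>>) `|` P.-negligible>>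
  end.

Let past_sigma k s : sigma_algebra setT (past k s).
Proof. by case: k => [||S]; exact: smallest_sigma_algebra. Qed.

Let filtG_past k s : s <= T -> G s `<=` past k s.
Proof.
move=> sT; apply: smallest_sub; first exact: past_sigma.
move=> E [[[bW|bB]|cN]|nE]; case: k => [||S]; apply: sub_gen_smallest; try (by right); left.
- by left; left; apply: sub_gen_smallest.
- by left; right; apply: sub_gen_smallest; exact: brownian_events_sub bW.
- by right; apply: sub_gen_smallest; exact: brownian_events_sub bW.
- by left; right; apply: sub_gen_smallest; exact: brownian_events_sub bB.
- by left; left; apply: sub_gen_smallest.
- by left; right; apply: sub_gen_smallest; exact: brownian_events_sub bB.
- by right; exact: compensated_poisson_events cN.
- by right; exact: compensated_poisson_events cN.
- by left; left; apply: sub_gen_smallest.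
Qed.

(* Increment of the noise, up to a null set. *)
Let incr (k : noise R) (s u : R) (w : Omega) : R :=
  match k with
  | NoiseW => W u w - W s w | NoiseB => B u w - B s w
  | NoiseN M => comp (`]s, u] `*` M) w
  end.

Let incr_ae k s u : 0 <= s -> s <= u -> u <= T -> noise_ok k ->
  {ae P, forall w, noise_val k u w - noise_val k s w = incr k s u w}.
Proof.
case: k => [||S] s0 su uT ok; try exact: aeW.
exact: comp_time_add.
Qed.

Let brownian_incr (V : R -> Omega -> R) (s u : R) : standard_brownian P T V -> 0 <= s -> s < u -> u <= T ->
  [/\ sqint P (fun w => V u w - V s w),
      Rintegral P setT (fun w => V u w - V s w) = 0 &
      Rintegral P setT (fun w => (V u w - V s w) ^+ 2) = u - s].
Proof.
move=> [mV _ _ _ lawV] s0 su uT.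
have us : 0 < u - s by rewrite subr_gt0.
have sq : 0 < Num.sqrt (u - s) by rewrite sqrtr_gt0.
have mI : measurable_fun setT (fun w => V u w - V s w).
  apply: measurable_funB; apply: mV.
    by rewrite uT (le_trans s0 (ltW su)).
  by rewrite s0 (le_trans (ltW su)).
have [? ? E] := gaussian_moments sq P _ mI (lawV s u s0 su uT).
by split => //; rewrite E sqr_sqrtr// ltW.
Qed.

Let incr_events_brownian (V : R -> Omega -> R) (s u : R) : 0 <= s -> s <= u -> u <= T ->
  events_on setT (fun w => V u w - V s w : R) `<=` <<s brownian_events V T>>.
Proof.
move=> s0 su uT; apply: events_onB; first exact: smallest_sigma_algebra.
  move=> E VE; apply: sub_gen_smallest; exists u => //=; rewrite in_itv/= uT.
  by rewrite (le_trans s0 su).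
move=> E VE; apply: sub_gen_smallest; exists s => //=; rewrite in_itv/= s0.
by rewrite (le_trans su uT).
Qed.

Let incr_moments k s u : 0 <= s -> s <= u -> u <= T -> noise_ok k ->
  [/\ sqint P (incr k s u), Rintegral P setT (incr k s u) = 0 &
      Rintegral P setT (fun w => incr k s u w ^+ 2) = (u - s) * noise_cov k k].
Proof.
move=> s0; rewrite le_eqVlt => /predU1P[<-|su] uT ok; last first.
  case: k ok => [||S] ok; rewrite ?mulr1; try exact: brownian_incr.
  have [? ? E _] := comp_moments hN (measurable_rect ok) (rect_strip s0 uT ok)
    (rect_fin s0 (ltW su) uT ok).
  by split => //; rewrite E (intensity_rect s0 (ltW su) uT ok)/= setIid.
(* The law of a Brownian increment is given for [s < u] only; when the endpoints coincide the
   increment vanishes. *)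
have E0 : incr k s s = cst 0.
  apply/funext => w; case: k ok => [||S] ok /=; rewrite ?subrr//.
  by rewrite set_itvoc0 set0X /compensated !measure0/= /intensity;
    under eq_integral do rewrite xsection0 set0I measure0; rewrite integral0 subrr.
rewrite E0 subrr mul0r; split; [exact: sqint_cst|exact: Ex_cst|].
by rewrite -[RHS](Ex_cst (P := P) 0); congr Rintegral; apply/funext => w; rewrite expr0n.
Qed.

(** An increment is independent of the past of its own noise by the Brownian hypothesis or by
    [poisson_past_indep]; [indep2_join] then adjoins the two other noises, taken up to [T]. *)
Let incr_indep k s u : 0 <= s -> s < u -> u <= T -> noise_ok k ->
  indep2 P (past k s) (events_on setT (incr k s u)).
Proof.
move=> s0 su uT; have sT := le_trans (ltW su) uT.
have sig (Q : set (set Omega)) : sigma_algebra setT <<s Q>> by exact: smallest_sigma_algebra.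
have mW := brownian_events_measurable hW.
have mB := brownian_events_measurable hB.
have mN := poisson_events_measurable.
case: k => [_|_|S ok] /=.
- apply: (indep2_join _ _ _ _ _ hP _ _ _ _ mW mB mN hWBN) => //.
  + apply: smallest_sub => // E /(brownian_events_sub sT) ?; exact: sub_gen_smallest.
  + exact: incr_events_brownian s0 (ltW su) uT.
  + by case: hW => _ _ _ + _; exact.
- apply: (indep2_join _ _ _ _ _ hP _ _ _ _ mB mW mN (indep3C12 hWBN)) => //.
  + apply: smallest_sub => // E /(brownian_events_sub sT) ?; exact: sub_gen_smallest.
  + exact: incr_events_brownian s0 (ltW su) uT.
  + by case: hB => _ _ _ + _; exact.
- have evN : events_on setT (comp (`]s, u] `*` S)) `<=` events_on setT (fun w => N w (`]s, u] `*` S)).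
    move=> E [A mA <-]; exists ((fun x => fine x - fine (intensity T l (`]s, u] `*` S))) @^-1` A) => //.
    have mh : measurable_fun setT (fun x : \bar R => fine x - fine (intensity T l (`]s, u] `*` S))).
      by apply: measurable_funB => //; exact: fine_measurable.
    by have := mh measurableT A mA; rewrite setTI.
  apply: (indep2_join _ _ _ _ _ hP _ _ _ _ mN mB mW (indep3C13 hWBN)) => //.
  + apply: smallest_sub => //; exact: compensated_poisson_events.
  + move=> E /evN NE; apply: sub_gen_smallest; exists (`]s, u] `*` S) => //.
    by split; [exact: (measurable_rect ok)|exact: (rect_strip s0 uT ok)].
  + move=> A E sA /evN; move: A E sA; apply: (poisson_past_indep hN sT).
    * exact: (measurable_rect ok).
    * exact: (rect_strip s0 uT ok).
    rewrite -subset0 => -[t z] /= []; rewrite !in_itv/= => -[/andP[st _] _] [/andP[_ ts] _].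
    by move: (lt_le_trans st ts); rewrite ltxx.
Qed.

Let incr_events k s u : 0 <= s -> s <= u -> u <= T -> noise_ok k ->
  events_on setT (incr k s u) `<=`
    match k with NoiseW => <<s brownian_events W T>> | NoiseB => <<s brownian_events B T>>
    | NoiseN _ => <<s poisson_events T N>> end.
Proof.
move=> s0 su uT; case: k => [||M] ok /=; try exact: incr_events_brownian.
move=> E NE; apply: (compensated_poisson_events (lexx T)).
exists (`]s, u] `*` M) => //; split; first exact: (measurable_rect ok).
- exact: (rect_strip s0 uT ok).
- exact: (rect_fin s0 su uT ok).
Qed.

Let noise_kind (k : noise R) : nat :=
  match k with NoiseW => 0 | NoiseB => 1 | NoiseN _ => 2 end.

(** [past j s] contains the other noises up to [T], hence also their increments after [s]. This
    makes products of increments of different kinds centred. *)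
Let cross_events k j s u : 0 <= s -> s <= u -> u <= T -> noise_ok k ->
  noise_kind k != noise_kind j ->
  events_on setT (incr k s u) `<=` past j s.
Proof.
move=> s0 su uT ok kj E /(incr_events k s u s0 su uT ok).
by case: k j ok kj => [||M] [||M'] //= _ _ h; apply: sub_gen_smallest; left;
  first [by right|by left; right].
Qed.

Section conditional_moments.
Context {s u : R} (s0 : 0 <= s) (su : s < u) (uT : u <= T).

Let incr_sqint k : noise_ok k -> sqint P (incr k s u).
Proof. by move=> ok; have [] := incr_moments k s u s0 (ltW su) uT ok. Qed.

Lemma incr_mean k X : noise_ok k -> sqint P X -> events_on setT X `<=` past k s ->
  Rintegral P setT (fun w => X w * incr k s u w) = 0.
Proof.
move=> ok sX XK; have [sI EI _] := incr_moments k s u s0 (ltW su) uT ok.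
exact: (Ex_mul_centered (incr_indep k s u s0 su uT ok) sI EI).
Qed.

Context {c : Omega -> R} (bc : bounded_rv c) (cG : events_on setT c `<=` G s).

Let c_past k : events_on setT c `<=` past k s.
Proof. by apply: subset_trans cG _; apply: filtG_past; exact: le_trans (ltW su) uT. Qed.

Let incr_square k : noise_ok k ->
  Rintegral P setT (fun w => c w * incr k s u w ^+ 2) =
  (u - s) * noise_cov k k * Rintegral P setT c.
Proof.
move=> ok; have [sI EI EI2] := incr_moments k s u s0 (ltW su) uT ok.
exact: (Ex_mul_square (incr_indep k s u s0 su uT ok) sI EI2).
Qed.

Let rint_triple k j : noise_ok k -> noise_ok j ->
  rint P (fun w => c w * (incr k s u w * incr j s u w)).
Proof.
move=> ok oj; under [X in rint P X]eq_fun do rewrite mulrA.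
by apply: sqint_mul; [apply: sqint_bmul => //|]; exact: incr_sqint.
Qed.

(** Polarisation: [incr_square] for [M], for [M'] and for their union, together with the additivity
    of [l], leaves nothing for the mixed term. The joint law of the two increments and the past does
    not enter. *)
Let incr_cov_disjoint M M' : mark l M -> mark l M' -> M `&` M' = set0 ->
  Rintegral P setT (fun w => c w * (incr (NoiseN M) s u w * incr (NoiseN M') s u w)) = 0.
Proof.
move=> ok ok' dis.
have okU : mark l (M `|` M').
  have [? ? ?] := ok; have [? ? ?] := ok'; split; first exact: measurableU.
    by rewrite subUset.
  by rewrite measureU// lte_add_pinfty.
have := incr_square (NoiseN (M `|` M')) okU.
have mc := bc.1.
have mI k : noise_ok k -> measurable_fun setT (incr k s u).
  by move=> /incr_sqint[].
rewrite (@Ex_ae _ _ _ P _ (fun w => c w * incr (NoiseN M) s u w ^+ 2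
    + 2 * (c w * (incr (NoiseN M) s u w * incr (NoiseN M') s u w))
    + c w * incr (NoiseN M') s u w ^+ 2)); last 3 first.
- by apply: measurable_funM => //; apply: measurable_funX; exact: mI.
- apply: measurable_funD; first apply: measurable_funD.
  + by apply: measurable_funM => //; apply: measurable_funX; exact: (mI (NoiseN M)).
  + apply: measurable_funM => //; apply: measurable_funM => //.
    by apply: measurable_funM; [exact: (mI (NoiseN M))|exact: (mI (NoiseN M'))].
  + by apply: measurable_funM => //; apply: measurable_funX; exact: (mI (NoiseN M')).
- have := comp_mark_add hN s0 (ltW su) uT ok ok' dis.
  by apply: filterS => w /= ->; ring.
have sqr k : noise_ok k -> rint P (fun w => c w * incr k s u w ^+ 2).
  by move=> okk; have := rint_triple k k okk okk.
have i1 := sqr (NoiseN M) ok.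
have i2 := sqr (NoiseN M') ok'.
have i3 := rint_triple (NoiseN M) (NoiseN M') ok ok'.
rewrite ExD//; last by apply: rintD => //; exact: rintZ.
rewrite ExD//; last exact: rintZ.
rewrite ExZ// (incr_square (NoiseN M) ok) (incr_square (NoiseN M') ok')/= !setIid.
rewrite (measureU l); [|by case: ok|by case: ok'|by []].
rewrite (fineD (mark_fin_num ok) (mark_fin_num ok')).
by nra.
Qed.

(** For noises of different kinds, the first increment is a factor from the past of the second. For
    two mark sets, both are cut along their intersection: the products over disjoint pieces vanish,
    and the square over [M] intersected with [M'] remains. *)
Lemma incr_cov k j : noise_ok k -> noise_ok j ->
  Rintegral P setT (fun w => c w * (incr k s u w * incr j s u w)) =
  (u - s) * noise_cov k j * Rintegral P setT c.
Proof.
have cross k' j' : noise_ok k' -> noise_ok j' ->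
    noise_kind k' != noise_kind j' ->
    Rintegral P setT (fun w => c w * (incr k' s u w * incr j' s u w)) = 0.
  move=> ok oj kj; under eq_Rintegral do rewrite mulrA.
  apply: (incr_mean j' (fun w => c w * incr k' s u w)) => //.
    by apply: sqint_bmul => //; exact: incr_sqint.
  apply: events_onM; [exact: past_sigma|exact: c_past|].
  exact: (cross_events k' j' s u s0 (ltW su) uT ok kj).
move=> ok oj; case: k j ok oj => [||M] [||M'] ok oj;
  try (by rewrite cross// mulr0 mul0r).
- by rewrite -(incr_square NoiseW I); congr Rintegral; apply/funext => w; rewrite expr2.
- by rewrite -(incr_square NoiseB I); congr Rintegral; apply/funext => w; rewrite expr2.
have [mM _ _] := ok; have [mM' _ _] := oj.
have ka : mark l (M `\` M') by apply: (markS ok); [exact: measurableD|exact: subDsetl].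
have kb : mark l (M `&` M') by apply: (markS ok); [exact: measurableI|exact: subIsetl].
have kc : mark l (M' `\` M) by apply: (markS oj); [exact: measurableD|exact: subDsetl].
have dab : (M `\` M') `&` (M `&` M') = set0 by apply/seteqP; split => x //= [[_ ?] []].
have dcb : (M' `\` M) `&` (M `&` M') = set0 by apply/seteqP; split => x //= [[_ ?] []].
have dac : (M `\` M') `&` (M' `\` M) = set0 by apply/seteqP; split => x //= [[_ ?] []].
have dbc : (M `&` M') `&` (M' `\` M) = set0 by rewrite setIC.
have mI k : noise_ok k -> measurable_fun setT (incr k s u) by move=> /incr_sqint[].
pose a := NoiseN (M `\` M'); pose b := NoiseN (M `&` M'); pose e := NoiseN (M' `\` M).
have tri k j : noise_ok k -> noise_ok j ->
    measurable_fun setT (fun w => c w * (incr k s u w * incr j s u w)).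
  by move=> okk okj; exact: rint_measurable (rint_triple k j okk okj).
rewrite (@Ex_ae _ _ _ P _ (fun w => (c w * (incr a s u w * incr e s u w)
    + c w * (incr a s u w * incr b s u w))
    + (c w * (incr b s u w * incr e s u w) + c w * incr b s u w ^+ 2))).
- have i1 := rint_triple a e ka kc; have i2 := rint_triple a b ka kb.
  have i3 := rint_triple b e kb kc; have i4 : rint P (fun w => c w * incr b s u w ^+ 2).
    exact: (rint_triple b b kb kb).
  rewrite ExD; [|exact: rintD|exact: rintD].
  rewrite ExD// ExD// (incr_square b kb) !incr_cov_disjoint// !add0r.
  by rewrite /= setIid.
- exact: (tri (NoiseN M) (NoiseN M')).
- apply: measurable_funD; apply: measurable_funD; try exact: tri.
- apply: filterS2 (comp_mark_add hN s0 (ltW su) uT ka kb dab)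
    (comp_mark_add hN s0 (ltW su) uT kc kb dcb) => w.
  have -> : (M `\` M') `|` (M `&` M') = M by rewrite setUC setUIDK.
  have -> : (M' `\` M) `|` (M `&` M') = M' by rewrite setUC setIC setUIDK.
  by rewrite /= => -> ->; ring.
Qed.

End conditional_moments.

Lemma noise_events k t : noise_ok k -> 0 <= t <= T -> events_on setT (noise_val k t) `<=` G t.
Proof.
case: k => [||M] ok t0T E Et; apply: sub_gen_smallest; left.
- by left; left; exists t => //=; rewrite in_itv/= lexx; case/andP : t0T => ->.
- by left; right; exists t => //=; rewrite in_itv/= lexx; case/andP : t0T => ->.
right; exists (`]0, t] `*` M) => //; case/andP : t0T => t0 tT; split.
- exact: (measurable_rect ok).
- exact: (rect_strip (lexx 0) (lexx t) ok).
- exact: (rect_fin (lexx 0) t0 tT ok).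
Qed.

Lemma noise_measurable k t : noise_ok k -> 0 <= t <= T -> measurable_fun setT (noise_val k t).
Proof.
move=> ok t0T _ A mA; have /andP[_ tT] := t0T; apply: (filtG_measurable t tT).
by apply: (noise_events k t ok t0T); exists A.
Qed.

(** The increment in the form in which it occurs in the simple integrals; [incr] agrees with it
    almost surely, which is enough for expectations. *)
Definition noise_incr k s u w := noise_val k u w - noise_val k s w.

Let measurable_incr k s u : noise_ok k -> 0 <= s -> s <= u -> u <= T ->
  measurable_fun setT (noise_incr k s u).
Proof.
move=> ok s0 su uT; apply: measurable_funB; apply: noise_measurable => //.
  by rewrite uT (le_trans s0 su).
by rewrite s0 (le_trans su uT).
Qed.

Lemma noise_incr_sqint {k s u} : noise_ok k -> 0 <= s -> s <= u -> u <= T ->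
  sqint P (noise_incr k s u).
Proof.
move=> ok s0 su uT; have mI := measurable_incr k s u ok s0 su uT; split => //.
have [[_ sI] _ _] := incr_moments k s u s0 su uT ok.
apply: (rint_ae _ sI); first exact: measurable_funX.
by apply: filterS (incr_ae k s u s0 su uT ok) => w; rewrite /noise_incr => ->.
Qed.

Lemma noise_incr_mean {k s u X} : noise_ok k -> 0 <= s -> s <= u -> u <= T ->
  sqint P X -> events_on setT X `<=` G s ->
  Rintegral P setT (fun w => X w * noise_incr k s u w) = 0.
Proof.
move=> ok s0 su uT sX XG; move: (su); rewrite le_eqVlt => /predU1P[<-|slu].
  under eq_Rintegral do rewrite /noise_incr subrr mulr0; exact: Ex_cst.
have [sI _ _] := incr_moments k s u s0 su uT ok.
rewrite -(incr_mean s0 slu uT k X ok sX); last first.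
  by apply: subset_trans XG _; apply: filtG_past; exact: le_trans uT.
apply: Ex_ae.
- by apply: measurable_funM; [case: sX|exact: measurable_incr].
- by apply: measurable_funM; [case: sX|case: sI].
by apply: filterS (incr_ae k s u s0 su uT ok) => w; rewrite /noise_incr => ->.
Qed.

Lemma noise_incr_cov {k j s u c} : noise_ok k -> noise_ok j -> 0 <= s -> s <= u -> u <= T ->
  bounded_rv c -> events_on setT c `<=` G s ->
  Rintegral P setT (fun w => c w * (noise_incr k s u w * noise_incr j s u w)) =
  (u - s) * noise_cov k j * Rintegral P setT c.
Proof.
move=> ok oj s0 su uT bc cG; move: (su); rewrite le_eqVlt => /predU1P[<-|slu].
  rewrite subrr !mul0r.
  by under eq_Rintegral do rewrite /noise_incr subrr mul0r mulr0; exact: Ex_cst.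
have [sI _ _] := incr_moments k s u s0 su uT ok.
have [sJ _ _] := incr_moments j s u s0 su uT oj.
rewrite -(incr_cov s0 slu uT bc cG k j ok oj).
apply: Ex_ae.
- apply: measurable_funM; first by case: bc.
  by apply: measurable_funM; exact: measurable_incr.
- apply: measurable_funM; first by case: bc.
  by apply: measurable_funM; [case: sI|case: sJ].
apply: filterS2 (incr_ae k s u s0 su uT ok) (incr_ae j s u s0 su uT oj) => w.
by rewrite /noise_incr => -> ->.
Qed.

End noises.

Arguments noise_ok {R} l k.
Arguments noise_cov {R} l k j.

(** * Isometry for simple integrands *)

Section simple_isometry.
Context {R : realType} {d : measure_display} {Omega : measurableType d}.
Context {P : probability Omega R} {T : R} {H : R -> set (set Omega)}.
Hypotheses (Hsigma : forall t, sigma_algebra setT (H t))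
  (Hsub : forall s t : R, s <= t -> H s `<=` H t)
  (Hmeas : forall t : R, t <= T -> H t `<=` measurable).
Context {K : Type} {ok : K -> Prop} {m : K -> R -> Omega -> R} {cov : K -> K -> R}.
Local Notation incr k s u := (fun w => m k u w - m k s w).
Hypotheses (cov_sym : forall k j, cov k j = cov j k)
  (m_events : forall k t, ok k -> 0 <= t <= T -> events_on setT (m k t) `<=` H t)
  (m_sqint : forall k s u, ok k -> 0 <= s -> s <= u -> u <= T -> sqint P (incr k s u))
  (m_mean : forall k s u X, ok k -> 0 <= s -> s <= u -> u <= T ->
    sqint P X -> events_on setT X `<=` H s ->
    Rintegral P setT (fun w => X w * (m k u w - m k s w)) = 0)
  (m_cov : forall k j s u c, ok k -> ok j -> 0 <= s -> s <= u -> u <= T ->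
    bounded_rv c -> events_on setT c `<=` H s ->
    Rintegral P setT (fun w => c w * ((m k u w - m k s w) * (m j u w - m j s w))) =
    (u - s) * cov k j * Rintegral P setT c).
Local Notation Ex X := (Rintegral P setT X).

Let ev_incr k s u v : ok k -> 0 <= s -> s <= u -> u <= v -> v <= T ->
  events_on setT (incr k s u) `<=` H v.
Proof.
move=> okk s0 su uv vT; apply: events_onB; first exact: Hsigma.
  apply: subset_trans (Hsub _ _ uv); apply: m_events => //.
  by rewrite (le_trans s0 su) (le_trans uv vT).
apply: subset_trans (Hsub _ _ (le_trans su uv)); apply: m_events => //.
by rewrite s0 (le_trans su (le_trans uv vT)).
Qed.

Let ev_sub {X : Omega -> R} s t : s <= t -> events_on setT X `<=` H s -> events_on setT X `<=` H t.
Proof. by move=> st XH; apply: subset_trans XH (Hsub _ _ st). Qed.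

(** If [p <= q], the longer increment is cut at [p]: its later part is centred given what is known
    at [p], and the two parts over []s, p]] fall under [m_cov]. *)
Let pair_same_start k j s p q c : ok k -> ok j -> 0 <= s -> s <= p -> s <= q ->
  p <= T -> q <= T -> bounded_rv c -> events_on setT c `<=` H s ->
  Ex (fun w => c w * ((m k p w - m k s w) * (m j q w - m j s w))) =
  (Num.min p q - s) * cov k j * Ex c.
Proof.
wlog pq : k j p q / p <= q => [hw|].
  move=> okk okj s0 sp sq pT qT bc cH; case: (leP p q) => [pq|/ltW qp].
    by rewrite (hw k j p q pq) ?(min_idPl pq).
  under eq_Rintegral do rewrite (mulrC (m k p _ - _)).
  by rewrite (hw j k q p qp)// (min_idPl qp) cov_sym.
move=> okk okj s0 sp sq pT qT bc cH; rewrite (min_idPl pq).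
have E w : c w * ((m k p w - m k s w) * (m j q w - m j s w)) =
    c w * ((m k p w - m k s w) * (m j p w - m j s w)) +
    c w * (m k p w - m k s w) * (m j q w - m j p w) by ring.
under eq_Rintegral do rewrite E.
have i1 := m_sqint k s p okk s0 sp pT.
have i2 := m_sqint j s p okj s0 sp pT.
have i3 := m_sqint j p q okj (le_trans s0 sp) pq qT.
have i4 := sqint_bmul bc i1.
rewrite ExD; [|by have := sqint_mul i4 i2; under eq_fun do rewrite -mulrA|exact: sqint_mul].
rewrite m_cov// [X in _ + X](m_mean j p q (fun w => c w * (m k p w - m k s w)))//.
- by rewrite addr0.
- exact: le_trans s0 sp.
- apply: events_onM; first exact: Hsigma.
    exact: (ev_sub s p).
  exact: ev_incr.
Qed.

(** The first increment is cut at [a'], through [r] and [p], which cover intersecting and disjoint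
    intervals alike. The part before [a'] is known when the second increment starts and contributes
    0; the rest starts at [a'] as well, which is the case of [pair_same_start]. *)
Let pair_ordered k j a b a' b' c c' : ok k -> ok j -> 0 <= a -> a <= b -> b <= T ->
  a' <= b' -> b' <= T -> a <= a' ->
  bounded_rv c -> events_on setT c `<=` H a -> bounded_rv c' -> events_on setT c' `<=` H a' ->
  Ex (fun w => (c w * (m k b w - m k a w)) * (c' w * (m j b' w - m j a' w))) =
  Num.max 0 (Num.min b b' - Num.max a a') * cov k j * Ex (fun w => c w * c' w).
Proof.
move=> okk okj a0 ab bT ab' bT' aa' bc cH bc' cH'.
rewrite (max_idPr aa').
pose p := Num.max b a'; pose r := Num.min b a'.
have a'0 := le_trans a0 aa'.
have a'T := le_trans ab' bT'.
have E w : (c w * (m k b w - m k a w)) * (c' w * (m j b' w - m j a' w)) =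
    (c w * c' w * (m k r w - m k a w)) * (m j b' w - m j a' w) +
    (c w * c' w) * ((m k p w - m k a' w) * (m j b' w - m j a' w)).
  by rewrite /r /p; case: (leP b a') => _; ring.
under eq_Rintegral do rewrite E.
have bcc := boundedM bc bc'.
have cc'H : events_on setT (fun w => c w * c' w) `<=` H a'.
  by apply: events_onM; [exact: Hsigma|exact: (ev_sub a a')|].
have ar : a <= r by rewrite /r le_min ab.
have ra' : r <= a' by rewrite /r ge_min lexx orbT.
have a'p : a' <= p by rewrite /p le_max lexx orbT.
have pT : p <= T by rewrite /p ge_max bT.
have i1 := m_sqint k a r okk a0 ar (le_trans ra' a'T).
have i2 := m_sqint j a' b' okj a'0 ab' bT'.
have i3 := m_sqint k a' p okk a'0 a'p pT.
have i4 := sqint_bmul bcc i1.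
have i5 := sqint_bmul bcc i3.
rewrite ExD; [|exact: sqint_mul|]; last first.
  by have := sqint_mul i5 i2; under eq_fun do rewrite -mulrA.
rewrite [X in X + _](m_mean j a' b' (fun w => c w * c' w * (m k r w - m k a w)))//; last first.
  by apply: events_onM => //; exact: ev_incr.
rewrite add0r pair_same_start//; congr (_ * _ * _).
rewrite /p; case: (leP b a') => ba'.
  by rewrite (min_idPl ab') subrr; apply/esym/max_idPl; rewrite subr_le0 ge_min ba'.
by apply/esym/max_idPr; rewrite subr_ge0 le_min ab' ltW.
Qed.

(** One term of a simple integrand, carrying the noise it is integrated against. Lists of items
    cover simple processes against [W] and [B] and simple fields at the same time. *)
Record item := Item { it_left : R; it_right : R; it_coef : Omega -> R; it_kind : K;
  it_coef_ok : simple_coef T H it_left it_right it_coef; it_kind_ok : ok it_kind }.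

Definition clamp (t u x : R) := Num.min (Num.max x t) u.

Definition it_incr (t u : R) (i : item) (w : Omega) :=
  it_coef i w * (m (it_kind i) (clamp t u (it_right i)) w - m (it_kind i) (clamp t u (it_left i)) w).

(** The length of the common part of the two time intervals inside [[t, u]], as [overlap_integral]
    confirms. *)
Definition overlap (t u : R) (i j : item) :=
  Num.max 0 (Num.min (clamp t u (it_right i)) (clamp t u (it_right j))
             - Num.max (clamp t u (it_left i)) (clamp t u (it_left j))).

Let overlapC t u i j : overlap t u i j = overlap t u j i.
Proof. by rewrite /overlap; congr (Num.max 0 (_ - _)); [exact: minC|exact: maxC]. Qed.

Section interval.
Context {t u : R} (t0 : 0 <= t) (tu : t <= u) (uT : u <= T).

Let clamp_le x y : x <= y -> clamp t u x <= clamp t u y.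
Proof.
move=> xy; rewrite /clamp le_min !ge_min lexx orbT andbT; apply/orP; left.
by rewrite ge_max !le_max xy lexx !orbT.
Qed.

Let clamp_t x : t <= clamp t u x.
Proof. by rewrite /clamp le_min tu andbT le_max lexx orbT. Qed.

Let clamp_T x : clamp t u x <= T.
Proof. by rewrite /clamp (le_trans _ uT)// ge_min lexx orbT. Qed.

Let le_clamp x : x <= u -> x <= clamp t u x.
Proof. by move=> xu; rewrite /clamp le_min xu andbT le_max lexx. Qed.

Let clamp_u x : u <= x -> clamp t u x = u.
Proof. by move=> ux; rewrite /clamp; apply/min_idPr; rewrite le_max ux. Qed.

Let it_bounded i : bounded_rv (it_coef i).
Proof.
have [_ ab bT cH [M cM]] := it_coef_ok i; split; last by exists M.
move=> _ A mA; apply: (Hmeas _ (le_trans ab bT)); apply: cH; by exists A.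
Qed.

Let it_lr i : it_left i <= it_right i. Proof. by case: (it_coef_ok i). Qed.

Let it_sqint i : sqint P (it_incr t u i).
Proof.
apply: sqint_bmul; first exact: it_bounded.
apply: m_sqint; [exact: it_kind_ok|exact: le_trans t0 (clamp_t _)|exact/clamp_le/it_lr|
  exact: clamp_T].
Qed.

(** Such an item is treated apart because its coefficient need not be known at the clamped left
    endpoint, which is [u]. *)
Let it_late i : u < it_left i -> it_incr t u i = cst 0.
Proof.
move=> ul; apply/funext => w; rewrite /it_incr !clamp_u ?subrr ?mulr0//.
  exact: ltW.
exact: le_trans (ltW ul) (it_lr i).
Qed.

Let it_coef_events i : it_left i <= u ->
  events_on setT (it_coef i) `<=` H (clamp t u (it_left i)).
Proof.
move=> iu; have [_ _ _ cH _] := it_coef_ok i.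
by apply: subset_trans cH _; exact/Hsub/le_clamp.
Qed.

Lemma it_pair i j : Ex (fun w => it_incr t u i w * it_incr t u j w) =
  overlap t u i j * cov (it_kind i) (it_kind j) * Ex (fun w => it_coef i w * it_coef j w).
Proof.
wlog ij : i j / clamp t u (it_left i) <= clamp t u (it_left j) => [hw|].
  have [|/ltW] := leP (clamp t u (it_left i)) (clamp t u (it_left j)); first exact: hw.
  move=> /(hw j i); rewrite overlapC cov_sym.
  under eq_Rintegral do rewrite mulrC.
  by under [in X in _ -> _ = X]eq_Rintegral do rewrite mulrC.
have late k k' : clamp t u (it_left k) <= clamp t u (it_left k') ->
    u < it_left k' -> overlap t u k k' = 0.
  move=> kk' ul; rewrite /overlap; apply/max_idPl; rewrite subr_le0.
  rewrite (clamp_u _ (ltW ul)) (clamp_u (it_right k')); last exact: le_trans (ltW ul) (it_lr _).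
  by apply: (@le_trans _ _ u); [rewrite ge_min lexx orbT|rewrite le_max lexx orbT].
have [jl|lj] := leP (it_left j) u; last first.
  rewrite (late _ _ ij lj) !mul0r (it_late _ lj).
  by under eq_Rintegral do rewrite mulr0; exact: Ex_cst.
have [il|li] := leP (it_left i) u; last first.
  have ji : clamp t u (it_left j) <= clamp t u (it_left i).
    by rewrite (clamp_u _ (ltW li)) /clamp ge_min lexx orbT.
  rewrite overlapC (late _ _ ji li) !mul0r (it_late _ li).
  by under eq_Rintegral do rewrite mul0r; exact: Ex_cst.
apply: pair_ordered; rewrite ?clamp_T//.
- exact: it_kind_ok.
- exact: it_kind_ok.
- exact: le_trans t0 (clamp_t _).
- exact/clamp_le/it_lr.
- exact/clamp_le/it_lr.
- exact: it_coef_events.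
- exact: it_coef_events.
Qed.

Lemma it_mean i X : sqint P X -> events_on setT X `<=` H t ->
  Ex (fun w => X w * it_incr t u i w) = 0.
Proof.
move=> sX XH; have [il|li] := leP (it_left i) u; last first.
  by rewrite (it_late _ li); under eq_Rintegral do rewrite mulr0; exact: Ex_cst.
under eq_Rintegral do rewrite mulrA (mulrC (X _)).
apply: (m_mean _ _ _ (fun w => it_coef i w * X w)).
- exact: it_kind_ok.
- exact: le_trans t0 (clamp_t _).
- exact/clamp_le/it_lr.
- exact: clamp_T.
- by apply: sqint_bmul => //; exact: it_bounded.
apply: events_onM; [exact: Hsigma|exact: it_coef_events|].
exact: (ev_sub t).
Qed.

(** The products with [X] vanish because [X] is known at time [t]. The double sum is the one that
    [qnorm_val] obtains from the norm of the integrand. *)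
Lemma it_isometry (its : seq item) X : sqint P X -> events_on setT X `<=` H t ->
  Ex (fun w => (X w + \sum_(i <- its) it_incr t u i w) ^+ 2) =
  Ex (fun w => X w ^+ 2) + \sum_(i <- its) \sum_(j <- its)
    overlap t u i j * cov (it_kind i) (it_kind j) * Ex (fun w => it_coef i w * it_coef j w).
Proof.
move=> sX XH.
have E w : (X w + \sum_(i <- its) it_incr t u i w) ^+ 2 =
    X w ^+ 2 + (\sum_(i <- its) 2 * (X w * it_incr t u i w) +
    \sum_(i <- its) \sum_(j <- its) it_incr t u i w * it_incr t u j w).
  rewrite -mulr_sumr -mulr_sumr.
  under [X in _ + (_ + X)]eq_bigr do rewrite -mulr_sumr.
  by rewrite -mulr_suml; ring.
under eq_Rintegral do rewrite E.
have iXi i : rint P (fun w => 2 * (X w * it_incr t u i w)) by apply: rintZ; exact: sqint_mul.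
have iij i j : rint P (fun w => it_incr t u i w * it_incr t u j w) by exact: sqint_mul.
have ii i : rint P (fun w => \sum_(j <- its) it_incr t u i w * it_incr t u j w).
  exact: rint_sum.
rewrite ExD; [|by case: sX|by apply: rintD; exact: rint_sum]; congr (_ + _).
rewrite ExD; [|exact: rint_sum|exact: rint_sum].
rewrite Ex_sum// big1 ?add0r; last first.
  by move=> i _; rewrite ExZ ?it_mean ?mulr0//; exact: sqint_mul.
by rewrite Ex_sum//; apply: eq_bigr => i _; rewrite Ex_sum//; apply: eq_bigr => j _; exact: it_pair.
Qed.

Lemma it_sum_sqint (its : seq item) : sqint P (fun w => \sum_(i <- its) it_incr t u i w).
Proof. exact: sqint_sum. Qed.

End interval.

End simple_isometry.

(** * Integrals over Omega and a time interval *)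

Section sigma_finite_restriction.
Context {R : realType} {l : {measure set R -> \bar R}}.
Hypothesis hl : (\int[l]_(z in Rstar) (z ^+ 2)%:E < +oo)%E.

Let away (n : nat) : set R := Rstar `&` [set z | n.+1%:R^-1 <= z ^+ 2].

Let maway n : measurable (away n).
Proof.
apply: measurableI; first exact: measurable_Rstar.
rewrite (_ : [set z | _] = (fun z : R => z ^+ 2) @^-1` `[n.+1%:R^-1, +oo[%classic); last first.
  by apply/seteqP; split => z /=; rewrite in_itv/= andbT.
by rewrite -[X in measurable X]setTI; apply: exprn_measurable.
Qed.

(** Markov's inequality for [z ^+ 2]. *)
Let away_fin n : (l (away n) < +oo)%E.
Proof.
have n0 : 0 < n.+1%:R^-1 :> R by rewrite invr_gt0.
have h : ((n.+1%:R^-1)%:E * l (away n) <= \int[l]_(z in Rstar) (z ^+ 2)%:E)%E.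
  rewrite -integral_cst//.
  apply: (@le_trans _ _ (\int[l]_(z in away n) (z ^+ 2)%:E)%E).
    apply: ge0_le_integral => //.
    - by move=> z _; rewrite lee_fin ltW.
    - by apply/measurable_EFinP; exact: exprn_measurable.
    - by move=> z [_ /=]; rewrite lee_fin.
  apply: ge0_subset_integral => //.
  - exact: measurable_Rstar.
  - by apply/measurable_EFinP; exact: exprn_measurable.
  - by move=> z _; rewrite lee_fin sqr_ge0.
  - by move=> z [].
rewrite ltey; apply/eqP => E; move: (le_lt_trans h hl).
by rewrite E gt0_muley ?ltxx// lte_fin.
Qed.

Let away_cover z : z != 0 -> exists n, away n z.
Proof.
move=> z0; have z2 : 0 < z ^+ 2 by rewrite exprn_even_gt0.
exists (Num.truncn (z ^+ 2)^-1); split => //=.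
by rewrite -[leRHS]invrK lef_pV2 ?posrE ?invr_gt0 ?ltr0n//; exact/ltW/truncnS_gt.
Qed.

(** Tonelli's theorem requires sigma-finiteness, whereas [l] may have any mass at 0. Its restriction
    to [Rstar] is sigma-finite: the sets [away n] have finite mass, and adding the complement of
    [Rstar], which is null for the restriction, makes them cover the line. *)
Lemma restrict_sigma_finite : exists l' : {sigma_finite_measure set R -> \bar R},
  forall f : R -> \bar R, measurable_fun Rstar f -> (forall z, Rstar z -> 0 <= f z)%E ->
    (\int[l]_(z in Rstar) f z = \int[l']_z (f \_ Rstar) z)%E.
Proof.
have mR := @measurable_Rstar R.
have sf : sigma_finite setT (mrestr l mR).
  exists (fun n => ~` Rstar `|` away n).
    apply/esym/seteqP; split => // z _; have [->|z0] := eqVneq z 0.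
      by exists 0%N => //; left => /=; rewrite /Rstar/= eqxx.
    by have [n zn] := away_cover z z0; exists n => //; right.
  move=> n; split; first by apply: measurableU => //; exact: measurableC.
  rewrite /= /mrestr; apply: le_lt_trans (away_fin n).
  apply: le_measure; rewrite ?inE//.
    by apply: measurableI => //; apply: measurableU => //; exact: measurableC.
  by move=> z [[]].
pose l' : {sigma_finite_measure set R -> \bar R} :=
  HB.pack (mrestr l mR) (Measure_isSigmaFinite.Build _ _ _ (mrestr l mR) sf).
exists l' => f mf f0.
have mf' : measurable_fun setT (f \_ Rstar) by apply/(measurable_restrictT _ mR).
have f'0 z : (0 <= (f \_ Rstar) z)%E.
  by rewrite patchE; case: ifPn => // /set_mem /f0.
rewrite (@ge0_integral_density _ _ _ l' l \1_Rstar)//.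
- rewrite [LHS]integral_mkcond; apply: eq_integral => z _.
  by rewrite patchE indicE; case: ifPn => zR; rewrite ?mule1// mul0e.
- by move=> A mA; rewrite integral_indic// setIC.
Qed.

End sigma_finite_restriction.

(** * Tonelli's theorem over Omega and time *)

Section spacetime.
Context {R : realType} {d : measure_display} {Omega : measurableType d}.
Context {P : probability Omega R} {T : R}.
Notation leb := (@lebesgue_measure R).
Implicit Types F : R -> Omega -> \bar R.

Definition stmeas F := measurable_fun (setT `*` `[0, T]) (fun p : Omega * R => F p.2 p.1).

Definition stint (t u : R) F := (\int[P]_w \int[leb]_(s in `[t, u]) F s w)%E.

Let mslab (t u : R) : measurable (setT `*` `[t, u] : set (Omega * R)).
Proof. exact: measurableX. Qed.

Let slabS (t u : R) : 0 <= t -> u <= T ->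
  (setT `*` `[t, u] : set (Omega * R)) `<=` setT `*` `[0, T].
Proof.
move=> t0 uT [w s] /= [_]; rewrite !in_itv/= => /andP[ts su]; split => //.
by rewrite (le_trans t0 ts) (le_trans su uT).
Qed.

Let itvS (t u : R) : 0 <= t -> u <= T -> `[t, u] `<=` `[0, T].
Proof.
move=> t0 uT s /=; rewrite !in_itv/= => /andP[ts su].
by rewrite (le_trans t0 ts) (le_trans su uT).
Qed.

Lemma stmeas_section F w t u : 0 <= t -> u <= T -> stmeas F ->
  measurable_fun `[t, u] (F ^~ w).
Proof.
move=> t0 uT mF; apply: (measurable_funS _ (itvS _ _ t0 uT)) => //.
have : measurable_fun `[0, T] ((fun p : Omega * R => F p.2 p.1) \o pair w).
  apply: (measurable_comp (F := setT `*` `[0, T])) => //.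
  - by move=> _ [s sT <-].
  - exact: measurable_funTS (pair1_measurable w).
by [].
Qed.

Lemma stmeas_time F t : 0 <= t <= T -> stmeas F -> measurable_fun setT (F t).
Proof.
move=> tT mF.
have : measurable_fun setT ((fun p : Omega * R => F p.2 p.1) \o (pair^~ t)).
  apply: (measurable_comp (F := setT `*` `[0, T])) => //.
  by move=> _ [w _ <-]; split => //=; rewrite in_itv.
by [].
Qed.

Section tonelli.
Context {t u : R} (t0 : 0 <= t) (uT : u <= T) {F : R -> Omega -> \bar R}.
Hypotheses (mF : stmeas F) (F0 : forall s w, (0 <= F s w)%E).

Let g := (fun p : Omega * R => F p.2 p.1) \_ (setT `*` `[t, u]).

Let mg : measurable_fun setT g.
Proof.
apply/(measurable_restrictT _ (mslab t u)).
exact: measurable_funS (slabS _ _ t0 uT) mF.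
Qed.

Let g0 p : (0 <= g p)%E. Proof. by rewrite /g patchE; case: ifP. Qed.

Let gE w : (\int[leb]_s g (w, s) = \int[leb]_(s in `[t, u]) F s w)%E.
Proof.
rewrite [RHS]integral_mkcond; apply: eq_integral => s _.
rewrite /g !patchE/=; congr (if _ then _ else _).
by apply/idP/idP => /set_mem/= h; apply/mem_set => //=; case: h.
Qed.

Lemma stmeas_inner : measurable_fun setT (fun w => \int[leb]_(s in `[t, u]) F s w)%E.
Proof.
have := measurable_fun_fubini_tonelli_F (m2 := leb) g mg g0.
by rewrite /fubini_F; under eq_fun do rewrite gE.
Qed.

Lemma stint_tonelli : stint t u F = (\int[leb]_(s in `[t, u]) \int[P]_w F s w)%E.
Proof.
rewrite /stint; under eq_integral do rewrite -gE.
have := fubini_tonelli (m1 := P) (m2 := leb) g mg g0.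
rewrite /fubini_F => ->; rewrite [RHS]integral_mkcond; apply: eq_integral => s _.
rewrite patchE; case: ifPn => su.
  by apply: eq_integral => w _; rewrite /g patchE mem_set//=; split => //; exact: set_mem.
rewrite integral0_eq// => w _; rewrite /g patchE memNset//= => -[_ h].
by move/negP : su; apply; exact: mem_set.
Qed.

Lemma stmeas_outer : measurable_fun `[t, u] (fun s => \int[P]_w F s w)%E.
Proof.
have := measurable_fun_fubini_tonelli_G (m1 := P) g mg g0.
move=> /(measurable_funS measurableT (@subsetT _ `[t, u])).
apply: eq_measurable_fun => s su; apply: eq_integral => w _.
by rewrite /g patchE mem_set//=; split => //; exact: set_mem.
Qed.

Lemma stint_ge0 : (0 <= stint t u F)%E.
Proof. by apply: integral_ge0 => w _; exact: integral_ge0. Qed.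

End tonelli.

Section rules.
Context {t u : R} (t0 : 0 <= t) (uT : u <= T).

Lemma stintD F G : stmeas F -> stmeas G -> (forall s w, 0 <= F s w)%E ->
  (forall s w, 0 <= G s w)%E ->
  stint t u (fun s w => F s w + G s w)%E = (stint t u F + stint t u G)%E.
Proof.
move=> mF mG F0 G0; rewrite /stint -ge0_integralD//.
- apply: eq_integral => w _; rewrite ge0_integralD//; exact: stmeas_section.
- by move=> w _; exact: integral_ge0.
- exact: stmeas_inner.
- by move=> w _; exact: integral_ge0.
- exact: stmeas_inner.
Qed.

Lemma stintZ (c : R) F : 0 <= c -> stmeas F -> (forall s w, 0 <= F s w)%E ->
  stint t u (fun s w => c%:E * F s w)%E = (c%:E * stint t u F)%E.
Proof.
move=> c0 mF F0; rewrite /stint -ge0_integralZl_EFin//.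
- by apply: eq_integral => w _; rewrite ge0_integralZl_EFin//; exact: stmeas_section.
- by move=> w _; exact: integral_ge0.
- exact: stmeas_inner.
Qed.

Lemma stmeasD F G : stmeas F -> stmeas G -> stmeas (fun s w => F s w + G s w)%E.
Proof. by move=> mF mG; exact: emeasurable_funD. Qed.

Lemma stmeasZ (c : R) F : stmeas F -> stmeas (fun s w => c%:E * F s w)%E.
Proof. by move=> mF; apply: emeasurable_funM => //; exact: measurable_cst. Qed.

Lemma stint_ae_le F G : stmeas F -> stmeas G -> (forall s w, 0 <= F s w)%E ->
  (forall s w, 0 <= G s w)%E ->
  {ae P, forall w, forall s, 0 <= s <= T -> (F s w <= G s w)%E} ->
  (stint t u F <= stint t u G)%E.
Proof.
move=> mF mG F0 G0 FG; apply: ae_ge0_le_integral => //.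
- by move=> w _; exact: integral_ge0.
- exact: stmeas_inner.
- by move=> w _; exact: integral_ge0.
- exact: stmeas_inner.
apply: filterS FG => w FG _; apply: ge0_le_integral => //.
- exact: stmeas_section.
- exact: stmeas_section.
- move=> s /= stu; apply: FG; have := itvS _ _ t0 uT _ stu.
  by rewrite /= in_itv.
Qed.

(** The interval is cut into [[t, u[] and [[u, v]], and the first piece is enlarged to [[t, u]];
    subadditivity is all that the Gronwall argument asks for. *)
Lemma stint_setU {v : R} F : t <= u -> u <= v -> v <= T -> stmeas F ->
  (forall s w, 0 <= F s w)%E -> (stint t v F <= stint t u F + stint u v F)%E.
Proof.
move=> tu uv vT mF F0; have u0 := le_trans t0 tu.
rewrite /stint -ge0_integralD//; last 4 first.
- by move=> w _; exact: integral_ge0.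
- exact: stmeas_inner.
- by move=> w _; exact: integral_ge0.
- exact: stmeas_inner.
apply: ge0_le_integral => //.
- by move=> w _; exact: integral_ge0.
- exact: stmeas_inner.
- by apply: emeasurable_funD; exact: stmeas_inner.
move=> w _; have mFv := stmeas_section F w _ _ t0 vT mF.
have -> : `[t, v]%classic = `[t, u[ `|` `[u, v].
  apply/seteqP; split => s /=; rewrite !in_itv/=.
    by move=> /andP[ts sv]; case: (ltP s u) => us; [left|right]; rewrite ?ts ?sv ?us.
  by move=> [/andP[-> /ltW su]|/andP[us ->]]; rewrite ?(le_trans su uv)//= (le_trans tu us).
rewrite ge0_integral_setU//=; last first.
- apply/disj_setPS => s [/=]; rewrite !in_itv/= => /andP[_ su] /andP[us _].
  by move: (lt_le_trans su us); rewrite ltxx.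
- apply: measurable_funS mFv => // s /=; rewrite !in_itv/=.
  by move=> [/andP[-> /ltW su]|/andP[us ->]]; rewrite ?(le_trans su uv)//= (le_trans tu us).
apply: leeD => //; apply: ge0_subset_integral => //.
- exact: stmeas_section.
- by move=> s /=; rewrite !in_itv/= => /andP[-> /ltW].
Qed.

End rules.

End spacetime.

Arguments stmeas {R d Omega} T F.
Arguments stint {R d Omega} P t u F.

Lemma integral_sum_EFin {R : realType} {d} {V : measurableType d} (mu : {measure set V -> \bar R})
    (D : set V) (mD : measurable D) I (s : seq I) (f : I -> V -> R) :
  (forall i, mu.-integrable D (EFin \o f i)) ->
  (\int[mu]_(x in D) (\sum_(i <- s) f i x)%:E = (\sum_(i <- s) \int[mu]_(x in D) f i x)%:E)%E.
Proof.
move=> fi; under eq_integral do rewrite -sumEFin.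
rewrite integral_sum// -sumEFin; apply: eq_bigr => i _.
by rewrite fineK// (integrable_fin_num mD (fi i)).
Qed.

Lemma integrable_sum_EFin {R : realType} {d} {V : measurableType d}
    (mu : {measure set V -> \bar R}) (D : set V) (mD : measurable D) I (s : seq I) (f : I -> V -> R) :
  (forall i, mu.-integrable D (EFin \o f i)) ->
  mu.-integrable D (EFin \o (fun x => \sum_(i <- s) f i x)).
Proof.
move=> fi; elim: s => [|i s IH].
  by under eq_fun do rewrite /= big_nil; exact: integrable0.
rewrite (_ : EFin \o _ = ((EFin \o f i) \+ (EFin \o (fun x => \sum_(i <- s) f i x)%R))%E).
  exact: integrableD.
by apply/funext => x /=; rewrite big_cons EFinD.
Qed.

Section squared_norms.
Context {R : realType} {d : measure_display} {Omega : measurableType d}.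
Context {P : probability Omega R} {T : R} {l : {measure set R -> \bar R}}.
Hypothesis hl : (\int[l]_(z in Rstar) (z ^+ 2)%:E < +oo)%E.
Notation leb := (@lebesgue_measure R).
Implicit Types (y : R -> Omega -> R) (z : R -> Omega -> R -> R).

Definition jmeas y := measurable_fun (setT `*` `[0, T]) (fun p : Omega * R => y p.2 p.1).

Definition jmeasZ z := measurable_fun ((setT `*` `[0, T]) `*` Rstar)
  (fun p : (Omega * R) * R => z p.1.2 p.1.1 p.2).

Definition sq y : R -> Omega -> \bar R := fun s w => (y s w ^+ 2)%:E.

Definition nz z : R -> Omega -> \bar R :=
  fun s w => (\int[l]_(x in Rstar) (z s w x ^+ 2)%:E)%E.

Lemma sq_ge0 y s w : (0 <= sq y s w)%E. Proof. by rewrite lee_fin sqr_ge0. Qed.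

Lemma nz_ge0 z s w : (0 <= nz z s w)%E.
Proof. by apply: integral_ge0 => x _; rewrite lee_fin sqr_ge0. Qed.

Lemma stmeas_sq {y} : jmeas y -> stmeas T (sq y).
Proof. by move=> my; apply/measurable_EFinP; exact: measurable_funX. Qed.

Lemma jmeasZ_section {z} s w : 0 <= s <= T -> jmeasZ z -> measurable_fun Rstar (z s w).
Proof.
move=> sT mz.
have : measurable_fun Rstar ((fun p : (Omega * R) * R => z p.1.2 p.1.1 p.2) \o pair (w, s)).
  apply: (measurable_comp (F := (setT `*` `[0, T]) `*` Rstar)) => //.
  - apply: measurableX; last exact: measurable_Rstar.
    exact: measurableX.
  - by move=> _ [x xR <-]; split => //=; rewrite in_itv.
  - exact: measurable_funTS (pair1_measurable (w, s)).
by [].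
Qed.

(** Measurability of a partial integral, by Tonelli with the sigma-finite [l'] in place of [l]. *)
Lemma stmeas_nz {z} : jmeasZ z -> stmeas T (nz z).
Proof.
move=> mz; have [l' l'E] := restrict_sigma_finite hl.
have mD : measurable (setT `*` `[0, T] : set (Omega * R)) by exact: measurableX.
have mDR : measurable ((setT `*` `[0, T] : set (Omega * R)) `*` @Rstar R).
  by apply: measurableX => //; exact: measurable_Rstar.
pose g := (fun p : (Omega * R) * R => (z p.1.2 p.1.1 p.2 ^+ 2)%:E) \_
  ((setT `*` `[0, T]) `*` Rstar).
have mg : measurable_fun setT g.
  apply/(measurable_restrictT _ mDR)/measurable_EFinP; exact: measurable_funX.
have g0 p : (0 <= g p)%E.
  by rewrite /g patchE; case: ifP => // _; rewrite lee_fin sqr_ge0.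
have := measurable_fun_fubini_tonelli_F (m2 := l') g mg g0.
move=> /(measurable_funS measurableT (@subsetT _ (setT `*` `[0, T] : set (Omega * R)))).
apply: eq_measurable_fun => -[w s] /set_mem[_ /= sT].
rewrite /nz l'E.
- apply: eq_integral => x _; rewrite /g !patchE/=.
  by congr (if _ then _ else _); apply/idP/idP => /set_mem/= h; apply/mem_set => //=; case: h.
- apply/measurable_EFinP/measurable_funX; apply: jmeasZ_section => //.
- by move=> x _; rewrite lee_fin sqr_ge0.
Qed.

Let sum_sq_le (a b : R) : (a + b) ^+ 2 <= 2 * a ^+ 2 + 2 * b ^+ 2.
Proof.
rewrite -subr_ge0 (_ : _ - _ = (a - b) ^+ 2); [exact: sqr_ge0|by ring].
Qed.

Let two : (0 <= 2%:E :> \bar R)%E. Proof. by rewrite lee_fin. Qed.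

Lemma stint_sq_split {t u : R} {y1 y2} : 0 <= t -> u <= T -> jmeas y1 -> jmeas y2 ->
  (stint P t u (sq (fun s w => y1 s w + y2 s w)%R) <=
   2%:E * stint P t u (sq y1) + 2%:E * stint P t u (sq y2))%E.
Proof.
move=> t0 uT m1 m2.
have s1 := stmeas_sq m1; have s2 := stmeas_sq m2.
have k0 : 0 <= 2 :> R by [].
have Z1 := stintZ (P := P) t0 uT 2 _ k0 s1 (sq_ge0 y1).
have Z2 := stintZ (P := P) t0 uT 2 _ k0 s2 (sq_ge0 y2).
have p1 s w : (0 <= 2%:E * sq y1 s w)%E by apply: mule_ge0 => //; exact: sq_ge0.
have p2 s w : (0 <= 2%:E * sq y2 s w)%E by apply: mule_ge0 => //; exact: sq_ge0.
have mZ1 := stmeasZ 2 _ s1; have mZ2 := stmeasZ 2 _ s2.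
have := stintD (P := P) t0 uT _ _ mZ1 mZ2 p1 p2; rewrite Z1 Z2 => <-.
apply: (stint_ae_le t0 uT).
- by apply: stmeas_sq; exact: measurable_funD.
- exact: stmeasD.
- by move=> s w; exact: sq_ge0.
- by move=> s w; exact: adde_ge0.
- by apply: aeW => w s _; rewrite /sq -!EFinM -EFinD lee_fin sum_sq_le.
Qed.

Lemma nz_split {s : R} {w z1 z2} : 0 <= s <= T -> jmeasZ z1 -> jmeasZ z2 ->
  (nz (fun s w x => z1 s w x + z2 s w x)%R s w <= 2%:E * nz z1 s w + 2%:E * nz z2 s w)%E.
Proof.
move=> sT m1 m2; have mR := @measurable_Rstar R.
have h1 := jmeasZ_section s w sT m1; have h2 := jmeasZ_section s w sT m2.
have q1 : measurable_fun Rstar (fun x => (z1 s w x ^+ 2)%:E).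
  exact/measurable_EFinP/measurable_funX.
have q2 : measurable_fun Rstar (fun x => (z2 s w x ^+ 2)%:E).
  exact/measurable_EFinP/measurable_funX.
rewrite /nz -ge0_integralZl_EFin//; [|by move=> *; rewrite lee_fin sqr_ge0].
rewrite -ge0_integralZl_EFin//; [|by move=> *; rewrite lee_fin sqr_ge0].
rewrite -ge0_integralD//.
- apply: ge0_le_integral => //.
  + by move=> *; rewrite lee_fin sqr_ge0.
  + by apply/measurable_EFinP/measurable_funX; exact: measurable_funD.
  + by apply: emeasurable_funD; apply: emeasurable_funM => //; exact: measurable_cst.
  + by move=> x _; rewrite -!EFinM -EFinD lee_fin sum_sq_le.
- by move=> *; rewrite -EFinM lee_fin mulr_ge0 ?sqr_ge0.
- by apply: emeasurable_funM => //; exact: measurable_cst.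
- by move=> *; rewrite -EFinM lee_fin mulr_ge0 ?sqr_ge0.
- by apply: emeasurable_funM => //; exact: measurable_cst.
Qed.

Lemma jmeasZD {z1 z2} : jmeasZ z1 -> jmeasZ z2 -> jmeasZ (fun s w x => z1 s w x + z2 s w x).
Proof. by move=> ? ?; exact: measurable_funD. Qed.

Lemma stint_nz_split {t u : R} {z1 z2} : 0 <= t -> u <= T -> jmeasZ z1 -> jmeasZ z2 ->
  (stint P t u (nz (fun s w x => z1 s w x + z2 s w x)%R) <=
   2%:E * stint P t u (nz z1) + 2%:E * stint P t u (nz z2))%E.
Proof.
move=> t0 uT m1 m2.
have s1 := stmeas_nz m1; have s2 := stmeas_nz m2.
have k0 : 0 <= 2 :> R by [].
have Z1 := stintZ (P := P) t0 uT 2 _ k0 s1 (nz_ge0 z1).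
have Z2 := stintZ (P := P) t0 uT 2 _ k0 s2 (nz_ge0 z2).
have p1 s w : (0 <= 2%:E * nz z1 s w)%E by apply: mule_ge0 => //; exact: nz_ge0.
have p2 s w : (0 <= 2%:E * nz z2 s w)%E by apply: mule_ge0 => //; exact: nz_ge0.
have mZ1 := stmeasZ 2 _ s1; have mZ2 := stmeasZ 2 _ s2.
have := stintD (P := P) t0 uT _ _ mZ1 mZ2 p1 p2; rewrite Z1 Z2 => <-.
apply: (stint_ae_le t0 uT).
- by apply: stmeas_nz; exact: jmeasZD.
- exact: stmeasD.
- by move=> s w; exact: nz_ge0.
- by move=> s w; exact: adde_ge0.
- by apply: aeW => w s sT; exact: nz_split.
Qed.

(* The norm of the integrands of dW, Ntilde and dB over [t, u]. *)
Definition qnorm t u y z (zeta : R -> Omega -> R) : \bar R :=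
  (stint P t u (sq y) + stint P t u (nz z) + stint P t u (sq zeta))%E.

Lemma qnorm_ge0 t u y z zeta : (0 <= qnorm t u y z zeta)%E.
Proof.
apply: adde_ge0; last exact: (stint_ge0 (sq_ge0 zeta)).
by apply: adde_ge0; [exact: (stint_ge0 (sq_ge0 y))|exact: (stint_ge0 (nz_ge0 z))].
Qed.

Lemma qnorm_split {t u : R} {y1 y2 z1 z2 c1 c2} : 0 <= t -> u <= T ->
  jmeas y1 -> jmeas y2 -> jmeasZ z1 -> jmeasZ z2 -> jmeas c1 -> jmeas c2 ->
  (qnorm t u (fun s w => y1 s w + y2 s w)%R (fun s w x => z1 s w x + z2 s w x)%R
    (fun s w => c1 s w + c2 s w)%R <=
   2%:E * qnorm t u y1 z1 c1 + 2%:E * qnorm t u y2 z2 c2)%E.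
Proof.
move=> t0 uT my1 my2 mz1 mz2 mc1 mc2.
have A := stint_sq_split t0 uT my1 my2.
have B := stint_nz_split t0 uT mz1 mz2.
have C := stint_sq_split t0 uT mc1 mc2.
apply: le_trans (leeD (leeD A B) C) _.
have comb (p1 p2 p3 q1 q2 q3 : \bar R) : (0 <= p1 -> 0 <= p2 -> 0 <= p3 ->
    0 <= q1 -> 0 <= q2 -> 0 <= q3 ->
    (2%:E * p1 + 2%:E * q1) + (2%:E * p2 + 2%:E * q2) + (2%:E * p3 + 2%:E * q3) =
    2%:E * (p1 + p2 + p3) + 2%:E * (q1 + q2 + q3))%E.
  move=> p10 p20 p30 q10 q20 q30.
  have p12 := adde_ge0 p10 p20; have q12 := adde_ge0 q10 q20.
  rewrite (ge0_muleDr _ p12 p30) (ge0_muleDr _ p10 p20) (ge0_muleDr _ q12 q30) (ge0_muleDr _ q10 q20).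
  by rewrite (addeACA (2%:E * p1)%E) (addeACA (2%:E * p1 + 2%:E * p2)%E).
by rewrite (comb _ _ _ _ _ _ (stint_ge0 (sq_ge0 y1)) (stint_ge0 (nz_ge0 z1))
  (stint_ge0 (sq_ge0 c1)) (stint_ge0 (sq_ge0 y2)) (stint_ge0 (nz_ge0 z2)) (stint_ge0 (sq_ge0 c2))).
Qed.

End squared_norms.

Arguments jmeas {R d Omega} T y.
Arguments jmeasZ {R d Omega} T z.
Arguments nz {R d Omega} l z s w.
Arguments qnorm {R d Omega} P l t u y z zeta.

(** * Norms of simple integrands *)

Section simple_values.
Context {R : realType} {d : measure_display} {Omega : measurableType d}.
Context {P : probability Omega R} {T : R} {l : {measure set R -> \bar R}}.
Context {H : R -> set (set Omega)}.
Hypothesis Hmeas : forall t : R, t <= T -> H t `<=` measurable.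
Notation leb := (@lebesgue_measure R).
Local Notation Ex X := (Rintegral P setT X).
Local Notation item := (@item R d Omega T H (noise R) (noise_ok l)).
Implicit Types its : seq item.

(** The weights and [marks] are the coordinates of a noise along [dW], [dB] and the jump measure. By
    [noise_covE], [noise_cov] is the inner product of these coordinates in [R x L^2(l) x R], which
    is the reason why the isometry holds. *)
Definition weightW (k : noise R) : R := if k is NoiseW then 1 else 0.
Definition weightB (k : noise R) : R := if k is NoiseB then 1 else 0.
Definition marks (k : noise R) : set R := if k is NoiseN M then M else set0.

Lemma noise_covE k j : noise_cov l k j =
  weightW k * weightW j + fine (l (marks k `&` marks j)) + weightB k * weightB j.
Proof.
by case: k => [||M]; case: j => [||M'] /=;
  rewrite ?set0I ?setI0 ?measure0 ?mulr0 ?mul0r ?mulr1 ?addr0 ?add0r.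
Qed.

Definition it_val (i : item) (s : R) (w : Omega) : R := it_coef i w * \1_(`]it_left i, it_right i]) s.

Definition valW its s w := \sum_(i <- its) weightW (it_kind i) * it_val i s w.
Definition valB its s w := \sum_(i <- its) weightB (it_kind i) * it_val i s w.
Definition valN its s w x := \sum_(i <- its) it_val i s w * \1_(marks (it_kind i)) x.

Lemma it_coef_bounded (i : item) : bounded_rv (it_coef i).
Proof.
have [_ ab bT cH [M cM]] := it_coef_ok i; split; last by exists M.
move=> _ A mA; apply: (Hmeas _ (le_trans ab bT)); apply: cH; by exists A.
Qed.

Lemma marks_ok (i : item) : [/\ measurable (marks (it_kind i)), marks (it_kind i) `<=` Rstar &
  (l (marks (it_kind i)) < +oo)%E].
Proof.
by case: i => ? ? ? [||M] ? //= _; split; rewrite ?measure0//; exact: measurable0.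
Qed.

Lemma jmeas_it_val i : jmeas T (it_val i).
Proof.
have [mc _] := it_coef_bounded i.
apply: (measurable_funS measurableT) => //; apply: measurable_funM.
  exact: (measurableT_comp mc).
by apply: (measurableT_comp (f := \1_(`]it_left i, it_right i]) : R -> R)).
Qed.

Lemma jmeas_sum (I : Type) (s : seq I) (y : I -> R -> Omega -> R) :
  (forall i, jmeas T (y i)) -> jmeas T (fun r w => \sum_(i <- s) y i r w).
Proof. by move=> my; apply: measurable_sum. Qed.

Lemma jmeas_valW its : jmeas T (valW its).
Proof. by apply: jmeas_sum => i; apply: measurable_funM => //; exact: jmeas_it_val. Qed.

Lemma jmeas_valB its : jmeas T (valB its).
Proof. by apply: jmeas_sum => i; apply: measurable_funM => //; exact: jmeas_it_val. Qed.

Lemma jmeas_valN its : jmeasZ T (valN its).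
Proof.
apply: measurable_sum => i; have [mM _ _] := marks_ok i.
have mR := @measurable_Rstar R.
have mD : measurable (setT `*` `[0, T] : set (Omega * R)) by exact: measurableX.
apply: measurable_funM.
  apply: (measurable_comp (F := setT `*` `[0, T]) (f := fun p : Omega * R => it_val i p.2 p.1)) => //.
  - by move=> _ [[p x] /= [pT _] <-].
  - exact: jmeas_it_val.
  - exact: (measurable_funTS measurable_fst).
have mI : measurable_fun setT (\1_(marks (it_kind i)) : R -> R) by [].
exact: (measurable_funTS (measurableT_comp mI measurable_snd)).
Qed.

Let max_sub (a b : R) : fine (leb `]a, b]%classic) = Num.max 0 (b - a).
Proof.
rewrite lebesgue_measure_itv/= lte_fin; case: ltP => ab /=.
  by apply/esym/max_idPr; rewrite subr_ge0 ltW.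
by apply/esym/max_idPl; rewrite subr_le0.
Qed.

Lemma overlap_integral t u (i j : item) : t <= u ->
  (\int[leb]_(s in `[t, u]) (\1_(`]it_left i, it_right i]) s * \1_(`]it_left j, it_right j]) s)%:E =
   (overlap t u i j)%:E)%E.
Proof.
(* Without the point [t] all three intervals are open on the left and closed on the right, and so is
   their intersection. *)
move=> tu; rewrite -integral_itv_obnd_cbnd; last first.
  by apply/measurable_EFinP; apply: measurable_funM.
pose A := `]it_left i, it_right i]%classic `&` `]it_left j, it_right j]%classic.
transitivity (\int[leb]_(s in `]t, u]) (\1_A s)%:E)%E.
  by apply: eq_integral => s _; rewrite /A indicI.
have mA : measurable A by exact: measurableI.
rewrite integral_indic// /overlap -max_sub.
have -> : A `&` `]t, u]%classic =
    `]Num.max (clamp t u (it_left i)) (clamp t u (it_left j)),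
      Num.min (clamp t u (it_right i)) (clamp t u (it_right j))]%classic.
  apply/seteqP; rewrite /A /clamp; split => s /=;
    rewrite !in_itv/= gt_max le_min !gt_min !le_min !gt_max !le_max.
    by move=> [[/andP[-> ->] /andP[-> ->]] /andP[-> ->]].
  move=> /andP[/andP[h1 h2] /andP[/andP[h3 su] /andP[h4 _]]].
  have us : (u < s) = false by rewrite ltNge su.
  move: h1 h2 h3 h4; rewrite us !orbF => /andP[-> ts] /andP[-> _].
  by rewrite [s <= t]leNgt ts/= !orbF => -> ->.
by rewrite fineK// lebesgue_measure_itv/=; case: ifP.
Qed.

Lemma stint_pairs {t u : R} (a : item -> item -> R) its : t <= u ->
  stint P t u (fun s w =>
    (\sum_(i <- its) \sum_(j <- its) a i j * (it_val i s w * it_val j s w))%:E) =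
  (\sum_(i <- its) \sum_(j <- its)
    overlap t u i j * a i j * Ex (fun w => it_coef i w * it_coef j w))%:E.
Proof.
move=> tu; rewrite /stint.
have ind (c : R) (i j : item) : leb.-integrable `[t, u]
    (EFin \o (fun s => c * (\1_(`]it_left i, it_right i]) s * \1_(`]it_left j, it_right j]) s))).
  apply: measurable_bounded_integrable => //.
  - have : (leb (`[t, u]%classic : set R) < +oo)%E 
      by rewrite lebesgue_measure_itv/=; case: ifP => _; rewrite ?ltry// -EFinB ltry.
    by [].
  - by apply: measurable_funM => //; apply: measurable_funM.
  - exists `|c|; split; first exact: num_real.
    move=> M cM s _ /=; apply: le_trans (ltW cM).
    rewrite normrM ler_piMr// !indicE.
    by case: (_ \in _); case: (_ \in _); rewrite /= ?(mulr0, mul0r, mulr1, normr0, normr1).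
have E (i j : item) s w : a i j * (it_val i s w * it_val j s w) = (a i j * (it_coef i w * it_coef j w)) *
    (\1_(`]it_left i, it_right i]) s * \1_(`]it_left j, it_right j]) s).
  by rewrite /it_val; ring.
transitivity (\int[P]_w (\sum_(i <- its) \sum_(j <- its)
    (overlap t u i j * a i j) * (it_coef i w * it_coef j w))%:E)%E.
  apply: eq_integral => w _.
  under eq_integral do (under eq_bigr do under eq_bigr do rewrite E).
  rewrite integral_sum_EFin//; last by move=> i; exact: integrable_sum_EFin.
  congr EFin; apply: eq_bigr => i _; rewrite /Rintegral integral_sum_EFin//=.
  apply: eq_bigr => j _; rewrite RintegralZl//; last first.
    by have := ind 1 i j; rewrite (_ : (fun s => 1 * _) = (fun s =>
      \1_(`]it_left i, it_right i]) s * \1_(`]it_left j, it_right j]) s))//;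
      apply/funext => s; rewrite mul1r.
  by rewrite /Rintegral overlap_integral//=; ring.
have bb (i j : item) : rint P (fun w => it_coef i w * it_coef j w).
  by apply: sqint_mul; apply: bounded_sqint; exact: it_coef_bounded.
rewrite integral_sum_EFin//; last by move=> i; apply: rint_sum => j; exact: rintZ.
congr EFin; apply: eq_bigr => i _; rewrite Ex_sum; last by move=> j; exact: rintZ.
by apply: eq_bigr => j _; rewrite ExZ.
Qed.

Lemma qnorm_val {t u : R} its : t <= u ->
  qnorm P l t u (valW its) (valN its) (valB its) =
  (\sum_(i <- its) \sum_(j <- its)
    overlap t u i j * noise_cov l (it_kind i) (it_kind j) *
    Ex (fun w => it_coef i w * it_coef j w))%:E.
Proof.
move=> tu; rewrite /qnorm.
have -> : stint P t u (sq (valW its)) = stint P t u (fun s w => (\sum_(i <- its)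
    \sum_(j <- its) (weightW (it_kind i) * weightW (it_kind j)) * (it_val i s w * it_val j s w))%:E).
  apply: eq_integral => w _; apply: eq_integral => s _; rewrite /sq expr2 /valW mulr_suml.
  by congr EFin; apply: eq_bigr => i _; rewrite mulr_sumr; apply: eq_bigr => j _; ring.
have -> : stint P t u (sq (valB its)) = stint P t u (fun s w => (\sum_(i <- its)
    \sum_(j <- its) (weightB (it_kind i) * weightB (it_kind j)) * (it_val i s w * it_val j s w))%:E).
  apply: eq_integral => w _; apply: eq_integral => s _; rewrite /sq expr2 /valB mulr_suml.
  by congr EFin; apply: eq_bigr => i _; rewrite mulr_sumr; apply: eq_bigr => j _; ring.
have -> : stint P t u (nz l (valN its)) = stint P t u (fun s w => (\sum_(i <- its)
    \sum_(j <- its) fine (l (marks (it_kind i) `&` marks (it_kind j))) *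
      (it_val i s w * it_val j s w))%:E).
  apply: eq_integral => w _; apply: eq_integral => s _; rewrite /nz.
  have mR := @measurable_Rstar R.
  have mI (i j : item) : measurable (marks (it_kind i) `&` marks (it_kind j)).
    by have [? _ _] := marks_ok i; have [? _ _] := marks_ok j; exact: measurableI.
  have fI (i j : item) : (l (marks (it_kind i) `&` marks (it_kind j)) < +oo)%E.
    have [? _ li] := marks_ok i; apply: le_lt_trans li.
    by apply: le_measure; rewrite ?inE//; apply: mI.
  have sI (i j : item) : marks (it_kind i) `&` marks (it_kind j) `<=` Rstar.
    by have [_ h _] := marks_ok i => x [/h].
  have E x : valN its s w x ^+ 2 = \sum_(i <- its) \sum_(j <- its) (it_val i s w * it_val j s w) *
      \1_(marks (it_kind i) `&` marks (it_kind j)) x.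
    rewrite expr2 /valN mulr_suml; apply: eq_bigr => i _; rewrite mulr_sumr.
    by apply: eq_bigr => j _; rewrite indicI/=; ring.
  have ind (i j : item) : l.-integrable Rstar
      (EFin \o (\1_(marks (it_kind i) `&` marks (it_kind j)) : R -> R)).
    apply/integrableP; split; first by apply/measurable_EFinP.
    under eq_integral do rewrite /= ger0_norm//.
    rewrite (integral_indic _ _ (mI i j))//.
    by rewrite setIidl//; exact: fI.
  have indZ c (i j : item) : l.-integrable Rstar
     (EFin \o (fun x => c * \1_(marks (it_kind i) `&` marks (it_kind j)) x)).
    have := integrableZl mR c (ind i j); by [].
  under eq_integral do rewrite E.
  rewrite integral_sum_EFin//; last by move=> i; exact: integrable_sum_EFin.
  congr EFin; apply: eq_bigr => i _; rewrite /Rintegral integral_sum_EFin//=.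
  apply: eq_bigr => j _; rewrite RintegralZl//.
  by rewrite mulrC /Rintegral (integral_indic _ _ (mI i j))// setIidl//; exact: sI.
rewrite !stint_pairs// -!EFinD; congr EFin.
rewrite -!big_split/=; apply: eq_bigr => i _; rewrite -!big_split/=; apply: eq_bigr => j _.
by rewrite noise_covE; ring.
Qed.

End simple_values.

(** * Approximation of stochastic integrals *)

Section predictability.
Context {R : realType} {d : measure_display} {Omega : measurableType d}.
Context {T : R} {H : R -> set (set Omega)}.

Lemma measurable_sigma_algebra {dV} {V : measurableType dV} (D : set V) : measurable D ->
  sigma_algebra D (@measurable _ V).
Proof.
move=> mD; split; [exact: measurable0|by move=> A mA; exact: measurableD|].
by move=> A mA; exact: bigcup_measurable.
Qed.

Lemma predictable_sets_measurable : 0 <= T -> (forall t : R, t <= T -> H t `<=` measurable) ->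
  predictable_sets T H `<=` measurable.
Proof.
move=> T0 Hm; apply: smallest_sub.
  by apply: measurable_sigma_algebra; exact: measurableX.
move=> C [[A HA <-]|[s [t [A [s0 st tT HA ->]]]]]; apply: measurableX => //.
  exact: (Hm 0).
exact: (Hm s (le_trans (ltW st) tT) _ HA).
Qed.

Lemma predictable_jmeas {y : R -> Omega -> R} : 0 <= T ->
  (forall t : R, t <= T -> H t `<=` measurable) -> predictable T H y -> jmeas T y.
Proof.
by move=> T0 Hm py _ A mA; apply: predictable_sets_measurable => //; apply: py; exists A.
Qed.

Lemma predictable_jmeasZ {z : R -> Omega -> R -> R} : 0 <= T ->
  (forall t : R, t <= T -> H t `<=` measurable) -> predictable_field T H z -> jmeasZ T z.
Proof.
move=> T0 Hm pz mD A mA.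
suff h : <<s (setT `*` `[0, T]) `*` Rstar, [set C `*` S | C in predictable_sets T H &
    S in [set S : set R | measurable S /\ S `<=` Rstar]] >> `<=`
    (@measurable _ ((Omega * R) * R)%type) by apply: h; apply: pz; exists A.
apply: smallest_sub; first exact: measurable_sigma_algebra.
move=> _ [C pC [S [mS _] <-]]; apply: measurableX => //.
exact: predictable_sets_measurable.
Qed.

End predictability.

Section differences.
Context {R : realType} {d : measure_display} {Omega : measurableType d} {T : R}.

Lemma jmeasB {y y' : R -> Omega -> R} : jmeas T y -> jmeas T y' ->
  jmeas T (fun s w => y s w - y' s w).
Proof. by move=> ? ?; exact: measurable_funB. Qed.

Lemma jmeasZB {z z' : R -> Omega -> R -> R} : jmeasZ T z -> jmeasZ T z' ->
  jmeasZ T (fun s w x => z s w x - z' s w x).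
Proof. by move=> ? ?; exact: measurable_funB. Qed.

Lemma qnorm_opp {P : probability Omega R} {l : {measure set R -> \bar R}} {t u : R}
    {y y' c c' : R -> Omega -> R} {z z' : R -> Omega -> R -> R} :
  (forall s w, y' s w = - y s w) -> (forall s w x, z' s w x = - z s w x) ->
  (forall s w, c' s w = - c s w) ->
  qnorm P l t u y' z' c' = qnorm P l t u y z c.
Proof.
move=> ey ez ec.
have h (a a' : R -> Omega -> R) : (forall s w, a' s w = - a s w) ->
    stint P t u (sq a') = stint P t u (sq a).
  move=> ea; apply: eq_integral => w _; apply: eq_integral => s _.
  by rewrite /sq ea sqrrN.
rewrite /qnorm (h _ _ ey) (h _ _ ec).
suff -> : stint P t u (nz l z') = stint P t u (nz l z) by [].
apply: eq_integral => w _; apply: eq_integral => s _.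
by apply: eq_integral => x _; rewrite ez sqrrN.
Qed.

End differences.

Lemma cvge0_eventually {R : realType} (f : nat -> \bar R) (r : R) : 0 < r ->
  f n @[n --> \oo] --> 0%E -> \forall n \near \oo, (f n <= r%:E)%E.
Proof.
move=> r0 f0; have /f0 : nbhs (0 : \bar R)%E [set x | (x < r%:E)%E].
  by apply: open_nbhs_nbhs; split; [exact: open_ereal_lt_ereal|rewrite /= lte_fin].
by move=> h; near=> n; apply: ltW; near: n.
Unshelve. all: by end_near. Qed.

Section mean_square.
Context {R : realType} {d : measure_display} {Omega : measurableType d}.
Context {P : probability Omega R}.
Implicit Types X Y : Omega -> R.

(** Kept in the extended reals, so that estimates can be written before finiteness is known. *)
Definition msq X := (\int[P]_w (X w ^+ 2)%:E)%E.

Lemma msq_ge0 X : (0 <= msq X)%E.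
Proof. by apply: integral_ge0 => w _; rewrite lee_fin sqr_ge0. Qed.

Lemma msqE X : msq X = ('E_P[fun w => (X w ^+ 2)%R])%E.
Proof. by rewrite unlock. Qed.

Lemma msqD {X Y} : measurable_fun setT X -> measurable_fun setT Y ->
  (msq (fun w => X w + Y w)%R <= 2%:E * (msq X + msq Y))%E.
Proof.
move=> mX mY.
have sX : measurable_fun setT (fun w => (X w ^+ 2)%:E).
  exact/measurable_EFinP/measurable_funX.
have sY : measurable_fun setT (fun w => (Y w ^+ 2)%:E).
  exact/measurable_EFinP/measurable_funX.
rewrite /msq -ge0_integralD//; try by move=> *; rewrite lee_fin sqr_ge0.
rewrite -ge0_integralZl_EFin//; last 2 first.
- by move=> w _; rewrite -EFinD lee_fin addr_ge0 ?sqr_ge0.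
- exact: emeasurable_funD.
apply: ge0_le_integral => //.
- by move=> *; rewrite lee_fin sqr_ge0.
- by apply/measurable_EFinP/measurable_funX; exact: measurable_funD.
- by apply: emeasurable_funM; [exact: measurable_cst|exact: emeasurable_funD].
move=> w _; rewrite -EFinD -EFinM lee_fin -subr_ge0.
have -> : 2 * (X w ^+ 2 + Y w ^+ 2) - (X w + Y w) ^+ 2 = (X w - Y w) ^+ 2 by ring.
exact: sqr_ge0.
Qed.

Lemma msqN X : msq (fun w => - X w) = msq X.
Proof. by apply: eq_integral => w _; rewrite sqrrN. Qed.

Lemma sqint_msq {X} : sqint P X -> msq X = (Rintegral P setT (fun w => X w ^+ 2))%:E.
Proof. by move=> [_ iX]; rewrite -expectationE// msqE. Qed.

Lemma msq_ae {X Y} : measurable_fun setT X -> measurable_fun setT Y ->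
  {ae P, forall w, X w = Y w} -> msq X = msq Y.
Proof.
move=> mX mY XY; apply: ae_eq_integral => //.
- exact/measurable_EFinP/measurable_funX.
- exact/measurable_EFinP/measurable_funX.
by apply: filterS XY => w -> _.
Qed.

End mean_square.

Arguments msq {R d Omega} P X.

Section approximation.
Context {R : realType} {d : measure_display} {Omega : measurableType d}.
Context {P : probability Omega R} {T : R} {l : {measure set R -> \bar R}}.
Context {W B : R -> Omega -> R} {N : Omega -> {measure set (R * R)%type -> \bar R}}.
Hypotheses (hP : measure_is_complete P) (hW : standard_brownian P T W)
  (hB : standard_brownian P T B) (hN : poisson_random_measure P T l N)
  (hWBN : indep3 P <<s brownian_events W T>> <<s brownian_events B T>>
                   <<s poisson_events T N>>)
  (hl : (\int[l]_(z in Rstar) (z ^+ 2)%:E < +oo)%E).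
Notation comp := (compensated T l N).
Local Notation G := (filtG P T l W B N).
Local Notation Ex X := (Rintegral P setT X).
Local Notation item := (@item R d Omega T G (noise R) (noise_ok l)).
Local Notation val := (noise_val (T := T) (l := l) (W := W) (B := B) (N := N)).
Local Notation incr := (it_incr (m := val)).

Let Gm : forall t : R, t <= T -> G t `<=` measurable.
Proof. exact: filtG_measurable. Qed.

Let Gs := filtG_sigma (P := P) (T := T) (l := l) (W := W) (B := B) (N := N).

Let cov_sym (k j : noise R) : noise_cov l k j = noise_cov l j k.
Proof. by case: k => [||M]; case: j => [||M'] //=; rewrite setIC. Qed.

Section interval.
Context {t u : R} (t0 : 0 <= t) (tu : t <= u) (uT : u <= T).
Local Notation qn := (qnorm P l t u).

Let sum_sqint (its : seq item) : sqint P (fun w => \sum_(i <- its) incr t u i w).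
Proof.
apply: (it_sum_sqint Gm) => //; move=> k s v ok *; exact: noise_incr_sqint.
Qed.

(** Both sides reduce to the same double sum, by [qnorm_val] and by [it_isometry]. *)
Lemma simple_isometry (its : seq item) X : sqint P X -> events_on setT X `<=` G t ->
  (msq P X + qn (valW its) (valN its) (valB its) =
   msq P (fun w => X w + \sum_(i <- its) incr t u i w)%R)%E.
Proof.
move=> sX XG; rewrite qnorm_val// (sqint_msq sX) (sqint_msq (sqintD sX (sum_sqint its))).
rewrite (it_isometry Gs filtG_sub Gm cov_sym)//.
- by move=> k s ok sT; exact: noise_events.
- by move=> k s v ok s0 sv vT; exact: noise_incr_sqint.
- by move=> k s v Y ok s0 sv vT sY YG; exact: noise_incr_mean.
- by move=> k j s v c ok oj s0 sv vT bc cG; exact: noise_incr_cov.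
Qed.

(* [D] is the increment over [t, u] of the stochastic integral of (y, z, c). *)
Definition approximable y z c D := forall r : R, 0 < r -> exists its : seq item,
  (qn (fun s w => y s w - valW its s w)%R (fun s w x => z s w x - valN its s w x)%R
      (fun s w => c s w - valB its s w)%R <= r%:E)%E /\
  (msq P (fun w => D w - \sum_(i <- its) incr t u i w)%R <= r%:E)%E.

(** Here [b] is the norm of the integrand and [q] that of its simple approximation. Since [a >= 0],
    [a + b] is at most [2 * (a + q) + r / 3], hence at most [4 * I + 2 * r / 3 + r / 3]; this fixes
    the tolerance [r / 6]. *)
Let combine (a q b I : \bar R) (r : R) : (0 <= a -> 0 <= q -> 0 <= b -> 0 <= I ->
  b <= 2%:E * q + 2%:E * (r / 6)%:E -> a + q <= 2%:E * (I + (r / 6)%:E) ->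
  a + b <= 4%:E * I + r%:E)%E.
Proof.
case: I => [I||] a0 q0 b0 I0; last by [].
  case: a a0 => [a||] // a0; last by rewrite addye ?gt_eqF ?(lt_le_trans _ q0)// leye_eq.
  case: q q0 => [q||] // _.
  case: b b0 => [b||] // _.
  by move: a0; rewrite -!EFinD -!EFinM -?EFinD !lee_fin => *; lra.
by move=> _ _; rewrite gt0_muley ?lte_fin// addye// leey.
Qed.

(** The simple integrand is exchanged for the general one twice, once in the norm and once in the
    second moment, each time at the cost of a factor 2. As [r] is arbitrary, no limit of integrals
    has to be taken. *)
Lemma stochastic_integral_ge {y z c D X} : jmeas T y -> jmeasZ T z ->
  jmeas T c -> measurable_fun setT D -> approximable y z c D ->
  sqint P X -> events_on setT X `<=` G t ->
  (msq P X + qn y z c <= 4%:E * msq P (fun w => X w + D w)%R)%E.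
Proof.
move=> my mz mc mD apx sX XG; apply/lee_addgt0Pr => r r0.
have r6 : 0 < r / 6 by rewrite divr_gt0.
have [its [q1 q2]] := apx _ r6.
have ey : y = fun s w => valW its s w + (y s w - valW its s w).
  by apply/funext => s; apply/funext => w; rewrite addrC subrK.
have ez : z = fun s w x => valN its s w x + (z s w x - valN its s w x).
  by apply/funext => s; apply/funext => w; apply/funext => x; rewrite addrC subrK.
have ec : c = fun s w => valB its s w + (c s w - valB its s w).
  by apply/funext => s; apply/funext => w; rewrite addrC subrK.
have A : (qn y z c <= 2%:E * qn (valW its) (valN its) (valB its) + 2%:E * (r / 6)%:E)%E.
  rewrite [in X in (X <= _)%E]ey [in X in (X <= _)%E]ez [in X in (X <= _)%E]ec.
  have mW := jmeas_valW Gm its; have mN := jmeas_valN Gm its; have mB := jmeas_valB Gm its.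
  have := qnorm_split (P := P) hl t0 uT mW (jmeasB my mW)
    mN (jmeasZB mz mN) mB (jmeasB mc mB).
  move/le_trans; apply.
  by rewrite leeD2l// lee_pmul2l// lte_fin.
have mS : measurable_fun setT (fun w => \sum_(i <- its) incr t u i w) by case: (sum_sqint its).
have mX : measurable_fun setT X by case: sX.
have Bd : (msq P X + qn (valW its) (valN its) (valB its) <=
    2%:E * (msq P (fun w => X w + D w)%R + (r / 6)%:E))%E.
  rewrite simple_isometry//.
  have -> : (fun w => X w + \sum_(i <- its) incr t u i w) =
      (fun w => (X w + D w) + - (D w - \sum_(i <- its) incr t u i w)).
    by apply/funext => w; ring.
  apply: le_trans (msqD _ _) _.
  - exact: measurable_funD.
  - by apply: measurable_funN; exact: measurable_funB.
  by rewrite msqN lee_pmul2l ?lte_fin// leeD2l.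
exact: (combine _ _ _ _ _ (msq_ge0 X) (qnorm_ge0 _ _ _ _ _) (qnorm_ge0 _ _ _ _ _) (msq_ge0 _) A Bd).
Qed.

Lemma approximableD {y1 z1 c1 D1 y2 z2 c2 D2} :
  jmeas T y1 -> jmeasZ T z1 -> jmeas T c1 -> measurable_fun setT D1 ->
  jmeas T y2 -> jmeasZ T z2 -> jmeas T c2 -> measurable_fun setT D2 ->
  approximable y1 z1 c1 D1 -> approximable y2 z2 c2 D2 ->
  approximable (fun s w => y1 s w + y2 s w) (fun s w x => z1 s w x + z2 s w x)
    (fun s w => c1 s w + c2 s w) (fun w => D1 w + D2 w).
Proof.
move=> my1 mz1 mc1 mD1 my2 mz2 mc2 mD2 apx1 apx2 r r0.
(* The square of a sum costs a factor 2, and [2 * (r / 4) + 2 * (r / 4) = r]. *)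
have r4 : 0 < r / 4 by rewrite divr_gt0.
have [i1 [q1 e1]] := apx1 _ r4; have [i2 [q2 e2]] := apx2 _ r4.
have mW (i : seq item) := jmeas_valW Gm i; have mN (i : seq item) := jmeas_valN Gm i.
have mB (i : seq item) := jmeas_valB Gm i.
exists (i1 ++ i2); split.
  have := qnorm_split (P := P) hl t0 uT
    (jmeasB my1 (mW i1)) (jmeasB my2 (mW i2)) (jmeasZB mz1 (mN i1)) (jmeasZB mz2 (mN i2))
    (jmeasB mc1 (mB i1)) (jmeasB mc2 (mB i2)).
  have -> : (fun s w => y1 s w + y2 s w - valW (i1 ++ i2) s w) =
      (fun s w => (y1 s w - valW i1 s w) + (y2 s w - valW i2 s w)).
    by apply/funext => s; apply/funext => w; rewrite /valW big_cat/=; ring.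
  have -> : (fun s w x => z1 s w x + z2 s w x - valN (i1 ++ i2) s w x) =
      (fun s w x => (z1 s w x - valN i1 s w x) + (z2 s w x - valN i2 s w x)).
    apply/funext => s; apply/funext => w; apply/funext => x.
    by rewrite /valN big_cat/=; ring.
  have -> : (fun s w => c1 s w + c2 s w - valB (i1 ++ i2) s w) =
      (fun s w => (c1 s w - valB i1 s w) + (c2 s w - valB i2 s w)).
    by apply/funext => s; apply/funext => w; rewrite /valB big_cat/=; ring.
  move/le_trans; apply.
  apply: (@le_trans _ _ (2%:E * (r / 4)%:E + 2%:E * (r / 4)%:E)%E).
    have two : (0 <= 2%:E :> \bar R)%E by rewrite lee_fin.
    exact: (leeD (lee_wpmul2l two q1) (lee_wpmul2l two q2)).
  by rewrite -!EFinM -EFinD lee_fin; lra.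
have mS (i : seq item) : measurable_fun setT (fun w => \sum_(j <- i) incr t u j w) by case: (sum_sqint i).
have := msqD (P := P) (measurable_funB mD1 (mS i1)) (measurable_funB mD2 (mS i2)).
rewrite [X in (msq _ X <= _)%E](_ : _ =
    fun w => D1 w + D2 w - \sum_(i <- i1 ++ i2) incr t u i w); last first.
  by apply/funext => w; rewrite big_cat/=; ring.
move/le_trans; apply.
apply: (@le_trans _ _ (2%:E * ((r / 4)%:E + (r / 4)%:E))%E).
  have two : (0 <= 2%:E :> \bar R)%E by rewrite lee_fin.
  exact: (lee_wpmul2l two (leeD e1 e2)).
by rewrite -EFinD -EFinM lee_fin; lra.
Qed.

Let coef_opp (i : item) : simple_coef T G (it_left i) (it_right i) (fun w => - it_coef i w).
Proof.
have [a0 ab bT cG [M cM]] := it_coef_ok i; split => //; last first.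
  by exists M => w; rewrite normrN.
apply: (events_on_comp (Gs _) (h := fun x : R => - x)) => //.
exact: oppr_measurable.
Qed.

Let opp_item (i : item) : item := Item _ _ _ _ (coef_opp i) (it_kind_ok i).

Lemma approximableN {y z c D} : approximable y z c D ->
  approximable (fun s w => - y s w) (fun s w x => - z s w x) (fun s w => - c s w)
    (fun w => - D w).
Proof.
move=> apx r /apx[its [q e]]; exists [seq opp_item i | i <- its]; split; last first.
  rewrite (_ : (fun w => _) = (fun w => - (D w - \sum_(i <- its) incr t u i w))) ?msqN//.
  apply/funext => w; rewrite big_map opprD; congr (_ + _); congr (- _); rewrite -sumrN.
  by apply: eq_bigr => i _; rewrite /it_incr/= mulNr.
have vE i s w : it_val (opp_item i) s w = - it_val i s w by rewrite /it_val/= mulNr.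
have eW s w : - y s w - valW [seq opp_item i | i <- its] s w = - (y s w - valW its s w).
  rewrite /valW big_map opprD; congr (_ + _); congr (- _); rewrite -sumrN.
  by apply: eq_bigr => i _; rewrite vE/= mulrN.
have eN s w x : - z s w x - valN [seq opp_item i | i <- its] s w x = - (z s w x - valN its s w x).
  rewrite /valN big_map opprD; congr (_ + _); congr (- _); rewrite -sumrN.
  by apply: eq_bigr => i _; rewrite vE/= mulNr.
have eB s w : - c s w - valB [seq opp_item i | i <- its] s w = - (c s w - valB its s w).
  rewrite /valB big_map opprD; congr (_ + _); congr (- _); rewrite -sumrN.
  by apply: eq_bigr => i _; rewrite vE/= mulrN.
have E := qnorm_opp (P := P) (l := l) (t := t) (u := u) eW eN eB.
by move: q; rewrite -E.
Qed.

End interval.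

End approximation.

Section monotone.
Context {R : realType} {d : measure_display} {Omega : measurableType d}.
Context {P : probability Omega R} {T : R}.

Lemma stint_mono {t u t' u' : R} {F : R -> Omega -> \bar R} : 0 <= t' -> t' <= t -> u <= u' ->
  u' <= T -> stmeas T F -> (forall s w, 0 <= F s w)%E ->
  (stint P t u F <= stint P t' u' F)%E.
Proof.
move=> t0 tt uu uT mF F0; apply: ge0_le_integral => //.
- by move=> w _; exact: integral_ge0.
- exact: (stmeas_inner (le_trans t0 tt) (le_trans uu uT) mF F0).
- exact: (stmeas_inner t0 uT mF F0).
move=> w _; apply: ge0_subset_integral => //; first exact: (stmeas_section F w _ _ t0 uT mF).
move=> s /=; rewrite !in_itv/= => /andP[ts su].
by rewrite (le_trans tt ts) (le_trans su uu).
Qed.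

Lemma stint_eq0 (t u : R) (F : R -> Omega -> \bar R) : (forall s w, F s w = 0%E) ->
  stint P t u F = 0%E.
Proof. by move=> F0; apply: integral0_eq => w _; apply: integral0_eq. Qed.

End monotone.

(** * Stochastic integrals are approximable *)

Section integrals.
Context {R : realType} {d : measure_display} {Omega : measurableType d}.
Context {P : probability Omega R} {T : R} {l : {measure set R -> \bar R}}.
Context {W B : R -> Omega -> R} {N : Omega -> {measure set (R * R)%type -> \bar R}}.
Hypotheses (hP : measure_is_complete P) (hW : standard_brownian P T W)
  (hB : standard_brownian P T B) (hN : poisson_random_measure P T l N)
  (hl : (\int[l]_(z in Rstar) (z ^+ 2)%:E < +oo)%E).
Notation comp := (compensated T l N).
Local Notation G := (filtG P T l W B N).
Local Notation item := (@item R d Omega T G (noise R) (noise_ok l)).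
Local Notation val := (noise_val (T := T) (l := l) (W := W) (B := B) (N := N)).
Local Notation incr := (it_incr (m := val)).
Context {t u : R} (t0 : 0 <= t) (tu : t <= u) (uT : u <= T).
Local Notation approximable :=
  (approximable (P := P) (T := T) (l := l) (W := W) (B := B) (N := N) (t := t) (u := u)).

Let Gm : forall t : R, t <= T -> G t `<=` measurable.
Proof. exact: filtG_measurable. Qed.

(** Reconciles two descriptions of an increment over [[t, u]]: [it_incr] moves the endpoints into
    [[t, u]], while the simple integrals stop the noise at [u] and at [t] and are subtracted. *)
Let clampE (V : R -> R) a : V (clamp t u a) - V t = V (Num.min a u) - V (Num.min a t).
Proof.
rewrite /clamp; case: (leP a t) => at_.
  by rewrite (min_idPl tu) (min_idPl (le_trans at_ tu)) !subrr.
by [].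
Qed.

Let four_points (a b c x y z v : R) : a - c = x - y -> b - c = z - v -> b - a = z - x - (v - y).
Proof. by move=> e1 e2; have := congr2 (fun p q => q - p) e1 e2; rewrite opprB addrACA => E; lra. Qed.

Section family.
Variables (n : nat) (left right : 'I_n -> R) (coef : 'I_n -> Omega -> R) (kind : 'I_n -> noise R).
Hypotheses (coef_ok : forall i, simple_coef T G (left i) (right i) (coef i))
  (kind_ok : forall i, noise_ok l (kind i)).

Definition family_items : seq item :=
  [seq Item (left i) (right i) (coef i) (kind i) (coef_ok i) (kind_ok i) | i <- enum 'I_n].

Let family_integral s w := \sum_(i < n)
  coef i w * (val (kind i) (Num.min (right i) s) w - val (kind i) (Num.min (left i) s) w).

Let family_incr w : \sum_(i <- family_items) incr t u i w = family_integral u w - family_integral t w.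
Proof.
rewrite /family_items big_map big_enum -sumrB; apply: eq_bigr => i _.
rewrite /it_incr/= -mulrBr; congr (_ * _).
have E1 := clampE (fun s => val (kind i) s w) (left i).
have E2 := clampE (fun s => val (kind i) s w) (right i).
exact: (four_points _ _ _ _ _ _ _ E1 E2).
Qed.

Lemma measurable_family_integral s : 0 <= s <= T -> measurable_fun setT (family_integral s).
Proof.
move=> /andP[s0 sT]; apply: measurable_sum => i.
have [a0 ab bT cG _] := coef_ok i.
have mn (a : R) : 0 <= a -> a <= T -> measurable_fun setT (val (kind i) (Num.min a s)).
  move=> a0' aT; apply: (noise_measurable hP hW hB hN) => //.
  by rewrite le_min a0' s0 ge_min aT.
apply: measurable_funM; last first.
  by apply: measurable_funB; apply: mn => //; [exact: le_trans ab|exact: le_trans bT].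
by move=> _ A mA; apply: (Gm _ (le_trans ab bT)); apply: cG; exists A.
Qed.

(** The values [Iu], [It] are linked to the family only almost surely, because a jump integral
    evaluates rectangles and not differences of [noise_val]. The two errors of [r / 4] enter through
    [msqD], hence with a factor 2. *)
Lemma family_approx (r : R) (Iu It Mu Mt : Omega -> R) :
  measurable_fun setT Iu -> measurable_fun setT It ->
  measurable_fun setT Mu -> measurable_fun setT Mt ->
  {ae P, forall w, Iu w = family_integral u w} -> {ae P, forall w, It w = family_integral t w} ->
  (msq P (fun w => Iu w - Mu w)%R <= (r / 4)%:E)%E ->
  (msq P (fun w => It w - Mt w)%R <= (r / 4)%:E)%E ->
  (msq P (fun w => Mu w - Mt w - \sum_(i <- family_items) incr t u i w)%R <= r%:E)%E.
Proof.
move=> mIu mIt mMu mMt eu et du dt.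
rewrite (_ : msq _ _ = msq P (fun w => (It w - Mt w) + - (Iu w - Mu w))); last first.
  have [mu mt] : measurable_fun setT (family_integral u) /\ measurable_fun setT (family_integral t).
    split; apply: measurable_family_integral; first by rewrite uT (le_trans t0 tu).
    by rewrite t0 (le_trans tu uT).
  under [in LHS]eq_fun do rewrite family_incr.
  apply: msq_ae.
  - by apply: measurable_funB; exact: measurable_funB.
  - by apply: measurable_funD; [|apply: measurable_funN]; exact: measurable_funB.
  apply: filterS2 eu et => w.
  move: (Iu w) (It w) (Mu w) (Mt w) (family_integral u w) (family_integral t w) => a b c e f g.
  by move=> -> ->; ring.
apply: le_trans (msqD _ _) _.
- exact: measurable_funB.
- by apply: measurable_funN; exact: measurable_funB.
rewrite msqN; have two : (0 <= 2%:E :> \bar R)%E by rewrite lee_fin.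
apply: le_trans (lee_wpmul2l two (leeD dt du)) _.
by rewrite -EFinD -EFinM lee_fin; lra.
Qed.

End family.

Let sqnorm_part (y y' : R -> Omega -> R) (r : R) : jmeas T y -> jmeas T y' ->
  (sqnormH P 0 T (fun s w => y' s w - y s w)%R <= r%:E)%E ->
  (stint P t u (sq (fun s w => y s w - y' s w)%R) <= r%:E)%E.
Proof.
move=> my my' h; apply: le_trans h; apply: le_trans (stint_mono (lexx 0) t0 uT (lexx T) _ _) _.
- by apply: stmeas_sq; exact: jmeasB.
- exact: sq_ge0.
rewrite le_eqVlt; apply/orP; left; apply/eqP.
apply: eq_integral => w _; apply: eq_integral => s _.
by rewrite /sq -sqrrN opprB.
Qed.

Let sq0 (y : R -> Omega -> R) : (forall s w, y s w = 0) -> stint P t u (sq y) = 0%E.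
Proof. by move=> y0; apply: stint_eq0 => s w; rewrite /sq y0 expr0n. Qed.

Let nz0 (z : R -> Omega -> R -> R) : (forall s w x, z s w x = 0) ->
  stint P t u (nz l z) = 0%E.
Proof.
by move=> z0; apply: stint_eq0 => s w; apply: integral0_eq => x _; rewrite z0 expr0n.
Qed.

Lemma jmeas_sp_val (phi : simple_process T G) : jmeas T (sp_val phi).
Proof.
apply: jmeas_sum => i.
exact: (jmeas_it_val Gm (Item (ok := noise_ok l) (sp_left i) (sp_right i) (sp_coef i) NoiseW
  (sp_ok i) I)).
Qed.

(** Shared by [W] and [B]: the weights of [k] decide in which component the simple process [p]
    appears, and the other components are zero. *)
Lemma ito_approx {V y M : R -> Omega -> R} {k : noise R} {r : R} :
  (forall s w, val k s w = V s w) -> noise_ok l k -> marks k = set0 ->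
  jmeas T y -> ito_integral P T G V y M -> 0 < r ->
  exists (its : seq item) (p : R -> Omega -> R),
  [/\ valW its = (fun s w => weightW k * p s w), valB its = (fun s w => weightB k * p s w),
      valN its = (fun _ _ _ => 0),
      (stint P t u (sq (fun s w => y s w - p s w)%R) <= r%:E)%E &
      (msq P (fun w => M u w - M t w - \sum_(i <- its) incr t u i w)%R <= r%:E)%E].
Proof.
move=> kV kok kN my hM r0; have r4 : 0 < r / 4 by rewrite divr_gt0.
have uT' : 0 <= u <= T by rewrite uT (le_trans t0 tu).
have tT' : 0 <= t <= T by rewrite t0 (le_trans tu uT).
have [phin [cvy cvM]] := hM.
have [mMu cvu] := cvM u uT'; have [mMt cvt] := cvM t tT'.
have [n [[hy hu] ht]] := filter_ex (filterI (filterI (cvge0_eventually _ _ r0 cvy)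
  (cvge0_eventually _ _ r4 cvu)) (cvge0_eventually _ _ r4 cvt)).
set phi := phin n in hy hu ht.
have IE s w : sp_integral V phi s w = \sum_(i < sp_size phi)
    sp_coef i w * (val k (Num.min (sp_right i) s) w - val k (Num.min (sp_left i) s) w).
  by apply: eq_bigr => i _; rewrite !kV.
have mI s : 0 <= s <= T -> measurable_fun setT (sp_integral V phi s).
  move=> sT; have := measurable_family_integral _ _ _ _ (fun=> k) (sp_ok (s := phi)) (fun=> kok) s sT.
  by apply: eq_measurable_fun => w _; rewrite IE.
exists (family_items (sp_size phi) (sp_left (s := phi)) (sp_right (s := phi))
  (sp_coef (s := phi)) (fun=> k) (sp_ok (s := phi)) (fun=> kok)), (sp_val phi); split.
- by apply/funext => s; apply/funext => w; rewrite /valW big_map big_enum/= mulr_sumr.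
- by apply/funext => s; apply/funext => w; rewrite /valB big_map big_enum/= mulr_sumr.
- apply/funext => s; apply/funext => w; apply/funext => x.
  by rewrite /valN big_map big_enum/= big1// => i _; rewrite kN indicE in_set0 mulr0.
- by apply: sqnorm_part => //; exact: jmeas_sp_val.
apply: (family_approx _ _ _ _ _ _ _ r (sp_integral V phi u) (sp_integral V phi t)).
- exact: mI.
- exact: mI.
- exact: mMu.
- exact: mMt.
- by apply: aeW => w; exact: IE.
- by apply: aeW => w; exact: IE.
- by rewrite msqE.
- by rewrite msqE.
Qed.

Lemma ito_approximable_W {y M : R -> Omega -> R} : jmeas T y -> ito_integral P T G W y M ->
  approximable y (fun _ _ _ => 0) (fun _ _ => 0) (fun w => M u w - M t w).
Proof.
move=> my hM r r0.
have [its [p [vW vB vN q e]]] := ito_approx (k := NoiseW) (fun s w => erefl) I erefl my hM r0.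
exists its; split; last exact: e.
have {}vW : valW its = p by rewrite vW; apply/funext => s; apply/funext => w; rewrite mul1r.
rewrite /qnorm vW vB vN nz0; last by move=> s w x; rewrite subrr.
by rewrite (sq0 (fun s w => 0 - _))// ?adde0// => s w; rewrite mul0r subrr.
Qed.

Lemma ito_approximable_B {y M : R -> Omega -> R} : jmeas T y -> ito_integral P T G B y M ->
  approximable (fun _ _ => 0) (fun _ _ _ => 0) y (fun w => M u w - M t w).
Proof.
move=> my hM r r0.
have [its [p [vW vB vN q e]]] := ito_approx (k := NoiseB) (fun s w => erefl) I erefl my hM r0.
exists its; split; last exact: e.
have {}vB : valB its = p by rewrite vB; apply/funext => s; apply/funext => w; rewrite mul1r.
rewrite /qnorm vW vB vN nz0; last by move=> s w x; rewrite subrr.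
by rewrite (sq0 (fun s w => 0 - _))// ?adde0 ?add0e// => s w; rewrite mul0r subrr.
Qed.

Lemma jump_approximable {z : R -> Omega -> R -> R} {M : R -> Omega -> R} : jmeasZ T z ->
  jump_integral P T l G N z M ->
  approximable (fun _ _ => 0) z (fun _ _ => 0) (fun w => M u w - M t w).
Proof.
move=> mz hM r r0; have r4 : 0 < r / 4 by rewrite divr_gt0.
have uT' : 0 <= u <= T by rewrite uT (le_trans t0 tu).
have tT' : 0 <= t <= T by rewrite t0 (le_trans tu uT).
have [thn [cvz cvM]] := hM.
have [mMu cvu] := cvM u uT'; have [mMt cvt] := cvM t tT'.
have [n [[hz hu] ht]] := filter_ex (filterI (filterI (cvge0_eventually _ _ r0 cvz)
  (cvge0_eventually _ _ r4 cvu)) (cvge0_eventually _ _ r4 cvt)).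
set th := thn n in hz hu ht.
have mk i : noise_ok l (NoiseN (sf_mark (s := th) i)) := sf_mark_ok (s := th) i.
pose items := family_items (sf_size th) (sf_left (s := th)) (sf_right (s := th))
  (sf_coef (s := th)) (fun i => NoiseN (sf_mark (s := th) i)) (sf_ok (s := th)) mk.
exists items; split.
  have vW s w : valW items s w = 0 by rewrite /valW big_map big1// => i _; rewrite mul0r.
  have vB s w : valB items s w = 0 by rewrite /valB big_map big1// => i _; rewrite mul0r.
  have vN s w x : valN items s w x = sf_val th s w x by rewrite /valN big_map big_enum.
  rewrite /qnorm (sq0 (fun s w => 0 - valW _ _ _)); last by move=> s w; rewrite vW subrr.
  rewrite (sq0 (fun s w => 0 - _)); last by move=> s w; rewrite vB subrr.
  rewrite add0e adde0; apply: le_trans hz.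
  apply: le_trans (stint_mono (lexx 0) t0 uT (lexx T) _ _) _.
  - by apply: (stmeas_nz hl); apply: jmeasZB => //; exact: jmeas_valN.
  - exact: nz_ge0.
  rewrite le_eqVlt; apply/orP; left; apply/eqP.
  apply: eq_integral => w _; apply: eq_integral => s _; apply: eq_integral => x _.
  by rewrite vN -sqrrN opprB.
have rect s i : 0 <= s <= T -> [/\ 0 <= Num.min (sf_left (s := th) i) s,
    Num.min (sf_left (s := th) i) s <= Num.min (sf_right (s := th) i) s &
    Num.min (sf_right (s := th) i) s <= T].
  move=> /andP[s0 sT]; have [a0 ab bT _ _] := sf_ok (s := th) i.
  by rewrite !le_min !ge_min a0 s0 ab sT lexx !orbT.
have mI s : 0 <= s <= T -> measurable_fun setT (sf_integral N th s).
  move=> sT; apply: measurable_sum => i; have [a0 ab bT] := rect s i sT.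
  have strip := rect_strip a0 bT (mk i); have fin := rect_fin a0 ab bT (mk i).
  have [[mC _] _ _ _] := comp_moments hN (measurable_rect (mk i)) strip fin.
  apply: measurable_funM => //; have [_ ab' bT' cG _] := sf_ok (s := th) i.
  by move=> _ A mA; apply: (Gm _ (le_trans ab' bT')); apply: cG; exists A.
(* Each rectangle agrees almost surely with a difference of noise values; as there are finitely
   many, one null set serves them all. *)
have aeI s : 0 <= s <= T -> {ae P, forall w, sf_integral N th s w = \sum_(i < sf_size th)
    sf_coef i w * (val (NoiseN (sf_mark (s := th) i)) (Num.min (sf_right i) s) w -
      val (NoiseN (sf_mark (s := th) i)) (Num.min (sf_left i) s) w)}.
  move=> sT.
  have : {ae P, forall w, forall i : 'I_(sf_size th),
      val (NoiseN (sf_mark (s := th) i)) (Num.min (sf_right i) s) w -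
      val (NoiseN (sf_mark (s := th) i)) (Num.min (sf_left i) s) w =
      comp (`]Num.min (sf_left i) s, Num.min (sf_right i) s] `*` sf_mark i) w}.
    apply: filter_forall => i; have [a0 ab bT] := rect s i sT.
    exact: (comp_time_add hN a0 ab bT (mk i)).
  by apply: filterS => w h; apply: eq_bigr => i _; rewrite h.
apply: (family_approx _ _ _ _ _ _ _ r (sf_integral N th u) (sf_integral N th t)).
- exact: mI.
- exact: mI.
- exact: mMu.
- exact: mMt.
- exact: aeI.
- exact: aeI.
- by rewrite msqE.
- by rewrite msqE.
Qed.

End integrals.

(** * Enlarging the filtration, regular versions *)

Section larger_filtration.
Context {R : realType} {d : measure_display} {Omega : measurableType d}.
Context {P : probability Omega R} {T : R} {l : {measure set R -> \bar R}}.
Context {H H' : R -> set (set Omega)} (HH : forall t, H t `<=` H' t).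

Lemma adapted_mono {x : R -> Omega -> R} : adapted T H x -> adapted T H' x.
Proof. by move=> xH t tT; apply: subset_trans (HH t); exact: xH. Qed.

Lemma predictable_sets_mono : predictable_sets T H `<=` predictable_sets T H'.
Proof.
apply: smallest_sub; first exact: smallest_sigma_algebra.
move=> C [[A HA <-]|[s [t [A [s0 st tT HA ->]]]]]; apply: sub_gen_smallest.
  by left; exists A => //; exact: HH.
by right; exists s, t, A; split => //; exact: HH.
Qed.

Lemma H2T_mono {y : R -> Omega -> R} : H2T P T H y -> H2T P T H' y.
Proof. by move=> [py ?]; split => //; exact: subset_trans predictable_sets_mono. Qed.

Lemma Hhat2T_mono {z : R -> Omega -> R -> R} : Hhat2T P T l H z -> Hhat2T P T l H' z.
Proof.
move=> [pz ?]; split => //; apply: subset_trans pz _.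
apply: smallest_sub; first exact: smallest_sigma_algebra.
move=> _ [C pC [S SR <-]]; apply: sub_gen_smallest.
by exists C; [exact: predictable_sets_mono|exists S].
Qed.

Lemma S2T_mono {x : R -> Omega -> R} : S2T P T H x -> S2T P T H' x.
Proof. by move=> [ax ? ?]; split => //; exact: adapted_mono. Qed.

Lemma simple_coef_mono {a b : R} {c : Omega -> R} : simple_coef T H a b c -> simple_coef T H' a b c.
Proof. by move=> [? ? ? cH ?]; split => //; exact: subset_trans (HH a). Qed.

Lemma ito_integral_mono {V y M : R -> Omega -> R} :
  ito_integral P T H V y M -> ito_integral P T H' V y M.
Proof.
move=> [phi [? ?]].
by exists (fun n => SimpleProcess (fun i => simple_coef_mono (sp_ok (s := phi n) i))).
Qed.

Lemma jump_integral_mono {N : Omega -> {measure set (R * R)%type -> \bar R}}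
    {z : R -> Omega -> R -> R} {M : R -> Omega -> R} :
  jump_integral P T l H N z M -> jump_integral P T l H' N z M.
Proof.
move=> [th [? ?]].
by exists (fun n => SimpleField (fun i => simple_coef_mono (sf_ok (s := th n) i))
  (sf_mark_ok (s := th n))).
Qed.

End larger_filtration.

Section zero_integrand.
Context {R : realType} {d : measure_display} {Omega : measurableType d}.
Context {P : probability Omega R} {T : R} {H : R -> set (set Omega)}.
Let zero : R -> Omega -> R := fun _ _ => 0.

Lemma H2T_0 : H2T P T H zero.
Proof.
have z0 : sqnormH P 0 T zero = 0%E.
  by apply: (stint_eq0 _ _ (fun s w => (zero s w ^+ 2)%:E)) => s w; rewrite /zero expr0n.
split; last by rewrite z0 ltry.
have [s0 sD _] : sigma_algebra (setT `*` `[0, T]) (predictable_sets T H).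
  exact: smallest_sigma_algebra.
move=> _ [A mA <-]; have [A0|A0] := pselect (A 0).
  rewrite (_ : _ `&` _ = (setT `*` `[0, T]) `\` set0); first exact: sD.
  by rewrite setD0; apply/setIidPl => p _.
by rewrite (_ : _ `&` _ = set0)//; apply/seteqP; split => // p [].
Qed.

Lemma ito_integral_0 {V : R -> Omega -> R} : ito_integral P T H V zero zero.
Proof.
have ok (i : 'I_0) : simple_coef T H (0 : R) (0 : R) (fun _ : Omega => 0 : R) by case: i.
exists (fun=> SimpleProcess ok); split.
  rewrite (_ : (fun n => _) = cst 0%E); first exact: cvg_cst.
  apply/funext => n; apply: (stint_eq0 _ _
    (fun s w => ((sp_val (SimpleProcess ok) s w - zero s w) ^+ 2)%:E)) => s w.
  by rewrite /sp_val big_ord0 subrr expr0n.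
move=> t _; split; first exact: measurable_cst.
rewrite (_ : (fun n => _) = cst 0%E); first exact: cvg_cst.
apply/funext => n; rewrite unlock; apply: integral0_eq => w _.
by rewrite /sp_integral big_ord0 subrr expr0n.
Qed.

End zero_integrand.

Lemma bsdej_bsdej1 {R : realType} {d : measure_display} {Omega : measurableType d}
    {P : probability Omega R} {T : R} {l : {measure set R -> \bar R}} {W B : R -> Omega -> R}
    {N : Omega -> {measure set (R * R)%type -> \bar R}} {xi : Omega -> R} {f X Y Z} :
  bsdej P T l W N xi f X Y Z ->
  bsdej1 P T l W B N xi (fun s w x y z _ => f s w x y z) X Y Z (fun _ _ => 0).
Proof.
have FG := filtF_subG (P := P) (T := T) (l := l) (W := W) (B := B) (N := N).
move=> [sX hY hZ intD [MY [MZ [iY iZ eqX]]]]; split; [|exact: intD|].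
  by split; [exact: (S2T_mono FG sX)|exact: (H2T_mono FG hY)|exact: (Hhat2T_mono FG hZ)|exact: H2T_0].
exists MY, MZ, (fun _ _ => 0); split;
  [exact: (ito_integral_mono FG iY)|exact: (jump_integral_mono FG iZ)|exact: ito_integral_0|].
by move=> t /eqX; apply: filterS => w ->; rewrite subrr subr0.
Qed.

Section nonmeasurable_monotonicity.
Context {R : realType} {d : measure_display} {V : measurableType d}.
Context {mu : {measure set V -> \bar R}}.
Implicit Types f g : V -> \bar R.

(* No measurability is needed: integrals of nonnegative functions are suprema over simple ones. *)
Lemma ge0_integral_mono {f g} : (forall x, 0 <= f x)%E -> (forall x, f x <= g x)%E ->
  (\int[mu]_x f x <= \int[mu]_x g x)%E.
Proof.
move=> f0 fg; have g0 x : (0 <= g x)%E := le_trans (f0 x) (fg x).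
rewrite !ge0_integralTE//; apply: le_ereal_sup => _ [h hf <-]; exists h => //.
by move=> x; exact: le_trans (fg x).
Qed.

(** Adding [+oo] to [g] on the exceptional null set makes the domination hold everywhere without
    changing the integral. Here [f] may be non-measurable, as happens for the time integral of the
    squared difference of [X] and [X'] themselves. *)
Lemma ae_ge0_integral_mono {f g} : (forall x, 0 <= f x)%E -> (forall x, 0 <= g x)%E ->
  measurable_fun setT g -> {ae mu, forall x, (f x <= g x)%E} ->
  (\int[mu]_x f x <= \int[mu]_x g x)%E.
Proof.
move=> f0 g0 mg [N [mN N0 fgN]].
pose k : V -> \bar R := (cst +oo%E) \_ N.
have mk : measurable_fun setT k by apply/(measurable_restrictT _ mN).
have k0 x : (0 <= k x)%E by rewrite /k patchE; case: ifP => //= _; exact: leey.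
apply: (@le_trans _ _ (\int[mu]_x (g x + k x))%E).
  apply: ge0_integral_mono => // x; rewrite /k patchE; case: ifPn => xN.
    by rewrite addey ?leey// gt_eqF// (lt_le_trans _ (g0 x)).
  rewrite adde0; apply: contrapT => h.
  by move/negP : xN; apply; apply/mem_set/fgN.
rewrite le_eqVlt; apply/orP; left; apply/eqP; apply: ae_eq_integral => //.
  exact: emeasurable_funD.
exists N; split => // x h; apply: contrapT => xN; apply: h => _.
by rewrite /k patchE memNset// adde0.
Qed.

End nonmeasurable_monotonicity.

(** * A jointly measurable version of a right-continuous process *)

Section right_continuous_version.
Context {R : realType} {d : measure_display} {Omega : measurableType d}.
Context {P : probability Omega R} {T : R} (T0 : 0 < T) {x : R -> Omega -> R}.
Hypotheses (mx : forall t : R, 0 <= t <= T -> measurable_fun setT (x t))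
  (rx : {ae P, forall w, forall t : R, 0 <= t < T -> x s w @[s --> t^'+] --> x t w}).

(** The first multiple of [1 / n.+1] strictly after [s], cut at [T]. It has to lie strictly after
    [s] because a right limit sees only such points. *)
Let step (n : nat) (s : R) : R := Num.min T ((Num.truncn (s * n.+1%:R)).+1%:R / n.+1%:R).

Let n0 (n : nat) : 0 < n.+1%:R :> R. Proof. by rewrite ltr0n. Qed.

Let step_T n : step n T = T.
Proof.
apply/min_idPl; rewrite ler_pdivlMr//; apply/ltW/truncnS_gt.
Qed.

Let step_gt n s : 0 <= s -> s < T -> s < step n s.
Proof. by move=> s0 sT; rewrite lt_min sT ltr_pdivlMr// truncnS_gt. Qed.

Let step_le n s : 0 <= s -> step n s <= s + n.+1%:R^-1.
Proof.
move=> s0; rewrite ge_min; apply/orP; right; rewrite ler_pdivrMr// mulrDl mulVf ?gt_eqF//.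
by rewrite -natr1 lerD2r truncn_le// mulr_ge0// ltW.
Qed.

Let step_cvg s : 0 <= s -> s < T -> step n s @[n --> \oo] --> s.
Proof.
move=> s0 sT; apply: (squeeze_cvgr (f := cst s) (h := fun n => s + n.+1%:R^-1)).
- by near=> n; rewrite (ltW (step_gt _ _ s0 sT)) step_le.
- exact: cvg_cst.
- rewrite -[X in _ --> X]addr0; apply: cvgD; first exact: cvg_cst.
  exact: cvg_harmonic.
Unshelve. all: by end_near. Qed.

Let jmeas_step n : jmeas T (fun s w => x (step n s) w).
Proof.
move=> _ A mA.
pose c (k : nat) : R := Num.min T (k.+1%:R / n.+1%:R).
pose S (k : nat) : set R := `[0, T] `&` `[k%:R / n.+1%:R, k.+1%:R / n.+1%:R[.
have stepc s k : S k s -> step n s = c k.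
  move=> [/=]; rewrite !in_itv/= => /andP[s0 sT] /andP[ks sk]; rewrite /step /c.
  by rewrite (@truncn_def _ _ k)// -ler_pdivrMr// -ltr_pdivlMr// ks sk.
rewrite (_ : _ `&` _ = \bigcup_k ((x (c k) @^-1` A) `*` S k)).
  apply: bigcup_measurable => k _; apply: measurableX; last exact: measurableI.
  rewrite -[X in measurable X]setTI; apply: mx => //.
  by rewrite ge_min lexx/= le_min ltW// divr_ge0.
apply/seteqP; split => [[w s] /= [[_ sT] xA]|[w s] /= [k _ [xA sk]]].
  have := sT; rewrite in_itv/= => /andP[s0 _].
  have sS : S (Num.truncn (s * n.+1%:R)) s.
    split => //=; rewrite in_itv/= ler_pdivrMr// ltr_pdivlMr// truncnS_gt andbT.
    by rewrite truncn_le// mulr_ge0// ltW.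
  by exists (Num.truncn (s * n.+1%:R)) => //; split => //=; rewrite -(stepc s).
by split; [split => //; case: sk|rewrite (stepc s k)].
Qed.

(** Sampled on the grid, the process is a countable union of rectangles, hence jointly measurable,
    and right-continuity makes the samples converge. Paths in the null set [N] are replaced by 0 so
    that the limit exists everywhere. *)
Lemma right_continuous_version : exists x' : R -> Omega -> R, jmeas T x' /\
  {ae P, forall w, forall s : R, 0 <= s <= T -> x' s w = x s w}.
Proof.
have [N [mN PN NS]] := rx.
exists (fun s w => \1_(~` N) w * x s w); split; last first.
  exists N; split => // w h; apply: contrapT => wN; apply: h => s sT.
  by rewrite indicE mem_set// mul1r.
rewrite /jmeas; apply: (@measurable_fun_cvg _ _ _ _
  (fun n (p : Omega * R) => \1_(~` N) p.1 * x (step n p.2) p.1)).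
  move=> n; apply: measurable_funM; last exact: jmeas_step.
  have mI : measurable_fun setT (\1_(~` N) : Omega -> R).
    by apply: measurable_indic; exact: measurableC.
  exact: (measurable_funTS (measurableT_comp mI measurable_fst)).
move=> [w s] [_ /=]; rewrite in_itv/= => /andP[s0 sT].
have [wN|wN] := pselect (N w).
  have i0 : \1_(~` N) w = 0 :> R by rewrite indicE memNset//; apply; exact: wN.
  by under eq_fun do rewrite /= i0 mul0r; rewrite /= i0 mul0r; exact: cvg_cst.
apply: cvgM; first exact: cvg_cst.
(* There is nothing to the right of [T], but [step n T] equals [T]. *)
move: sT; rewrite le_eqVlt => /predU1P[->|sT].
  by under eq_fun do rewrite step_T; exact: cvg_cst.
have wx : forall t : R, 0 <= t < T -> x s w @[s --> t^'+] --> x t w.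
  by apply: contrapT => h; apply: wN; exact: NS.
have s0T : 0 <= s < T by rewrite s0 sT.
have [/(_ (wx s s0T)) h _] := cvg_at_rightP (fun s => x s w) s (x s w).
by apply: (h (step^~ s)); split; [move=> n; exact: step_gt|exact: step_cvg].
Qed.

End right_continuous_version.

Section square_integrable_paths.
Context {R : realType} {d : measure_display} {Omega : measurableType d}.
Context {P : probability Omega R} {T : R} (T0 : 0 < T) {H : R -> set (set Omega)}.
Hypothesis Hmeas : forall t : R, t <= T -> H t `<=` measurable.

Lemma adapted_measurable {x : R -> Omega -> R} {t : R} : adapted T H x -> 0 <= t <= T ->
  measurable_fun setT (x t).
Proof.
move=> ax tT _ A mA; have /andP[_ tT'] := tT.
by apply: (Hmeas t tT'); apply: ax => //; exists A.
Qed.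

Lemma msq_sqint {X : Omega -> R} : measurable_fun setT X -> (msq P X < +oo)%E -> sqint P X.
Proof.
move=> mX fX; split => //; apply/integrableP; split.
  by apply/measurable_EFinP; exact: measurable_funX.
rewrite (_ : (\int[P]_w _ = msq P X)%E)//; apply: eq_integral => w _ /=.
by rewrite ger0_norm ?sqr_ge0.
Qed.

(** The supremum runs over uncountably many times and is not known to be measurable;
    [ge0_integral_mono] covers this case. *)
Lemma S2T_msq_bound {x : R -> Omega -> R} : S2T P T H x ->
  exists S : R, forall t : R, 0 <= t <= T -> (msq P (x t) <= S%:E)%E.
Proof.
move=> [ax _ fx]; set I := (\int[P]_w _)%E in fx.
exists (fine I) => t tT.
have xI : (msq P (x t) <= I)%E.
  apply: ge0_integral_mono => w; first by rewrite lee_fin sqr_ge0.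
  by apply: ereal_sup_ubound; exists t => //=; rewrite in_itv.
by rewrite fineK// ge0_fin_numE// (le_trans (msq_ge0 _) xI).
Qed.

Lemma S2T_difference {x x' : R -> Omega -> R} : S2T P T H x -> S2T P T H x' ->
  [/\ forall t : R, 0 <= t <= T -> sqint P (fun w => x t w - x' t w),
      exists S : R, forall t : R, 0 <= t <= T -> (msq P (fun w => x t w - x' t w)%R <= S%:E)%E &
      exists y : R -> Omega -> R, jmeas T y /\
        {ae P, forall w, forall s : R, 0 <= s <= T -> y s w = x s w - x' s w}].
Proof.
move=> sx sx'; have [ax cx _] := sx; have [ax' cx' _] := sx'.
have [S hS] := S2T_msq_bound sx; have [S' hS'] := S2T_msq_bound sx'.
have mx t tT := adapted_measurable (t := t) ax tT.
have mx' t tT := adapted_measurable (t := t) ax' tT.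
have bound (t : R) : 0 <= t <= T ->
    (msq P (fun w => x t w - x' t w)%R <= (2 * (S + S'))%:E)%E.
  move=> tT; have two : (0 <= 2%:E :> \bar R)%E by rewrite lee_fin.
  apply: le_trans (msqD (Y := fun w => - x' t w) (mx t tT) (measurable_funN (mx' t tT))) _.
  by rewrite msqN EFinM EFinD; exact: (lee_wpmul2l two (leeD (hS t tT) (hS' t tT))).
split.
- move=> t tT; apply: msq_sqint; first by apply: measurable_funB; [exact: mx|exact: mx'].
  by apply: le_lt_trans (bound t tT) _; exact: ltry.
- by exists (2 * (S + S')).
apply: (right_continuous_version T0).
  by move=> t tT; apply: measurable_funB; [exact: mx|exact: mx'].
apply: filterS2 cx cx' => w [rx _] [rx' _] t tT.
by apply: cvgB; [exact: rx|exact: rx'].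
Qed.

End square_integrable_paths.

(** * Increments of the drift *)

Section path_increment.
Context {R : realType} {T t u : R} (t0 : 0 <= t) (tu : t <= u) (uT : u <= T).
Notation leb := (@lebesgue_measure R).
Context {L L' : set R}.
Hypotheses (mL : measurable (`[0, T] `&` L)) (mL' : measurable (`[0, T] `&` L')).

(* The library lemmas at the measurable structure carried by [leb]. *)
Let timeS := @integrableS _ (measurableTypeR R) R leb.
Let time_negligible := @negligible_integral _ (measurableTypeR R) R leb.
Let time_fin_num := @integrable_fin_num _ (measurableTypeR R) R leb.

Let sub (A : set R) (v v' : R) : 0 <= v -> v' <= T -> `[v, v'] `&` A = `[v, v'] `&` (`[0, T] `&` A).
Proof.
move=> v0 vT; rewrite setIA; congr (_ `&` _); apply/esym/setIidPl => s /=; rewrite !in_itv/=.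
by move=> /andP[vs sv]; rewrite (le_trans v0 vs) (le_trans sv vT).
Qed.

Let mclosed (A : set R) (v v' : R) : measurable (`[0, T] `&` A) -> 0 <= v -> v' <= T ->
  measurable (`[v, v'] `&` A).
Proof. by move=> mA v0 vT; rewrite sub//; exact: measurableI. Qed.

Let half (A : set R) : `[t, u[ `&` A = `[t, u[ `&` (`[0, T] `&` A).
Proof.
rewrite setIA; congr (_ `&` _); apply/esym/setIidPl => s /=; rewrite !in_itv/=.
by move=> /andP[ts /ltW su]; rewrite (le_trans t0 ts) (le_trans su uT).
Qed.

Let mhalf (A : set R) : measurable (`[0, T] `&` A) -> measurable (`[t, u[ `&` A).
Proof. by move=> mA; rewrite half; exact: measurableI. Qed.

Lemma Rintegral_time_increment {A : set R} {g : R -> R} : measurable (`[0, T] `&` A) ->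
  leb.-integrable (`[0, T] `&` A) (EFin \o g) ->
  \int[leb]_(s in `[t, T] `&` A) g s - \int[leb]_(s in `[u, T] `&` A) g s =
  \int[leb]_(s in `[t, u[ `&` A) g s.
Proof.
move=> mA ig; have u0 := le_trans t0 tu.
have E : `[t, T] `&` A = (`[t, u[ `&` A) `|` (`[u, T] `&` A).
  rewrite -setIUl; congr (_ `&` _); apply/seteqP; split => s /=; rewrite !in_itv/=.
    by move=> /andP[ts sT]; case: (ltP s u) => us; [left|right]; rewrite ?ts ?sT.
  by move=> [/andP[-> /ltW su]|/andP[us ->]];
    rewrite ?(le_trans su uT)// (le_trans tu us).
rewrite [in X in X - _]E Rintegral_setU.
- by rewrite addrK.
- exact: mhalf.
- exact: mclosed.
- by rewrite -E; apply: (timeS _ _ _ mA _ _ ig); [exact: mclosed|rewrite sub//; exact: subIsetr].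
- apply/disj_setPS => s [[/=]]; rewrite !in_itv/= => /andP[_ su] _ [/andP[us _] _].
  by move: (lt_le_trans su us); rewrite ltxx.
Qed.

Hypotheses (L0 : leb (`[0, T] `\` L) = 0%E) (L'0 : leb (`[0, T] `\` L') = 0%E).
Context {g g' : R -> R} {G : R -> \bar R}.
Hypotheses (ig : leb.-integrable (`[0, T] `&` L) (EFin \o g))
  (ig' : leb.-integrable (`[0, T] `&` L') (EFin \o g')).
Hypotheses (mG : measurable_fun `[t, u] G) (G0 : forall s, (0 <= G s)%E)
  (gG : forall s : R, 0 <= s <= T -> L s -> L' s -> (((g s - g' s) ^+ 2)%:E <= G s)%E).

Let E := `[t, u[ `&` (L `&` L').

Let mE : measurable E.
Proof.
rewrite /E half; apply: measurableI => //.
by rewrite setIIr; exact: measurableI.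
Qed.

(** The two drifts are integrated over different sets of proper times; up to null sets, both
    integrals may be taken over the common set [E]. *)
Let full (A A' : set R) (k : R -> R) : measurable (`[0, T] `&` A) -> measurable (`[0, T] `&` A') ->
  leb (`[0, T] `\` A') = 0%E -> leb.-integrable (`[0, T] `&` A) (EFin \o k) ->
  \int[leb]_(s in `[t, u[ `&` A) k s = \int[leb]_(s in `[t, u[ `&` (A `&` A')) k s.
Proof.
move=> mA mA' A'0 ik.
have mN : measurable (`[0, T] `\` A').
  rewrite (_ : _ `\` _ = `[0, T] `\` (`[0, T] `&` A')); first exact: measurableD.
  by apply/seteqP; split => s [sT h]; split => // A's; apply: h => //; case: A's.
rewrite /Rintegral (time_negligible _ _ _ mN (mhalf _ mA))//.
- congr (fine (integral _ _ _)); apply/seteqP; split => s /=.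
    move=> [[itu As] h]; split=> //; split => //; apply: contrapT => A's; apply: h; split => //.
    move: itu; rewrite !in_itv/= => /andP[ts /ltW su].
    by rewrite (le_trans t0 ts) (le_trans su uT).
  by move=> [itu [As A's]]; split => // -[_].
- by apply: (timeS _ _ _ mA _ _ ik); [exact: mhalf|rewrite half; exact: subIsetr].
Qed.

Let iE (k : R -> R) (A A' : set R) : measurable (`[0, T] `&` A) -> E = `[t, u[ `&` (A `&` A') ->
  leb.-integrable (`[0, T] `&` A) (EFin \o k) -> leb.-integrable E (EFin \o k).
Proof.
by move=> mA eE; apply: (timeS _ _ _ mA mE); rewrite eE half => s [_ [sT [As _]]].
Qed.

Let J := (\int[leb]_(s in `[t, u]) G s)%E.
Let m := \int[leb]_(s in E) `|g s - g' s|.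

(** Young's inequality [a <= c / 2 + a ^+ 2 / (2 * c)] under the integral, with [c] left free.
    Optimising [c] afterwards yields Cauchy-Schwarz. *)
Let m_le (c j : R) : 0 < c -> J = j%:E -> m <= (c * (u - t) + c^-1 * j) / 2.
Proof.
move=> c0 Jj; have c2 : 0 <= c / 2 by rewrite divr_ge0 ?ltW.
have ci : 0 <= c^-1 / 2 by rewrite divr_ge0// invr_ge0 ltW.
have ik : leb.-integrable E (EFin \o (fun s => g s - g' s)).
  apply: (@integrableB _ _ _ leb E mE (EFin \o g) (EFin \o g')).
    by apply: (iE g L L').
  by apply: (iE g' L' L) => //; rewrite /E (setIC L).
rewrite -lee_fin.
have -> : m%:E = (\int[leb]_(s in E) `|g s - g' s|%:E)%E.
  rewrite /m /Rintegral fineK//; apply: (time_fin_num _ mE).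
  exact: (integrable_norm ik).
have mGE : measurable_fun E G.
  apply: measurable_funS mG => // s [/=]; rewrite !in_itv/= => /andP[ts /ltW su] _.
  by rewrite ts su.
apply: (@le_trans _ _ (\int[leb]_(s in `[t, u]) ((c / 2)%:E + (c^-1 / 2)%:E * G s))%E).
  apply: (@le_trans _ _ (\int[leb]_(s in E) ((c / 2)%:E + (c^-1 / 2)%:E * G s))%E).
    apply: ge0_le_integral => //.
    - by case/integrableP : (integrable_norm ik).
    - apply: emeasurable_funD; first exact: measurable_cst.
      by apply: emeasurable_funM => //; exact: measurable_cst.
    move=> s [stu [Ls L's]].
    have sT : 0 <= s <= T.
      move: stu; rewrite /= in_itv/= => /andP[ts /ltW su].
      by rewrite (le_trans t0 ts) (le_trans su uT).
    have := gG s sT Ls L's; case: (G s) (G0 s) => [e|_ _|//]; last first.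
      by rewrite gt0_muley ?addey ?leey// lte_fin divr_gt0// invr_gt0.
    rewrite !lee_fin => e0 ge; set a := `|_|.
    have a2 : a ^+ 2 <= e by rewrite /a real_normK ?num_real.
    rewrite -subr_ge0.
    have -> : c / 2 + c^-1 / 2 * e - a = c^-1 / 2 * ((e - a ^+ 2) + (a - c) ^+ 2).
      by field; rewrite gt_eqF.
    by rewrite mulr_ge0// addr_ge0 ?sqr_ge0// subr_ge0.
  apply: ge0_subset_integral => //.
  - apply: emeasurable_funD; first exact: measurable_cst.
    by apply: emeasurable_funM => //; exact: measurable_cst.
  - by move=> s _; apply: adde_ge0; [rewrite lee_fin|apply: mule_ge0; rewrite ?lee_fin].
  - by move=> s [/=]; rewrite !in_itv/= => /andP[-> /ltW ->].
rewrite ge0_integralD//; last 2 first.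
- by move=> s _; apply: mule_ge0; rewrite ?lee_fin.
- by apply: emeasurable_funM => //; exact: measurable_cst.
rewrite ge0_integralZl_EFin// -/J Jj integral_cst//.
have len : leb (`[t, u]%classic : set R) = (u - t)%:E.
  rewrite lebesgue_measure_itv/= lte_fin; case: ltP => // ut.
  by rewrite (@le_anti _ _ t u) ?subrr// tu.
apply: (@le_trans _ _ ((c / 2)%:E * (u - t)%:E + (c^-1 / 2)%:E * j%:E)%E).
  by rewrite -len.
by rewrite -!EFinM -EFinD lee_fin; lra.
Qed.

(** The drift of a solution is controlled along single paths only. The squared difference is
    therefore bounded by a majorant [G] with measurable sections before any expectation is taken. *)
Lemma path_increment_le : t < u ->
  (((\int[leb]_(s in `[t, T] `&` L) g s - \int[leb]_(s in `[u, T] `&` L) g s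
     - (\int[leb]_(s in `[t, T] `&` L') g' s - \int[leb]_(s in `[u, T] `&` L') g' s)) ^+ 2)%:E
   <= (u - t)%:E * J)%E.
Proof.
move=> ltu; have h0 : 0 < u - t by rewrite subr_gt0.
rewrite !Rintegral_time_increment// (full L L')// (full L' L)// (setIC L') -/E.
have ig1 : leb.-integrable E (EFin \o g) by apply: (iE g L L').
have ig2 : leb.-integrable E (EFin \o g') by apply: (iE g' L' L) => //; rewrite /E (setIC L).
have ik : leb.-integrable E (EFin \o (fun s => g s - g' s)).
  exact: (@integrableB _ _ _ leb E mE (EFin \o g) (EFin \o g')).
rewrite -RintegralB//.
have Im : `|\int[leb]_(s in E) (g s - g' s)| <= m.
  exact: (@le_normr_Rintegral _ (measurableTypeR R) R leb _ _ mE ik).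
have J0 : (0 <= J)%E by apply: integral_ge0.
case EJ : J J0 => [j||//] J0; last by rewrite gt0_muley ?lee_fin ?leey// lte_fin.
rewrite -EFinM lee_fin -real_normK ?num_real//.
have m0 : 0 <= m by exact: le_trans Im.
apply: (@le_trans _ _ (m ^+ 2)); first by rewrite lerXn2r ?nnegrE.
move: m0; rewrite le_eqVlt => /predU1P[<-|m0].
  by rewrite expr0n/= mulr_ge0// ltW.
(* The optimal constant for Young's inequality: the bound becomes
   [m ^+ 2 <= (m ^+ 2 + (u - t) * j) / 2]. *)
have := m_le (m / (u - t)) j (divr_gt0 m0 h0) EJ.
rewrite mulfVK ?gt_eqF// invf_div.
move=> h; have : m * m <= m * ((m + (u - t) / m * j) / 2) by rewrite ler_pM2l.
have -> : m * ((m + (u - t) / m * j) / 2) = (m * m + (u - t) * j) / 2.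
  by field; rewrite gt_eqF.
by rewrite expr2 => *; lra.
Qed.

End path_increment.

(** * A backward Gronwall inequality *)

Section backward_gronwall.
Context {R : realType} (C T : R) (T0 : 0 < T).

(** Chosen for [h * (64 * C ^+ 2 + 1) <= 1]. This gives [32 * C ^+ 2 * h <= 1 / 2], which absorbs
    the drift, and [h <= 1], which bounds [A] over one step by the supremum of [a]. *)
Let n := (Num.truncn (T * (64 * C ^+ 2 + 1))).+1.
Let h := T / n%:R.

Let n0 : 0 < n%:R :> R. Proof. by rewrite ltr0n. Qed.

Let h0 : 0 < h. Proof. by rewrite divr_gt0. Qed.

Let hC : h * (64 * C ^+ 2 + 1) <= 1.
Proof. by rewrite /h mulrAC ler_pdivrMr// mul1r ltW// truncnS_gt. Qed.

Let C2 : 0 <= C ^+ 2. Proof. exact: sqr_ge0. Qed.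

(** Each of the [n] steps multiplies [a] by at most 16, and contributes to [A + Q] at most 48 times
    the value of [a] at its right end. *)
Definition gronwall_constant : R := 48 * n%:R * 16 ^+ n.

Lemma gronwall_constant_gt0 : 0 < gronwall_constant.
Proof. by rewrite mulr_gt0 ?exprn_gt0// mulr_gt0. Qed.

Context {a : R -> R} {A Q : R -> R -> R}.
Hypotheses (a0 : forall t, 0 <= t <= T -> 0 <= a t)
  (A0 : forall t u, 0 <= t -> t <= u -> u <= T -> 0 <= A t u)
  (Q0 : forall t u, 0 <= t -> t <= u -> u <= T -> 0 <= Q t u)
  (step : forall t u, 0 <= t -> t < u -> u <= T ->
    a t + Q t u <= 8 * a u + 32 * C ^+ 2 * (u - t) * (A t u + Q t u))
  (A_le : forall t u M, 0 <= t -> t <= u -> u <= T ->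
    (forall s, t <= s <= u -> a s <= M) -> A t u <= (u - t) * M)
  (A_mono : forall t t' u, 0 <= t -> t <= t' -> t' <= u -> u <= T -> A t' u <= A t u)
  (QT : Q T T = 0)
  (A_add : forall t u v, 0 <= t -> t <= u -> u <= v -> v <= T -> A t v <= A t u + A u v)
  (Q_add : forall t u v, 0 <= t -> t <= u -> u <= v -> v <= T -> Q t v <= Q t u + Q u v).

(** With the drift coefficient at most one half, [a s <= 8 * a u + A t u / 2] for all [s] in
    [[t, u]]. Bounding [A t u] by this value, as [h <= 1], gives [A t u <= 16 * a u], hence
    [a t <= 16 * a u]. What is left of the inequality at [t] gives [Q t u <= 32 * a u], and 48 is
    the sum. *)
Let short_step t u : 0 <= t -> t < u -> u <= T -> u - t <= h ->
  a t <= 16 * a u /\ A t u + Q t u <= 48 * a u.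
Proof.
move=> t0 ltu uT uth; have tu := ltW ltu.
have uT' : 0 <= u <= T by rewrite uT (le_trans t0 tu).
have au := a0 u uT'.
have small s : t <= s -> s < u -> a s + Q s u <= 8 * a u + 2^-1 * (A s u + Q s u).
  move=> ts su; have s0 := le_trans t0 ts; have su' := ltW su.
  apply: le_trans (step s u s0 su uT) _; rewrite lerD2l.
  have AQ : 0 <= A s u + Q s u by rewrite addr_ge0 ?A0 ?Q0.
  rewrite ler_wpM2r//.
  have h1 : 32 * C ^+ 2 * (u - s) <= 32 * C ^+ 2 * h.
    apply: ler_wpM2l; first by rewrite mulr_ge0.
    by apply: le_trans uth; rewrite lerB.
  apply: le_trans h1 _; move: hC h0.
  rewrite (_ : h * (64 * C ^+ 2 + 1) = 2 * (32 * C ^+ 2 * h) + h); last by ring.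
  by move: (32 * C ^+ 2 * h) h => p q *; lra.
have h1 : h <= 1.
  have := hC; have : 0 <= h * (64 * C ^+ 2) by apply: mulr_ge0; [exact: ltW|rewrite mulr_ge0].
  by rewrite mulrDr mulr1 => *; lra.
have as_le s : t <= s <= u -> a s <= 8 * a u + 2^-1 * A t u.
  move=> /andP[ts]; rewrite le_eqVlt => /predU1P[->|su].
    have := A0 t u t0 tu uT; lra.
  have s0 := le_trans t0 ts; have su' := ltW su.
  have := small s ts su; have := A_mono t s u t0 ts su' uT; have := Q0 s u s0 su' uT; lra.
have A1 : A t u <= 8 * a u + 2^-1 * A t u.
  apply: le_trans (A_le t u _ t0 tu uT as_le) _.
  rewrite -[leRHS]mul1r ler_wpM2r//; last exact: le_trans h1.
  by have := A0 t u t0 tu uT; lra.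
have tt : t <= t <= u by rewrite lexx.
split; first by have := as_le t tt; lra.
have tT : 0 <= t <= T by rewrite t0 (le_trans tu uT).
by have := small t (lexx t) ltu; have := a0 t tT; lra.
Qed.

Lemma backward_gronwall : A 0 T + Q 0 T <= gronwall_constant * a T.
Proof.
have TT : 0 <= T <= T by rewrite lexx ltW.
have aT := a0 T TT.
(* Induction on the number of steps taken back from [T]; after [n] of them the time 0 is reached,
   since [n%:R * h = T]. *)
suff H k : (k <= n)%N -> a (T - k%:R * h) <= 16 ^+ k * a T /\
    A (T - k%:R * h) T + Q (T - k%:R * h) T <= 48 * k%:R * 16 ^+ k * a T.
  have [_] := H n (leqnn n); rewrite (_ : T - n%:R * h = 0)//.
  by rewrite /h mulrC divfK ?subrr// gt_eqF.
elim: k => [_|k IH kn].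
  rewrite mul0r subr0 expr0 mul1r mulr0 !mul0r QT addr0; split => //.
  have := A_le T T (a T) (ltW T0) (lexx T) (lexx T); rewrite subrr mul0r; apply.
  by move=> s; rewrite -eq_le => /eqP <-.
have [aI AQI] := IH (ltnW kn).
set u := T - k%:R * h in aI AQI *.
have tE : T - k.+1%:R * h = u - h by rewrite /u -natr1; ring.
rewrite tE.
have t0 : 0 <= u - h.
  rewrite -tE subr_ge0 /h mulrCA -[leRHS]mulr1 ler_pM2l// ler_pdivrMr// mul1r ler_nat//.
have hh := ltW h0.
have tu : u - h < u by rewrite gtrBl.
have tu' := ltW tu.
have uT : u <= T by rewrite /u gerBl mulr_ge0.
have ut : u - (u - h) <= h by rewrite subKr.
have [at_ AQ] := short_step _ _ t0 tu uT ut.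
have p0 : 0 <= 16 ^+ k :> R by rewrite exprn_ge0.
split.
  by rewrite exprS -mulrA; apply: le_trans at_ _; rewrite ler_pM2l.
have AA := A_add _ _ _ t0 tu' uT (lexx T).
have QQ := Q_add _ _ _ t0 tu' uT (lexx T).
have -> : 48 * k.+1%:R * 16 ^+ k.+1 * a T = 16 * (48 * k%:R * 16 ^+ k * a T) + 16 * 48 * (16 ^+ k * a T).
  by rewrite -natr1 exprS; ring.
have k0 : 0 <= 48 * k%:R * 16 ^+ k * a T by rewrite !mulr_ge0.
have b0 : 0 <= 16 ^+ k * a T by rewrite mulr_ge0.
move: AA QQ AQ aI AQI k0 b0; set b := 16 ^+ k * a T; set b' := 48 * k%:R * _ * _.
move: b b' (A _ T) (Q _ T) (A _ _) (Q _ _) (A _ _) (Q _ _) (a u) => *; lra.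
Qed.

End backward_gronwall.

(** * Comparison of two solutions *)

Section proper_times.
Context {R : realType} {d : measure_display} {Omega : measurableType d}.
Context {P : probability Omega R} {T : R} {l : {measure set R -> \bar R}}.
Hypothesis hl : (\int[l]_(z in Rstar) (z ^+ 2)%:E < +oo)%E.
Notation leb := (@lebesgue_measure R).
Context {z : R -> Omega -> R -> R} (mz : jmeasZ T z).

Let properE w : `[0, T] `&` [set s | L2l l (z s w)] = `[0, T] `&` [set s | (nz l z s w < +oo)%E].
Proof.
apply/seteqP; split => s [sT h]; split => //; first by case: h.
by split=> //; apply: (jmeasZ_section s w _ mz); move: sT; rewrite /= in_itv.
Qed.

Lemma measurable_proper_times w : measurable (`[0, T] `&` [set s | L2l l (z s w)]).
Proof.
rewrite properE; have mF := stmeas_section _ w 0 T (lexx 0) (lexx T) (stmeas_nz hl mz).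
exact: emeasurable_fun_infty_o.
Qed.

(** An integrable function is finite almost everywhere, used twice: over Omega for the time
    integral, then over time for almost every path. *)
Lemma proper_times_full : (stint P 0 T (nz l z) < +oo)%E ->
  {ae P, forall w, leb (`[0, T] `\` [set s | L2l l (z s w)]) = 0%E}.
Proof.
move=> fz; have mS := stmeas_nz hl mz.
have n0 := nz_ge0 (l := l) z.
have mI : measurable_fun setT (fun w => \int[leb]_(s in `[0%R, T]) nz l z s w)%E.
  exact: (stmeas_inner (lexx 0) (lexx T) mS n0).
have I0 w : (0 <= \int[leb]_(s in `[0%R, T]) nz l z s w)%E by exact: integral_ge0.
have intI : P.-integrable setT (fun w => \int[leb]_(s in `[0%R, T]) nz l z s w)%E.
  apply/integrableP; split => //; apply: le_lt_trans fz.
  by rewrite le_eqVlt; apply/orP; left; apply/eqP/eq_integral => w _; rewrite gee0_abs.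
have := integrable_ae measurableT intI; apply: filterS => w /(_ I) fw.
have mw : measurable_fun `[0, T] (nz l z ^~ w).
  exact: (stmeas_section _ w 0 T (lexx 0) (lexx T) mS).
have iw : leb.-integrable `[0, T] (nz l z ^~ w).
  apply/integrableP; split => //.
  under eq_integral do rewrite gee0_abs//.
  by rewrite -ge0_fin_numE.
have [A [mA A0 hA]] : {ae leb, forall s, `[0, T]%classic s -> nz l z s w \is a fin_num}.
  by apply: integrable_ae.
apply: (subset_measure0 _ mA _ A0).
  rewrite -[X in measurable X](_ : `[0, T] `\` (`[0, T] `&` [set s | L2l l (z s w)]) = _).
    by apply: measurableD => //; exact: measurable_proper_times.
  by apply/seteqP; split => s [sT h]; split => // k; apply: h => //; case: k.
move=> s [sT h]; apply: hA => /= k; apply: h; have := k sT; rewrite ge0_fin_numE// => lt.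
by split=> //; apply: (jmeasZ_section s w _ mz); move: sT; rewrite /= in_itv.
Qed.

End proper_times.

Section norml.
Context {R : realType} {l : {measure set R -> \bar R}}.

(** An inequality only, since [norml] takes the value 0 when the integral is infinite. *)
Lemma norml_sq (psi : R -> R) :
  ((norml l psi ^+ 2)%:E <= \int[l]_(z in Rstar) (psi z ^+ 2)%:E)%E.
Proof.
rewrite /norml; set I := (\int[l]_(z in _) _)%E.
have : (0 <= I)%E by apply: integral_ge0 => x _; rewrite lee_fin sqr_ge0.
case: I => [i||] //; last by move=> _; exact: leey.
by rewrite lee_fin => i0; rewrite /= sqr_sqrtr.
Qed.

Lemma sq_sum4_le (C a b c e D : R) : 0 <= C -> 0 <= a -> 0 <= b -> 0 <= c -> 0 <= e ->
  `|D| <= C * (a + b + c + e) -> D ^+ 2 <= 4 * C ^+ 2 * (a ^+ 2 + b ^+ 2 + c ^+ 2 + e ^+ 2).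
Proof.
move=> C0 a0 b0 c0 e0 h; rewrite -[D ^+ 2]real_normK ?num_real//.
apply: (@le_trans _ _ ((C * (a + b + c + e)) ^+ 2)).
  by rewrite lerXn2r// nnegrE// mulr_ge0// !addr_ge0.
rewrite exprMn -subr_ge0.
have -> : 4 * C ^+ 2 * (a ^+ 2 + b ^+ 2 + c ^+ 2 + e ^+ 2) - C ^+ 2 * (a + b + c + e) ^+ 2 =
  C ^+ 2 * ((a - b) ^+ 2 + (a - c) ^+ 2 + (a - e) ^+ 2 + (b - c) ^+ 2 + (b - e) ^+ 2 + (c - e) ^+ 2).
  by ring.
by rewrite mulr_ge0 ?sqr_ge0// !addr_ge0// sqr_ge0.
Qed.

End norml.

Section extended_reals.
Context {R : realType}.
Implicit Types p q r s : \bar R.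

Lemma double_sum_lty p q r : (p < +oo -> q < +oo -> r < +oo -> 2%:E * (p + q + r) < +oo)%E.
Proof.
move=> fp fq fr; apply: lte_mul_pinfty => //.
by apply: lte_add_pinfty => //; exact: lte_add_pinfty.
Qed.

Lemma add3ACA p q r p' q' r' :
  ((p + p') + (q + q') + (r + r') = (p + q + r) + (p' + q' + r'))%E.
Proof. by rewrite (addeACA p p') (addeACA (p + q)%E). Qed.

Lemma fine_add_le p q r : p \is a fin_num -> q \is a fin_num -> r \is a fin_num ->
  (p <= q + r)%E -> fine p <= fine q + fine r.
Proof. by move=> fp fq fr; rewrite -lee_fin EFinD !fineK. Qed.

Lemma fine_step_le (k : R) p q r s : p \is a fin_num -> q \is a fin_num ->
  r \is a fin_num -> s \is a fin_num -> (p + q <= 8%:E * r + k%:E * (s + q))%E ->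
  fine p + fine q <= 8 * fine r + k * (fine s + fine q).
Proof.
case: p => [p||] // _; case: q => [q||] // _; case: r => [r||] // _; case: s => [s||] // _.
Qed.

Lemma add4_le p q r s p' q' r' s' : (p <= p' -> q <= q' -> r <= r' -> s <= s' ->
  p + q + r + s <= p' + (q' + r' + s'))%E.
Proof. by move=> h1 h2 h3 h4; rewrite !addeA; exact: leeD (leeD (leeD h1 h2) h3) h4. Qed.

End extended_reals.

(** * From the equations to the stability estimate *)

Section solutions.
Context {R : realType} {d : measure_display} {Omega : measurableType d}.
Context {P : probability Omega R} {T : R} {l : {measure set R -> \bar R}}.
Context {W B : R -> Omega -> R} {N : Omega -> {measure set (R * R)%type -> \bar R}}.
Hypotheses (hP : measure_is_complete P) (T0 : 0 < T) (hW : standard_brownian P T W)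
  (hB : standard_brownian P T B) (hN : poisson_random_measure P T l N)
  (hWBN : indep3 P <<s brownian_events W T>> <<s brownian_events B T>>
                   <<s poisson_events T N>>)
  (hl : (\int[l]_(z in Rstar) (z ^+ 2)%:E < +oo)%E).
Notation leb := (@lebesgue_measure R).
Local Notation G := (filtG P T l W B N).
Local Notation proper := (proper_times T l).

Let Gm : forall t : R, t <= T -> G t `<=` measurable.
Proof. exact: filtG_measurable. Qed.

(** Subtracting the equation at [u] from the one at [t] cancels [xi] and the values of the integrals
    at [T]. [D] is the total increment of the three stochastic integrals, approximable as a sum of
    three terms with one nonzero component each. *)
Lemma solution_increment {xi f X Y Z zeta} {t u : R} :
  bsdej1 P T l W B N xi f X Y Z zeta -> 0 <= t -> t <= u -> u <= T ->
  exists D : Omega -> R, [/\ measurable_fun setT D,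
    approximable (P := P) (T := T) (l := l) (W := W) (B := B) (N := N) (t := t) (u := u) Y Z zeta D &
    {ae P, forall w, X t w + D w = X u w +
      (\int[leb]_(s in proper Z t w) f s w (X s w) (Y s w) (Z s w) (zeta s w) -
       \int[leb]_(s in proper Z u w) f s w (X s w) (Y s w) (Z s w) (zeta s w))}].
Proof.
move=> [[_ [pY _] [pZ _] [pz _]] _ [MY [MZ [Mz [iY iZ iz eqX]]]]] t0 tu uT.
have mY := predictable_jmeas (ltW T0) Gm pY.
have mZ := predictable_jmeasZ (ltW T0) Gm pZ.
have mz := predictable_jmeas (ltW T0) Gm pz.
have uT' : 0 <= u <= T by rewrite uT (le_trans t0 tu).
have tT' : 0 <= t <= T by rewrite t0 (le_trans tu uT).
have j0 : jmeas T (fun _ (_ : Omega) => 0 : R) by exact: measurable_cst.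
have jZ0 : jmeasZ T (fun _ (_ : Omega) _ => 0 : R) by exact: measurable_cst.
have aY := ito_approximable_W hP hW hB hN t0 tu uT mY iY.
have aZ := jump_approximable hP hW hB hN hl t0 tu uT mZ iZ.
have az := ito_approximable_B hP hW hB hN t0 tu uT mz iz.
have mD (V y M : R -> Omega -> R) : ito_integral P T G V y M -> measurable_fun setT (fun w => M u w - M t w).
  by move=> [phi [_ h]]; have [? _] := h u uT'; have [? _] := h t tT'; exact: measurable_funB.
have mDY := mD _ _ _ iY; have mDz := mD _ _ _ iz.
have mDZ : measurable_fun setT (fun w => MZ u w - MZ t w).
  by have [th [_ h]] := iZ; have [? _] := h u uT'; have [? _] := h t tT'; exact: measurable_funB.
have a1 := approximableD hP hW hB hN hl t0 tu uT mY jZ0 j0 mDY j0 mZ j0 mDZ aY aZ.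
have a2 := approximableD hP hW hB hN hl t0 tu uT (measurable_funD mY j0) (measurable_funD jZ0 mZ)
  (measurable_funD j0 j0) (measurable_funD mDY mDZ) j0 jZ0 mz mDz a1 az.
exists (fun w => (MY u w - MY t w) + (MZ u w - MZ t w) + (Mz u w - Mz t w)); split.
- by apply: measurable_funD => //; exact: measurable_funD.
- have e1 : (fun s w => Y s w + 0 + 0) = Y.
    by apply/funext => s; apply/funext => w; rewrite !addr0.
  have e2 : (fun s w x => 0 + Z s w x + 0) = Z.
    by apply/funext => s; apply/funext => w; apply/funext => x; rewrite add0r addr0.
  have e3 : (fun s w => 0 + 0 + zeta s w) = zeta.
    by apply/funext => s; apply/funext => w; rewrite !add0r.
  by move: a2; rewrite e1 e2 e3.
- apply: filterS2 (eqX t tT') (eqX u uT') => w.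
  move: (\int[leb]_(s in proper Z t w) _) (\int[leb]_(s in proper Z u w) _) => I1 I2.
  by move=> -> ->; ring.
Qed.

(** At [T] the drift is integrated over a single point, or over the empty set when [Z T w] is not in
    [L2l]. *)
Lemma solution_terminal {xi f X Y Z zeta} : bsdej1 P T l W B N xi f X Y Z zeta ->
  {ae P, forall w, X T w = xi w}.
Proof.
move=> [_ _ [MY [MZ [Mz [_ _ _ eqX]]]]].
have TT : 0 <= T <= T by rewrite lexx ltW.
apply: filterS (eqX T TT) => w ->; rewrite !subrr !subr0.
suff -> : \int[leb]_(s in proper Z T w) f s w (X s w) (Y s w) (Z s w) (zeta s w) = 0 by rewrite addr0.
have [LT|nLT] := pselect (L2l l (Z T w)).
  rewrite (_ : proper Z T w = [set T]) ?Rintegral_set1//.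
  rewrite /proper_times set_itv1; apply/seteqP; split => s /=; first by case.
  by move=> ->; split.
rewrite (_ : proper Z T w = set0) ?Rintegral_set0//.
by rewrite /proper_times set_itv1; apply/seteqP; split => s // -[/= ->].
Qed.

Section comparison.
Context {xi xi' : Omega -> R} (mxi : measurable_fun setT xi) (mxi' : measurable_fun setT xi').
Context {f : R -> Omega -> R -> R -> (R -> R) -> R}
  {f' : R -> Omega -> R -> R -> (R -> R) -> R -> R}.
Context {X Y : R -> Omega -> R} {Z : R -> Omega -> R -> R}.
Context {X' Y' : R -> Omega -> R} {Z' : R -> Omega -> R -> R} {zeta' : R -> Omega -> R}.
Hypotheses (sol : bsdej P T l W N xi f X Y Z)
  (sol' : bsdej1 P T l W B N xi' f' X' Y' Z' zeta').
Context {C : R} (C0 : 0 < C).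
Hypothesis hff' : {ae P, forall w, forall t : R, 0 <= t <= T ->
  forall x1 x2 y1 y2 z1 z2 zeta, L2l l z1 -> L2l l z2 ->
  `|f t w x1 y1 z1 - f' t w x2 y2 z2 zeta|
    <= C * (`|x1 - x2| + `|y1 - y2| + norml l (z1 \- z2) + `|zeta|)}.

Let sol1 := bsdej_bsdej1 (B := B) sol.

Let x s w := X s w - X' s w.
Let y s w := Y s w - Y' s w.
Let z s w r := Z s w r - Z' s w r.
Let c s w := 0 - zeta' s w.

Let mY : jmeas T Y.
Proof. by have [[_ [p _] _ _] _ _] := sol1; exact: (predictable_jmeas (ltW T0) Gm p). Qed.

Let mY' : jmeas T Y'.
Proof. by have [[_ [p _] _ _] _ _] := sol'; exact: (predictable_jmeas (ltW T0) Gm p). Qed.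

Let mZ : jmeasZ T Z.
Proof. by have [[_ _ [p _] _] _ _] := sol1; exact: (predictable_jmeasZ (ltW T0) Gm p). Qed.

Let mZ' : jmeasZ T Z'.
Proof. by have [[_ _ [p _] _] _ _] := sol'; exact: (predictable_jmeasZ (ltW T0) Gm p). Qed.

Let mc' : jmeas T zeta'.
Proof. by have [[_ _ _ [p _]] _ _] := sol'; exact: (predictable_jmeas (ltW T0) Gm p). Qed.

Let j0 : jmeas T (fun _ (_ : Omega) => 0 : R). Proof. exact: measurable_cst. Qed.

Let mc : jmeas T c. Proof. exact: jmeasB. Qed.

Let my : jmeas T y. Proof. exact: jmeasB. Qed.

Let mz : jmeasZ T z. Proof. exact: jmeasZB. Qed.

Section step.
Context {x' : R -> Omega -> R} (mx' : jmeas T x')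
  (xx' : {ae P, forall w, forall s : R, 0 <= s <= T -> x' s w = x s w}).
Hypothesis sx : forall t : R, 0 <= t <= T -> sqint P (x t).

(** Times [4 * C ^+ 2], this is the majorant of the squared difference of the drifts. It is built
    from the version [x'], which makes it jointly measurable. *)
Let total s w : \bar R := (sq x' s w + sq y s w + nz l z s w + sq c s w)%E.

Let mtotal : stmeas T total.
Proof.
apply: stmeasD; last exact: stmeas_sq.
apply: stmeasD; last exact: stmeas_nz.
by apply: stmeasD; exact: stmeas_sq.
Qed.

Let total0 s w : (0 <= total s w)%E.
Proof.
apply: adde_ge0; last exact: sq_ge0.
by apply: adde_ge0; [apply: adde_ge0; exact: sq_ge0|exact: nz_ge0].
Qed.

Section interval.
Context {t u : R} (t0 : 0 <= t) (tu : t < u) (uT : u <= T).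
Local Notation qn := (qnorm P l t u y z c).
Local Notation A := (stint P t u (sq x')).

Let totalE : stint P t u total = (A + qn)%E.
Proof.
have sx' := stmeas_sq mx'; have sy := stmeas_sq my.
have sz := stmeas_nz hl mz; have sc := stmeas_sq mc.
rewrite /total (stintD t0 uT)//.
- rewrite (stintD t0 uT)//; last 3 first.
  + exact: stmeasD.
  + by move=> s w; apply: adde_ge0; exact: sq_ge0.
  + exact: nz_ge0.
  rewrite (stintD t0 uT)//; [|exact: sq_ge0|exact: sq_ge0].
  by rewrite /qnorm !addeA.
- by apply: stmeasD => //; exact: stmeasD.
- move=> s w; apply: adde_ge0; last exact: nz_ge0.
  by apply: adde_ge0; exact: sq_ge0.
- exact: sq_ge0.
Qed.

Let dom (s : R) w : 0 <= s <= T -> x' s w = x s w ->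
  (forall x1 x2 y1 y2 z1 z2 zeta, L2l l z1 -> L2l l z2 -> `|f s w x1 y1 z1 - f' s w x2 y2 z2 zeta|
    <= C * (`|x1 - x2| + `|y1 - y2| + norml l (z1 \- z2) + `|zeta|)) ->
  L2l l (Z s w) -> L2l l (Z' s w) ->
  (((f s w (X s w) (Y s w) (Z s w) - f' s w (X' s w) (Y' s w) (Z' s w) (zeta' s w)) ^+ 2)%:E
    <= (4 * C ^+ 2)%:E * total s w)%E.
Proof.
move=> sT ex hf L L'.
have h := hf (X s w) (X' s w) (Y s w) (Y' s w) _ _ (zeta' s w) L L'.
have := sq_sum4_le _ _ _ _ _ _ (ltW C0) (normr_ge0 _) (normr_ge0 _) (sqrtr_ge0 _) (normr_ge0 _) h.
rewrite -lee_fin => /le_trans; apply.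
rewrite EFinM; apply: lee_wpmul2l; first by rewrite lee_fin mulr_ge0// sqr_ge0.
rewrite !EFinD /total /sq ex.
apply: leeD; last by rewrite lee_fin /c sub0r sqrrN real_normK ?num_real.
apply: leeD; last exact: norml_sq.
by apply: leeD; rewrite lee_fin real_normK ?num_real.
Qed.

(** The factor 8 is the 4 of [stochastic_integral_ge] times the 2 of [msqD]; the drift adds
    [(u - t) * (4 * C ^+ 2)], by Cauchy-Schwarz on each path and the four-term Lipschitz bound. *)
Lemma one_step : (msq P (x t) + qn <=
  8%:E * msq P (x u) + (32 * C ^+ 2 * (u - t))%:E * (A + qn))%E.
Proof.
have tu' := ltW tu.
have uT' : 0 <= u <= T by rewrite uT (le_trans t0 tu').
have tT' : 0 <= t <= T by rewrite t0 (le_trans tu' uT).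
have [D [mD aD eD]] := solution_increment sol1 t0 tu' uT.
have [D' [mD' aD' eD']] := solution_increment sol' t0 tu' uT.
have aDD : approximable (P := P) (T := T) (l := l) (W := W) (B := B) (N := N) (t := t) (u := u)
    y z c (fun w => D w - D' w).
  exact: (approximableD hP hW hB hN hl t0 tu' uT mY mZ j0 mD (measurable_funN mY')
    (measurable_funN mZ') (measurable_funN mc') (measurable_funN mD') aD (approximableN aD')).
have [mxt _] := sx t tT'; have [mxu _] := sx u uT'.
have mDD : measurable_fun setT (fun w => D w - D' w) by exact: measurable_funB.
have ev : events_on setT (x t) `<=` G t.
  have [[[aX _ _] _ _ _] _ _] := sol1; have [[[aX' _ _] _ _ _] _ _] := sol'.
  apply: events_onB; first exact: filtG_sigma.
    exact: aX.
  exact: aX'.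
have := stochastic_integral_ge hP hW hB hN hWBN hl t0 tu' uT my mz mc mDD aDD (sx t tT') ev.
move/le_trans; apply.
(* Almost surely the difference of the drift increments, but written through [x] and the stochastic
   integrals: in this form its measurability is at hand. *)
pose V w := x t w + (D w - D' w) - x u w.
have mV : measurable_fun setT V by apply: measurable_funB => //; exact: measurable_funD.
have -> : (fun w => x t w + (D w - D' w)) = (fun w => x u w + V w).
  by apply/funext => w; rewrite /V; ring.
have four : (0 <= 4%:E :> \bar R)%E by rewrite lee_fin.
have two : (0 <= 2%:E :> \bar R)%E by rewrite lee_fin.
apply: le_trans (lee_wpmul2l four (msqD mxu mV)) _.
have h0 : 0 < u - t by rewrite subr_gt0.
have C4 : 0 <= 4 * C ^+ 2 by rewrite mulr_ge0// sqr_ge0.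
have VV : (msq P V <= ((u - t) * (4 * C ^+ 2))%:E * (A + qn))%E.
  rewrite -totalE EFinM -muleA.
  rewrite -(stintZ t0 uT)//.
  have mF : stmeas T (fun s w => (4 * C ^+ 2)%:E * total s w)%E by exact: stmeasZ.
  have F0 s w : (0 <= (4 * C ^+ 2)%:E * total s w)%E by apply: mule_ge0; rewrite ?lee_fin.
  have mI := stmeas_inner t0 uT mF F0.
  rewrite -ge0_integralZl_EFin//; last 2 first.
  - by move=> w _; exact: integral_ge0.
  - exact: ltW.
  apply: ae_ge0_integral_mono.
  - by move=> w; rewrite lee_fin sqr_ge0.
  - by move=> w; apply: mule_ge0; [rewrite lee_fin ltW|exact: integral_ge0].
  - by apply: emeasurable_funM => //; exact: measurable_cst.
  have [[_ _ [_ fz] _] intD _] := sol1; have [[_ _ [_ fz'] _] intD' _] := sol'.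
  have L0 := proper_times_full hl mZ fz.
  have L0' := proper_times_full hl mZ' fz'.
  near=> w.
  have eV : V w = (\int[leb]_(s in proper Z t w) f s w (X s w) (Y s w) (Z s w) -
      \int[leb]_(s in proper Z u w) f s w (X s w) (Y s w) (Z s w)) -
      (\int[leb]_(s in proper Z' t w) f' s w (X' s w) (Y' s w) (Z' s w) (zeta' s w) -
       \int[leb]_(s in proper Z' u w) f' s w (X' s w) (Y' s w) (Z' s w) (zeta' s w)).
    have e1 : X t w + D w = X u w + (\int[leb]_(s in proper Z t w) f s w (X s w) (Y s w) (Z s w) -
      \int[leb]_(s in proper Z u w) f s w (X s w) (Y s w) (Z s w)) by near: w.
    have e2 : X' t w + D' w = X' u w +
      (\int[leb]_(s in proper Z' t w) f' s w (X' s w) (Y' s w) (Z' s w) (zeta' s w) -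
       \int[leb]_(s in proper Z' u w) f' s w (X' s w) (Y' s w) (Z' s w) (zeta' s w)) by near: w.
    move: e1 e2; rewrite /V /x.
    move: (_ - _) (\int[leb]_(s in proper Z' t w) _ - _) => I1 I2 e1 e2.
    have -> : I1 = X t w + D w - X u w by rewrite e1; ring.
    have -> : I2 = X' t w + D' w - X' u w by rewrite e2; ring.
    by ring.
  rewrite eV; apply: (path_increment_le t0 tu' uT
    (measurable_proper_times hl mZ w) (measurable_proper_times hl mZ' w)).
  - by near: w.
  - by near: w.
  - by near: w; exact: intD.
  - by near: w; exact: intD'.
  - exact: (stmeas_section _ w _ _ t0 uT mF).
  - by move=> s; exact: F0.
  - move=> s sT Ls Ls'; apply: dom => //.
      by move: s sT {Ls Ls'}; near: w; exact: xx'.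
    by move: s sT {Ls Ls'}; near: w; exact: hff'.
  - exact: tu.
apply: le_trans (lee_wpmul2l four (lee_wpmul2l two (leeD (lexx _) VV))) _.
rewrite muleA -EFinM ge0_muleDr; last 2 first.
- exact: msq_ge0.
- apply: mule_ge0; first by rewrite lee_fin mulr_ge0// ltW.
  by apply: adde_ge0; [exact: (stint_ge0 (sq_ge0 x'))|exact: qnorm_ge0].
rewrite muleA -EFinM.
rewrite (_ : 4 * 2 = 8 :> R); last by ring.
by rewrite (_ : 8 * ((u - t) * (4 * C ^+ 2)) = 32 * C ^+ 2 * (u - t)); last by ring.
Unshelve. all: by end_near. Qed.

End interval.

End step.

Local Notation qn t u := (qnorm P l t u y z c).

(** Absorbing a term into the left-hand side is legitimate only for finite quantities; this lets the
    Gronwall argument run in the reals. *)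
Let qn_fin : (qn 0 T < +oo)%E.
Proof.
apply: le_lt_trans (qnorm_split (P := P) hl (lexx 0) (lexx T) mY (measurable_funN mY') mZ
  (measurable_funN mZ') j0 (measurable_funN mc')) _.
have fin (a : R -> Omega -> R) (b : R -> Omega -> R -> R) (e : R -> Omega -> R) :
    (stint P 0 T (sq a) < +oo -> stint P 0 T (nz l b) < +oo ->
     stint P 0 T (sq e) < +oo -> 2%:E * qnorm P l 0 T a b e < +oo)%E.
  exact: double_sum_lty.
have [[_ [_ fY] [_ fZ] [_ fz]] _ _] := sol1; have [[_ [_ fY'] [_ fZ'] [_ fz']] _ _] := sol'.
apply: (lte_add_pinfty (fin _ _ _ fY fZ fz)).
have -> := qnorm_opp (P := P) (l := l) (t := 0) (u := T) (y := Y') (z := Z') (c := zeta')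
  (fun _ _ => erefl) (fun _ _ _ => erefl) (fun _ _ => erefl).
exact: (fin _ _ _ fY' fZ' fz').
Qed.

Let qn_mono t u : 0 <= t -> u <= T -> (qn t u <= qn 0 T)%E.
Proof.
move=> t0 uT; have sy := stmeas_sq my; have sz := stmeas_nz hl mz; have sc := stmeas_sq mc.
apply: leeD; last by apply: (stint_mono (lexx 0) t0 uT (lexx T) sc); exact: sq_ge0.
apply: leeD; first by apply: (stint_mono (lexx 0) t0 uT (lexx T) sy); exact: sq_ge0.
by apply: (stint_mono (lexx 0) t0 uT (lexx T) sz); exact: nz_ge0.
Qed.

Let qn_add t u v : 0 <= t -> t <= u -> u <= v -> v <= T -> (qn t v <= qn t u + qn u v)%E.
Proof.
move=> t0 tu uv vT.
have sy := stmeas_sq my; have sz := stmeas_nz hl mz; have sc := stmeas_sq mc.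
have h1 := stint_setU (P := P) t0 (le_trans uv vT) (sq y) tu uv vT sy (sq_ge0 y).
have h2 := stint_setU (P := P) t0 (le_trans uv vT) (nz l z) tu uv vT sz (nz_ge0 z).
have h3 := stint_setU (P := P) t0 (le_trans uv vT) (sq c) tu uv vT sc (sq_ge0 c).
apply: le_trans (leeD (leeD h1 h2) h3) _; rewrite le_eqVlt; apply/orP; left; apply/eqP.
exact: add3ACA.
Qed.

(** The Gronwall bound is taken on all of [[0, T]], and the error from [t] on is at most the error
    from 0 on. The constant involves only [C] and [T], hence its uniformity in the data. *)
Lemma stability_estimate (t : R) : 0 <= t <= T ->
  (bsde_error P T l t X Y Z X' Y' Z' zeta' <=
   (gronwall_constant C T)%:E * 'E_P[fun w => ((xi w - xi' w) ^+ 2)%R])%E.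
Proof.
move=> tT; have /andP[t0 tleT] := tT.
have [[sX _ _ _] _ _] := sol1; have [[sX' _ _ _] _ _] := sol'.
have [sx [S bS] [x' [mx' xx']]] := S2T_difference T0 Gm sX sX'.
have TT : 0 <= T <= T by rewrite lexx ltW.
have q0 v u : (0 <= qn v u)%E by exact: qnorm_ge0.
have qf v u : 0 <= v -> u <= T -> qn v u \is a fin_num.
  by move=> v0 uT; rewrite (ge0_fin_numE (q0 v u)); exact: (le_lt_trans (qn_mono v u v0 uT) qn_fin).
pose A v u := stint P v u (sq x').
have sx' := stmeas_sq mx'.
have A0 v u : (0 <= A v u)%E by exact: (stint_ge0 (sq_ge0 x')).
have mE s : 0 <= s <= T -> msq P (x s) = (\int[P]_w sq x' s w)%E.
  move=> sT; apply: msq_ae.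
  - by case: (sx s sT).
  - have h : stmeas T (fun s w => (x' s w)%:E) by apply/measurable_EFinP.
    by have := stmeas_time _ s sT h => /measurable_EFinP.
  - by apply: filterS xx' => w ->.
(* Tonelli for the jointly measurable version; at each fixed time its second moment equals that of
   [x]. *)
have A_le v u (M : R) : 0 <= v -> v <= u -> u <= T ->
    (forall s, v <= s <= u -> (msq P (x s) <= M%:E)%E) -> (A v u <= ((u - v) * M)%:E)%E.
  move=> v0 vu uT h.
  have sT s : v <= s <= u -> 0 <= s <= T.
    by move=> /andP[vs su]; rewrite (le_trans v0 vs) (le_trans su uT).
  rewrite /A (stint_tonelli v0 uT sx' (sq_ge0 x')).
  apply: (@le_trans _ _ (\int[leb]_(s in `[v, u]) (cst M%:E s))%E).
    apply: ge0_le_integral => //.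
    - by move=> s _; apply: integral_ge0 => w _; exact: sq_ge0.
    - exact: (stmeas_outer v0 uT sx' (sq_ge0 x')).
    - by move=> s /=; rewrite in_itv/= => vsu; rewrite -mE ?sT// h.
  rewrite integral_cst//.
  have len : leb (`[v, u]%classic : set R) = (u - v)%:E.
    rewrite lebesgue_measure_itv/= lte_fin; case: ltP => // uv.
    by rewrite (@le_anti _ _ v u) ?subrr// vu.
  apply: (@le_trans _ _ (M%:E * (u - v)%:E)%E); first by rewrite -len.
  by rewrite -EFinM lee_fin mulrC.
have Af v u : 0 <= v -> v <= u -> u <= T -> A v u \is a fin_num.
  move=> v0 vu uT; rewrite ge0_fin_numE//.
  apply: le_lt_trans (A_le v u S v0 vu uT _) _; last exact: ltry.
  by move=> s /andP[vs su]; apply: bS; rewrite (le_trans v0 vs) (le_trans su uT).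
have mf s : 0 <= s <= T -> msq P (x s) \is a fin_num.
  by move=> sT; rewrite ge0_fin_numE ?msq_ge0// (le_lt_trans (bS s sT) (ltry _)).
have main : fine (A 0 T) + fine (qn 0 T) <= gronwall_constant C T * fine (msq P (x T)).
  apply: (backward_gronwall C T T0 (a := fun s => fine (msq P (x s)))
    (A := fun v u => fine (A v u)) (Q := fun v u => fine (qn v u))).
  - by move=> s _; rewrite fine_ge0// msq_ge0.
  - by move=> v u *; rewrite fine_ge0.
  - by move=> v u *; rewrite fine_ge0.
  - move=> v u v0 vu uT.
    have vT' : 0 <= v <= T by rewrite v0 (le_trans (ltW vu) uT).
    have uT' : 0 <= u <= T by rewrite uT (le_trans v0 (ltW vu)).
    exact: (fine_step_le _ _ _ _ _ (mf v vT') (qf v u v0 uT) (mf u uT') (Af v u v0 (ltW vu) uT)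
      (one_step mx' xx' sx v0 vu uT)).
  - move=> v u M v0 vu uT h; rewrite -lee_fin fineK ?Af//; apply: A_le => // s vsu.
    rewrite -(fineK (mf s _)) ?lee_fin ?h//.
    by case/andP: vsu => vs su; rewrite (le_trans v0 vs) (le_trans su uT).
  - move=> v v' u v0 vv' v'u uT; apply: fine_le.
    + exact: (Af _ _ (le_trans v0 vv') v'u uT).
    + exact: (Af _ _ v0 (le_trans vv' v'u) uT).
    exact: (stint_mono v0 vv' (lexx u) uT sx' (sq_ge0 x')).
  - have zero (F : R -> Omega -> \bar R) : stint P T T F = 0%E.
      by apply: integral0_eq => w _; rewrite set_itv1 integral_set1.
    by rewrite /qnorm !zero !adde0.
  - move=> v u v' v0 vu uv' v'T; have uT := le_trans uv' v'T; have u0 := le_trans v0 vu.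
    apply: (fine_add_le _ _ _ (Af _ _ v0 (le_trans vu uv') v'T) (Af _ _ v0 vu uT) (Af _ _ u0 uv' v'T)).
    exact: (stint_setU v0 uT (sq x') vu uv' v'T sx' (sq_ge0 x')).
  - move=> v u v' v0 vu uv' v'T; have uT := le_trans uv' v'T; have u0 := le_trans v0 vu.
    exact: (fine_add_le _ _ _ (qf _ _ v0 v'T) (qf _ _ v0 uT) (qf _ _ u0 v'T)
      (qn_add v u v' v0 vu uv' v'T)).
have xT : msq P (x T) = ('E_P[fun w => ((xi w - xi' w) ^+ 2)%R])%E.
  rewrite -msqE; apply: msq_ae.
  - by case: (sx T TT).
  - exact: measurable_funB.
  by apply: filterS2 (solution_terminal sol1) (solution_terminal sol') => w; rewrite /x => -> ->.
rewrite -xT -(fineK (mf T TT)) -EFinM.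
apply: (@le_trans _ _ (A 0%R T + qn 0%R T)%E); last first.
  by rewrite -(fineK (Af 0 T (lexx 0) (ltW T0) (lexx T))) -(fineK (qf 0 T (lexx 0) (lexx T))) -EFinD lee_fin.
have hc : (sqnormH P t T zeta' <= stint P 0 T (sq c))%E.
  apply: le_trans (stint_mono (lexx 0) t0 (lexx T) (lexx T) (stmeas_sq mc) (sq_ge0 c)).
  rewrite le_eqVlt; apply/orP; left; apply/eqP.
  by apply: eq_integral => w _; apply: eq_integral => s _; rewrite /sq /c sub0r sqrrN.
have hz := stint_mono (P := P) (lexx 0) t0 (lexx T) (lexx T) (stmeas_nz hl mz) (nz_ge0 z).
have hy := stint_mono (P := P) (lexx 0) t0 (lexx T) (lexx T) (stmeas_sq my) (sq_ge0 y).
(* The statement speaks of [X] and [X'], which are not known to be jointly measurable, so the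
   passage to the version is made path by path. *)
have hx : (sqnormH P t T (fun s w => X s w - X' s w)%R <= stint P 0 T (sq x'))%E.
  apply: ae_ge0_integral_mono.
  - by move=> w; apply: integral_ge0 => s _; rewrite lee_fin sqr_ge0.
  - by move=> w; apply: integral_ge0 => s _; exact: sq_ge0.
  - exact: (stmeas_inner (lexx 0) (lexx T) sx' (sq_ge0 x')).
  apply: filterS xx' => w xx'.
  apply: (@le_trans _ _ (\int[leb]_(s in `[t, T]) sq x' s w)%E).
    rewrite le_eqVlt; apply/orP; left; apply/eqP; apply: eq_integral => s.
    rewrite inE/= in_itv/= => /andP[ts sT]; rewrite /sq xx'//.
    by rewrite (le_trans t0 ts).
  apply: ge0_subset_integral => //.
  - exact: (stmeas_section _ w _ _ (lexx 0) (lexx T) sx').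
  - by move=> s _; exact: sq_ge0.
  - by move=> s /=; rewrite !in_itv/= => /andP[ts ->]; rewrite (le_trans t0 ts).
exact: (add4_le _ _ _ _ _ _ _ _ hx hy hz hc).
Qed.

End comparison.

End solutions.

Lemma L2T_measurable {R : realType} {d : measure_display} {Omega : measurableType d}
    {P : probability Omega R} {T : R} {H : R -> set (set Omega)} {eta : Omega -> R} :
  H T `<=` measurable -> L2T P T H eta -> measurable_fun setT eta.
Proof. by move=> HT [eH _] _ A mA; apply: HT; apply: eH; exists A. Qed.

Theorem theorem3p4 (R : realType) (d : measure_display) (Omega : measurableType d)
  (P : probability Omega R) (hP : measure_is_complete P)
  (T : R) (hT : 0 < T)
  (l : {measure set R -> \bar R})
  (hl : (\int[l]_(z in Rstar) (z ^+ 2)%:E < +oo)%E)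
  (W B : R -> Omega -> R)
  (N : Omega -> {measure set (R * R)%type -> \bar R})
  (hW : standard_brownian P T W) (hB : standard_brownian P T B)
  (hN : poisson_random_measure P T l N)
  (hWBN : indep3 P <<s brownian_events W T>> <<s brownian_events B T>>
                   <<s poisson_events T N>>)
  (xi : Omega -> R) (hxi : L2T P T (filtF P T l W N) xi)
  (f : R -> Omega -> R -> R -> (R -> R) -> R)
  (hf : driverB P T l (filtF P T l W N) f)
  (f0 : R -> Omega -> R -> R -> (R -> R) -> R)
  (hf0 : driverB P T l (filtF P T l W N) f0)
  (f1 : R -> Omega -> R -> R -> (R -> R) -> R -> R)
  (hf1 : driverB1 P T l (filtG P T l W B N) f1)
  (C : R) (hC : 0 < C)
  (hff0 : {ae P, forall w, forall t : R, 0 <= t <= T ->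
     forall x1 x2 y1 y2 z1 z2, L2l l z1 -> L2l l z2 ->
     `|f t w x1 y1 z1 - f0 t w x2 y2 z2|
       <= C * (`|x1 - x2| + `|y1 - y2| + norml l (z1 \- z2))})
  (hff1 : {ae P, forall w, forall t : R, 0 <= t <= T ->
     forall x1 x2 y1 y2 z1 z2 zeta, L2l l z1 -> L2l l z2 ->
     `|f t w x1 y1 z1 - f1 t w x2 y2 z2 zeta|
       <= C * (`|x1 - x2| + `|y1 - y2| + norml l (z1 \- z2) + `|zeta|)})
  (xi0 xi1 : R -> Omega -> R)
  (hxi0 : forall e : R, 0 < e -> L2T P T (filtF P T l W N) (xi0 e))
  (hxi1 : forall e : R, 0 < e -> L2T P T (filtG P T l W B N) (xi1 e))
  (cvg_xi0 : 'E_P[fun w => ((xi0 e w - xi w) ^+ 2)%R]%E @[e --> 0^'+] --> 0%E)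
  (cvg_xi1 : 'E_P[fun w => ((xi1 e w - xi w) ^+ 2)%R]%E @[e --> 0^'+] --> 0%E)
  (X Y : R -> Omega -> R) (Z : R -> Omega -> R -> R)
  (hX : bsdej P T l W N xi f X Y Z)
  (X0 Y0 : R -> R -> Omega -> R) (Z0 : R -> R -> Omega -> R -> R)
  (hX0 : forall e : R, 0 < e -> bsdej P T l W N (xi0 e) f0 (X0 e) (Y0 e) (Z0 e))
  (X1 Y1 : R -> R -> Omega -> R) (Z1 : R -> R -> Omega -> R -> R)
  (zeta1 : R -> R -> Omega -> R)
  (hX1 : forall e : R, 0 < e ->
     bsdej1 P T l W B N (xi1 e) f1 (X1 e) (Y1 e) (Z1 e) (zeta1 e)) :
  exists K : R, 0 < K /\ forall e : R, 0 < e -> forall t : R, 0 <= t <= T ->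
    (bsde_error P T l t X Y Z (X0 e) (Y0 e) (Z0 e) (fun _ _ => 0%R)
       <= K%:E * 'E_P[fun w => ((xi w - xi0 e w) ^+ 2)%R])%E /\
    (bsde_error P T l t X Y Z (X1 e) (Y1 e) (Z1 e) (zeta1 e)
       <= K%:E * 'E_P[fun w => ((xi w - xi1 e w) ^+ 2)%R])%E.
Proof.
have mG : filtG P T l W B N T `<=` measurable by exact: filtG_measurable.
have mF : filtF P T l W N T `<=` measurable by apply: subset_trans mG; exact: filtF_subG.
have mxi := L2T_measurable mF hxi.
exists (gronwall_constant C T); split; first exact: gronwall_constant_gt0.
move=> e e0 t tT; split.
  apply: (stability_estimate hP hT hW hB hN hWBN hl mxi (L2T_measurable mF (hxi0 e e0)) hX
    (bsdej_bsdej1 (hX0 e e0)) hC _ _ tT).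
  (* [f0] is read as a driver that is constant in [zeta]; the additional term in [zeta] only weakens
     the bound. *)
  apply: filterS hff0 => w h s sT x1 x2 y1 y2 z1 z2 zeta L1 L2.
  by apply: le_trans (h s sT x1 x2 y1 y2 z1 z2 L1 L2) _; rewrite ler_pM2l// lerDl.
exact: (stability_estimate hP hT hW hB hN hWBN hl mxi (L2T_measurable mG (hxi1 e e0)) hX (hX1 e e0) hC
  hff1 _ tT).
Qed.
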